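(* Let $\Omega=\mathbb T^d_{\boldsymbol L}$, let $\eta,T>0$, and let $\mathbf F\in\mathbb R^d$ be a Diophantine vector with exponent $\tau\ge d-1$, i.e., for some $C>0$, $$|\mathbf F\cdot\boldsymbol g(\boldsymbol k)|\ge\frac{C}{|\boldsymbol k|^\tau}\quad\text{for all }\boldsymbol k\in\mathbb Z^d\setminus\{\boldsymbol 0\},\qquad\boldsymbol g(\boldsymbol k)=\Big(\frac{k_1}{L_1},\dots,\frac{k_d}{L_d}\Big).$$ Assume that the function $\boldsymbol b$ satisfies 1. $\boldsymbol b\in L^2(0,T;H^{\tau+2}_{\mathrm{per}}(\Omega;\mathbb R^d))\cap C([0,T];H^{\tau+1}_{\mathrm{per}}(\Omega;\mathbb R^d))$, 2. $\partial_t\boldsymbol b\in L^2(0,T;H^\tau_{\mathrm{per}}(\Omega;\mathbb R^d))$, 3. $\nabla\cdot\boldsymbol b=0$ for a.e. $t\in[0,T]$, 4. $\int_\Omega\boldsymbol b(t,\boldsymbol x)\,d\boldsymbol x=0$ for a.e. $t\in[0,T]$. Then there exists a unique velocity field $$\boldsymbol v\in\mathbb X:=\{\boldsymbol v\in L^2(0,T;L^2_{\mathrm{per},0}(\Omega;\mathbb R^d)):\ \nabla\cdot\boldsymbol v=0\text{ for a.e. }t\in[0,T]\}$$ satisfying $$\partial_t\boldsymbol b=\eta\nabla^2\boldsymbol b+\nabla\times(\boldsymbol v\times\mathbf F),\qquad\nabla\cdot\boldsymbol b=0.$$ Moreover, $\boldsymbol v$ satisfies the stability estimate $$\|\boldsymbol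 v\|_{L^2(0,T;L^2(\Omega;\mathbb R^d))}\le\frac1{2\pi C}\left\|\partial_t\boldsymbol b-\eta\nabla^2\boldsymbol b\right\|_{L^2(0,T;H^\tau(\Omega;\mathbb R^d))}.$$
   Context: Throughout, $d\in\{2,3\}$. For $\boldsymbol L=(L_1,\dots,L_d)$ with all $L_i>0$, $\mathbb T^d_{\boldsymbol L}$ is the torus with side lengths $L_1,\dots,L_d$. Fourier coefficients $\hat{\boldsymbol u}(\boldsymbol k)\in\mathbb C^d$ are with respect to $e_{\boldsymbol k}(\boldsymbol x)=e^{2\pi\mathrm i\,\boldsymbol g(\boldsymbol k)\cdot\boldsymbol x}$, $\boldsymbol u=\sum_{\boldsymbol k\in\mathbb Z^d}\hat{\boldsymbol u}(\boldsymbol k)e_{\boldsymbol k}$. For $s\ge0$, $H^s_{\mathrm{per}}(\Omega;\mathbb R^d)$ is the periodic Sobolev space with norm $\|\boldsymbol u\|_{H^s}^2=\sum_{\boldsymbol k}(1+|\boldsymbol k|^2)^s|\hat{\boldsymbol u}(\boldsymbol k)|^2$, the case $s=0$ being the (normalized) $L^2$ norm. $L^2_{\mathrm{per},0}(\Omega;\mathbb R^d)$ is the space of periodic $L^2$ vector fields with zero mean over $\Omega$. Equations are understood in the sense of distributions. For constant $\mathbf F$, $\nabla\times(\boldsymbol v\times\mathbf F)=(\mathbf F\cdot\nabla)\boldsymbol v-\mathbf F(\nabla\cdot\boldsymbol v)$; for $d=2$, $\boldsymbol v\times\mathbf F=v_1F_2-v_2F_1$ is a scalar and the curl of a scalar $\psi$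 is $(\partial_2\psi,-\partial_1\psi)$. *)

(* Defs.v *)
From HB Require Import structures.
From mathcomp Require Import all_boot all_order all_algebra.
From mathcomp Require Import all_classical all_reals all_analysis.
From mathcomp Require Import complex.

Set Implicit Arguments.
Unset Strict Implicit.
Unset Printing Implicit Defensive.
Import Order.TTheory GRing.Theory Num.Theory numFieldNormedType.Exports.
Local Open Scope classical_set_scope.
Local Open Scope ring_scope.

Section measurable_rV.
Context (R : realType) (n : nat).

Let coord (i : 'I_n) (x : 'rV[R]_n) : R := x 0 i.

Let rV_set0 : g_sigma_preimage coord set0.
Proof. exact: sigma_algebra0. Qed.

Let rV_setC A : g_sigma_preimage coord A -> g_sigma_preimage coord (~` A).
Proof. exact: sigma_algebraC. Qed.

Let rV_bigcup (G : (set 'rV[R]_n)^nat) :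
  (forall i, g_sigma_preimage coord (G i)) ->
  g_sigma_preimage coord (\bigcup_i (G i)).
Proof. exact: sigma_algebra_bigcup. Qed.

Fact rV_display : measure_display. Proof. exact: default_measure_display. Qed.
HB.instance Definition _ := @isMeasurable.Build rV_display
  'rV[R]_n (g_sigma_preimage coord) rV_set0 rV_setC rV_bigcup.

Lemma measurable_coord (i : 'I_n) :
  measurable_fun [set: 'rV[R]_n] (fun x : 'rV[R]_n => x 0 i).
Proof.
move=> _ Y mY; rewrite setTI; apply: sub_sigma_algebra => /=.
rewrite -bigcup_seq/=; exists i => /=; first by rewrite mem_index_enum.
by exists Y => //; rewrite setTI.
Qed.

Lemma measurable_rV d (T : measurableType d) (f : T -> 'rV[R]_n) :
  (forall i, measurable_fun [set: T] (fun t => f t 0 i)) ->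
  measurable_fun [set: T] f.
Proof.
move=> mf; apply: (@measurability _ _ _ _ _ _
  (\big[setU/set0]_(i < n) preimage_set_system setT (coord i) measurable)).
  by [].
move=> _ [B + <-]; rewrite -bigcup_seq => -[i _] [C mC <-].
rewrite setTI; have := mf i measurableT C mC.
by rewrite !setTI.
Qed.

End measurable_rV.

(* Lebesgue measure on R^n, as an iterated product. *)
Section lebesgue_rV.
Context (R : realType).

Definition cons_rV n (p : R * 'rV[R]_n) : 'rV[R]_n.+1 :=
  \row_i oapp (p.2 0) p.1 (unlift ord0 i).

Let uncons n (x : 'rV[R]_n.+1) : R * 'rV[R]_n :=
  (x 0 ord0, \row_i x 0 (lift ord0 i)).

Let consK n : cancel (@cons_rV n) (@uncons n).
Proof.
move=> [a x]; congr pair; first by rewrite mxE unlift_none.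
by apply/rowP => i; rewrite !mxE liftK.
Qed.

Lemma measurable_cons_rV n : measurable_fun setT (@cons_rV n).
Proof.
apply: measurable_rV => i.
under eq_fun do rewrite mxE.
case: unliftP => [j|] _ /=; last exact: measurable_fst.
by apply: (measurableT_comp (@measurable_coord R n j)); exact: measurable_snd.
Qed.

Let measurable_uncons n : measurable_fun setT (@uncons n).
Proof.
apply: measurable_fun_pair; first exact: measurable_coord.
apply: measurable_rV => i; under eq_fun do rewrite mxE.
exact: measurable_coord.
Qed.

Section lebesgue_cons.
Context n (m : {sigma_finite_measure set 'rV[R]_n -> \bar R}).

Definition lebesgue_cons :=
  pushforward (lebesgue_measure \x m)%E (@cons_rV n).

Let lebesgue_cons0 : lebesgue_cons set0 = 0%E.
Proof. by rewrite /lebesgue_cons /pushforward preimage_set0 (@measure0 _ _ _ (lebesgue_measure \x m)%E). Qed.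

Let lebesgue_cons_ge0 A : (0 <= lebesgue_cons A)%E.
Proof. exact: (@measure_ge0 _ _ _ (lebesgue_measure \x m)%E). Qed.

Let lebesgue_cons_sigma_additive : semi_sigma_additive lebesgue_cons.
Proof.
move=> F mF tF mUF; rewrite /lebesgue_cons /pushforward preimage_bigcup.
have mcons A : measurable A -> measurable (@cons_rV n @^-1` A).
  by move=> mA; rewrite -[X in measurable X]setTI; exact: measurable_cons_rV.
apply: (@measure_semi_sigma_additive _ _ _ (lebesgue_measure \x m)%E).
- by move=> k; exact: mcons.
- apply/trivIsetP => i j _ _ ij; rewrite -preimage_setI.
  by move/trivIsetP : tF => /(_ _ _ _ _ ij) ->//; rewrite preimage_set0.
- by rewrite -preimage_bigcup; exact: mcons.
Qed.

HB.instance Definition _ := isMeasure.Build _ _ _ lebesgue_cons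
  lebesgue_cons0 lebesgue_cons_ge0 lebesgue_cons_sigma_additive.

Let lebesgue_cons_sigma_finite : sigma_finite setT lebesgue_cons.
Proof.
have /sigma_finiteP[F [TF ndF Foo]] :=
  sigma_finiteT (@lebesgue_measure R).
have /sigma_finiteP[G [TG ndG Goo]] := sigma_finiteT m.
exists (fun k => @uncons n @^-1` (F k `*` G k)).
  rewrite -preimage_bigcup predeqE => x; split=> // _.
  have [i _ Fi] : (\bigcup_k F k) (x 0 ord0) by rewrite -TF.
  have [j _ Gj] : (\bigcup_k G k) (@uncons n x).2 by rewrite -TG.
  exists (maxn i j) => //; split.
  - by move: Fi; exact/subsetPset/ndF/leq_maxl.
  - by move: Gj; exact/subsetPset/ndG/leq_maxr.
move=> k; have [mF Fk] := Foo k; have [mG Gk] := Goo k; split.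
  by rewrite -[X in measurable X]setTI; apply: measurable_uncons => //;
    exact: measurableX.
rewrite /lebesgue_cons /pushforward -comp_preimage.
rewrite (_ : _ \o _ = id); last by apply/funext => p /=; rewrite consK.
rewrite preimage_id product_measure1E//.
by rewrite lte_mul_pinfty// ge0_fin_numE.
Qed.

HB.instance Definition _ := Measure_isSigmaFinite.Build _ _ _
  lebesgue_cons lebesgue_cons_sigma_finite.

End lebesgue_cons.

Fixpoint lebesgue_rV n : {sigma_finite_measure set 'rV[R]_n -> \bar R} :=
  if n is n'.+1 then lebesgue_cons (lebesgue_rV n') else @dirac _ 'rV[R]_0 0%R R.

End lebesgue_rV.

Section smooth.
Context (R : realType) (V : normedModType R).

Fixpoint iter_derive (f : V -> R) (vs : seq V) : V -> R :=
  if vs is v :: vs' then 'D_v (iter_derive f vs') else f.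

Definition smooth (f : V -> R) := forall vs : seq V,
  continuous (iter_derive f vs) /\
  forall x v, derivable (iter_derive f vs) x v.

End smooth.

Section torus.
Context (R : realType) (d : nat) (L : 'rV[R]_d).
Implicit Types (u f : 'rV[R]_d -> 'rV[R]_d) (k : 'rV[int]_d).

Definition cell : set 'rV[R]_d := [set x | forall i, 0 <= x 0 i < L 0 i].

Definition volume : R := \prod_i L 0 i.

(* Fields on the torus are L-periodic fields on R^d; integrals over the torus
   are integrals over the fundamental cell. *)
Definition periodic E (f : 'rV[R]_d -> E) :=
  forall x i, f (x + L 0 i *: delta_mx 0 i) = f x.

Definition dot (x y : 'rV[R]_d) : R := \sum_i x 0 i * y 0 i.

Definition freq k : 'rV[R]_d := \row_i ((k 0 i)%:~R / L 0 i).

Definition sqnormZ k : R := \sum_i (k 0 i)%:~R ^+ 2.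

Definition diophantine (F : 'rV[R]_d) (tau C : R) :=
  forall k, k != 0 -> C / Num.sqrt (sqnormZ k) `^ tau <= `|dot F (freq k)|.

(* \hat u(k) = |cell|^-1 \int_cell u(x) exp(- 2 i pi g(k).x) dx *)
Definition fourier_coef u k : 'rV[R[i]]_d := \row_i Complex
  (volume^-1 * \int[lebesgue_rV R d]_(x in cell)
    (u x 0 i * cos (2 * pi * dot (freq k) x)))
  (- (volume^-1 * \int[lebesgue_rV R d]_(x in cell)
    (u x 0 i * sin (2 * pi * dot (freq k) x)))).

Definition sqnormC (z : 'rV[R[i]]_d) : R :=
  \sum_i (complex.Re (z 0 i) ^+ 2 + complex.Im (z 0 i) ^+ 2).

Definition L2_sqnorm u : \bar R :=
  ((volume^-1)%:E *
    \int[lebesgue_rV R d]_(x in cell) (dot (u x) (u x))%:E)%E.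

Definition L2per : set ('rV[R]_d -> 'rV[R]_d) := [set u |
  [/\ measurable_fun setT u, periodic u & (L2_sqnorm u < +oo)%E]].

Definition zero_mean u :=
  forall i, \int[lebesgue_rV R d]_(x in cell) u x 0 i = 0.

Definition L2per0 : set ('rV[R]_d -> 'rV[R]_d) := [set u |
  L2per u /\ zero_mean u].

(* The weight uses the integer vector k itself, not the frequency g(k). *)
Definition Hs_sqnorm (s : R) u : \bar R :=
  \esum_(k in [set: 'rV[int]_d])
    ((1 + sqnormZ k) `^ s * sqnormC (fourier_coef u k))%:E.

Definition Hsper (s : R) : set ('rV[R]_d -> 'rV[R]_d) := [set u |
  L2per u /\ (Hs_sqnorm s u < +oo)%E].

Definition div_free u := forall phi : 'rV[R]_d -> R,
  smooth phi -> periodic phi ->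
  \int[lebesgue_rV R d]_(x in cell)
    (\sum_i u x 0 i * 'D_(delta_mx 0 i) phi x) = 0.

Definition ae_eq_field u f :=
  {ae lebesgue_rV R d, forall x, cell x -> u x = f x}.

End torus.

Lemma lebesgue_rV_cell (R : realType) n (L : 'rV[R]_n) :
  (forall i, 0 <= L 0 i) ->
  measurable (cell L) /\ lebesgue_rV R n (cell L) = (volume L)%:E.
Proof.
elim: n L => [|n IH] L L0.
  have -> : cell L = setT by apply/seteqP; split => // x _ [].
  by split => //=; rewrite /volume big_ord0 diracT.
have [i|mc Ec] := IH (\row_i L 0 (lift ord0 i)); first by rewrite mxE.
split.
  rewrite (_ : cell L = \big[setI/setT]_(i < n.+1) [set x : 'rV[R]_n.+1 | x 0 i \in `[0, L 0 i[]).
    apply: bigsetI_measurable => i _.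
    by have := @measurable_coord R n.+1 i measurableT _ (measurable_itv `[0, L 0 i[); rewrite setTI.
  rewrite -bigcap_seq; apply/seteqP; split => x /= H i.
    by move=> _ /=; rewrite in_itv /=; exact: H.
  by have /= := H i; rewrite in_itv/=; apply; rewrite mem_index_enum.
rewrite /= /lebesgue_cons /pushforward.
rewrite (_ : _ @^-1` _ = [set` `[0, L 0 ord0[] `*` cell (\row_i L 0 (lift ord0 i))).
  rewrite product_measure1E// /volume big_ord_recl EFinM.
  congr (_ * _)%E; first by
    (etransitivity; first exact: lebesgue_measure_itv);
    rewrite /= lte_fin -EFinD subr0;
    case: ltP (L0 ord0) => // a b; congr EFin; apply/le_anti; rewrite a b.
  by rewrite -/(lebesgue_rV R n) Ec /volume; congr EFin; apply: eq_bigr => i _; rewrite mxE.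
apply/seteqP; split => -[a x] /=.
  move=> H; split => /=; first by have := H ord0; rewrite mxE unlift_none in_itv.
  by move=> i; have := H (lift ord0 i); rewrite !mxE liftK.
move=> [/=]; rewrite in_itv/= => H1 H2 i; rewrite mxE.
by case: unliftP => [j|] -> //=; have := H2 j; rewrite mxE.
Qed.

Section bochner.
Context (R : realType) (d : nat).
(* X is a space of fields on the torus and N the square of its norm; an element
   of L^2(0, T; X) is a function of t that is strongly measurable, i.e. an a.e.
   limit, in norm, of simple functions. *)
Variables (X : set ('rV[R]_d -> 'rV[R]_d))
  (N : ('rV[R]_d -> 'rV[R]_d) -> \bar R) (T : R).
Implicit Types u S : R -> 'rV[R]_d -> 'rV[R]_d.

Definition simple_field S := exists (n : nat) (A : 'I_n -> set R)
    (f : 'I_n -> 'rV[R]_d -> 'rV[R]_d),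
  (forall i, measurable (A i) /\ X (f i)) /\
  forall t x, S t x = \sum_i \1_(A i) t *: f i x.

Definition strongly_measurable u :=
  exists S : nat -> R -> 'rV[R]_d -> 'rV[R]_d,
  (forall n, simple_field (S n)) /\
  {ae lebesgue_measure, forall t, t \in `]0, T[ ->
    N (S n t - u t) @[n --> \oo] --> 0%E}.

Definition bochner_L2 u :=
  [/\ {ae lebesgue_measure, forall t, t \in `]0, T[ -> X (u t)},
      strongly_measurable u &
      (\int[lebesgue_measure]_(t in `]0%R, T[) N (u t) < +oo)%E].

Definition bochner_norm u : \bar R :=
  poweR (\int[lebesgue_measure]_(t in `]0%R, T[) N (u t))%E 2^-1.

Definition continuous_in_time u := forall t0, t0 \in `[0, T] ->
  X (u t0) /\ N (u t - u t0) @[t --> within `[0, T] (nbhs t0)] --> 0%E.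

End bochner.

Section distributions.
Context (R : realType) (d : nat) (L : 'rV[R]_d) (T : R).

Definition test_function (phi : R * 'rV[R]_d -> R) :=
  [/\ smooth phi,
      forall t, periodic L (fun x => phi (t, x)) &
      exists a b, [/\ 0 < a, b < T &
        forall t x, t \notin `[a, b] -> phi (t, x) = 0]].

(* Distributions on (0, T) x torus are functionals that are only ever compared
   on test functions. *)
Definition distrib := (R * 'rV[R]_d -> R) -> R.

Definition eq_dist (S S' : distrib) :=
  forall phi, test_function phi -> S phi = S' phi.

Definition dist_of (u : R -> 'rV[R]_d -> 'rV[R]_d) (i : 'I_d) : distrib :=
  fun phi => \int[lebesgue_measure]_(t in `]0, T[)
    \int[lebesgue_rV R d]_(x in cell L) (u t x 0 i * phi (t, x)).

Definition dt (S : distrib) : distrib :=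
  fun phi => - S ('D_(1 : R, 0 : 'rV[R]_d) phi).

Definition dx (j : 'I_d) (S : distrib) : distrib :=
  fun phi => - S ('D_(0 : R, delta_mx 0 j : 'rV[R]_d) phi).

Definition laplacian (S : distrib) : distrib :=
  \sum_j dx j (dx j S).

Definition divergence (S : 'I_d -> distrib) : distrib :=
  \sum_j dx j (S j).

End distributions.

Section cross_curl.
Context (R : realType).

Definition cross2 (V : 'I_2 -> distrib R 2) (F : 'rV[R]_2) :
  distrib R 2 := F 0 1 *: V 0 - F 0 0 *: V 1.

Definition curl2 (psi : distrib R 2) (i : 'I_2) : distrib R 2 :=
  if i == 0 then dx 1 psi else - dx 0 psi.

(* Indices in 'I_3 are added modulo 3. *)
Definition cross3 (V : 'I_3 -> distrib R 3) (F : 'rV[R]_3) (i : 'I_3) :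
  distrib R 3 := F 0 (i + 2) *: V (i + 1) - F 0 (i + 1) *: V (i + 2).

Definition curl3 (A : 'I_3 -> distrib R 3) (i : 'I_3) :
  distrib R 3 := dx (i + 1) (A (i + 2)) - dx (i + 2) (A (i + 1)).

(* The curl of V x F for a constant F; only d = 2 and d = 3 are meaningful. *)
Definition curl_cross (d : nat) :
  ('I_d -> distrib R d) -> 'rV[R]_d -> 'I_d -> distrib R d :=
  match d with
  | 2 => fun V F => curl2 (cross2 V F)
  | 3 => fun V F => curl3 (cross3 V F)
  | _ => fun _ _ _ => 0
  end.

End cross_curl.

Section induction_equation.
Context (R : realType) (d : nat) (L : 'rV[R]_d) (T eta : R) (F : 'rV[R]_d).
Implicit Types b v : R -> 'rV[R]_d -> 'rV[R]_d.

Definition L2_Hs (s : R) (u : R -> 'rV[R]_d -> 'rV[R]_d) :=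
  bochner_L2 (Hsper L s) (Hs_sqnorm L s) T u.

Definition velocity_space v :=
  bochner_L2 (L2per0 L) (L2_sqnorm L) T v /\
  {ae lebesgue_measure, forall t, t \in `[0, T] -> div_free L (v t)}.

Definition induction_equation b v :=
  (forall i, eq_dist L T (dt (dist_of L T b i))
    (eta *: laplacian (dist_of L T b i) + curl_cross (dist_of L T v) F i)) /\
  eq_dist L T (divergence (dist_of L T b)) 0.

End induction_equation.

(* Main.v *)
Require Import Defs.
From mathcomp Require Import all_boot all_order all_algebra.
From mathcomp Require Import all_classical all_reals all_analysis.
From mathcomp Require Import measurable_realfun complex ring lra.

Set Implicit Arguments.
Unset Strict Implicit.
Unset Printing Implicit Defensive.
Import Order.TTheory GRing.Theory Num.Theory numFieldNormedType.Exports.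
Local Open Scope classical_set_scope.
Local Open Scope ring_scope.

(* Expand the fields in Hartley's real orthonormal basis cas (2 pi g(k).x), where
   cas = cos + sin. Integrating by parts turns d/dx_j into the multiplication
   by - 2 pi g(k)_j composed with the exchange of the coefficients at k and - k.
   Put w = d_t b - eta Laplacian b. Testing the equations for b against
   chi(t) cas_k(x) shows that w has mean zero and is divergence free for almost
   every t. For divergence free v, curl (v x F) = (F.grad) v, so the equation
   says that the coefficients of w at - k are 2 pi F.g(k) times those of v at k.
   This determines v up to its mean; it is solvable since w has mean zero, and
   the Diophantine condition bounds 1 / (2 pi F.g(k)) by |k|^tau / (2 pi C), so
   the solution lies in L^2 with the stated norm. Strong measurability in time
   is preserved because a Fourier multiplier maps simple functions to simple
   functions. *)

(** * Integrals of non-measurable functions *)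

(** The obstacle is measurability in time. Membership in [L2_Hs] makes a field strongly measurable
    as a function of [t], but gives no joint measurability in space and time, and a pairing of [u t]
    with a test function is only almost everywhere equal to a measurable function, the limit of its
    pairings with simple fields. Time integrals are therefore manipulated modulo null sets. This is
    consistent because the integral of a nonnegative function is a supremum over simple functions,
    whatever its measurability. Since [dist_of] is an iterated integral, each distributional
    identity reduces to one at a fixed time, where Parseval's identity turns the space integral into
    a sum over frequencies and the derivatives fall on the smooth test function. The real basis
    keeps all coefficients real. The exchange of k and - k costs nothing, as the Sobolev weights are
    even, so that the norms defined by complex Fourier coefficients have the same expression in it.
    The basis is complete by a monotone class argument, and cutoffs in time are built from
    exp(-1/x). *)

Section inner_integral.
Context d (T : measurableType d) (R : realType) (mu : {measure set T -> \bar R}).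
Local Open Scope ereal_scope.
Implicit Types (D : set T) (f g : T -> \bar R).

Import HBNNSimple.

(* The integral of a nonnegative function is a supremum over the simple
   functions below it, so it is monotone even on non-measurable functions. *)
Lemma le_integral_ae D f g :
  (forall x, D x -> 0 <= f x) -> (forall x, D x -> 0 <= g x) ->
  {ae mu, forall x, D x -> f x <= g x} ->
  \int[mu]_(x in D) f x <= \int[mu]_(x in D) g x.
Proof.
move=> f0 g0 [N [mN N0 fgN]].
rewrite !ge0_integralE//; apply: ge_ereal_sup => _ [h hf <-].
rewrite -integralT_nnsfun (ge0_negligible_integral mN)//; last 2 first.
- exact/measurable_EFinP.
- by move=> x _; rewrite lee_fin.
rewrite setTD integral_nnsfun; last exact: measurableC.
have mNc : measurable (~` N) by exact: measurableC.
(* Restricting [h] to the complement of the null set [N] keeps its integral and puts it below [g]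
   everywhere. *)
apply: ereal_sup_ubound; exists (proj_nnsfun h mNc) => //=.
- move=> x; have := hf x; rewrite !patchE /= mindicE.
  case: ifPn => xD; case: (boolP (x \in ~` N)) => xN /=; rewrite ?mulr1 ?mulr0 //.
  + move/le_trans; apply; apply: contrapT => nfg; move: xN; rewrite inE; apply.
    by apply: fgN => /= /(_ (set_mem xD)).
  + by move=> _; apply: g0; exact: set_mem.
- apply: eq_sintegral => x /=; rewrite /patch /= mindicE.
  by case: ifPn => xD /=; rewrite ?mulr1 ?mulr0.
Qed.

Lemma eq_integral_ae D f g : {ae mu, forall x, D x -> f x = g x} ->
  \int[mu]_(x in D) f x = \int[mu]_(x in D) g x.
Proof.
move=> fg; rewrite integralE [RHS]integralE.
by congr (_ - _); apply/eqP; rewrite eq_le !le_integral_ae//;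
   apply: filterS fg => x fgx Dx; rewrite ?funeposE ?funenegE fgx.
Qed.

Lemma eq_Rintegral_ae D (f g : T -> R) :
  {ae mu, forall x, D x -> f x = g x} ->
  (\int[mu]_(x in D) f x = \int[mu]_(x in D) g x)%R.
Proof.
move=> fg; rewrite /Rintegral; congr fine; apply: eq_integral_ae.
by apply: filterS fg => x fgx Dx; rewrite fgx.
Qed.

End inner_integral.

Section ae_measurable.
Context d (T : measurableType d) (R : realType) (mu : {measure set T -> \bar R}).

(** An almost everywhere limit need not be measurable when the measure is not complete. The upper
    limit of the [f n] is measurable, and agrees with [g] wherever they converge. *)
Lemma ae_measurable_cvg (D : set T) (f : nat -> T -> \bar R) (g : T -> \bar R) :
  (forall n, measurable_fun setT (f n)) ->
  {ae mu, forall x, D x -> f n x @[n --> \oo] --> g x} ->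
  exists2 G, measurable_fun setT G & {ae mu, forall x, D x -> g x = G x}.
Proof.
move=> mf fg; exists (fun x => limn_esup (f ^~ x)).
  exact: measurable_fun_limn_esup.
apply: filterS fg => x fgx Dx; apply/esym.
have := is_cvg_limn_esupE (cvgP _ (fgx Dx)).
by move=> ->; exact/cvg_lim/fgx.
Qed.

Lemma ae_measurable_cvgR (D : set T) (f : nat -> T -> R) (g : T -> R) :
  (forall n, measurable_fun setT (f n)) ->
  {ae mu, forall x, D x -> f n x @[n --> \oo] --> g x} ->
  exists2 G, measurable_fun setT G & {ae mu, forall x, D x -> g x = G x}.
Proof.
move=> mf fg.
have mfE n : measurable_fun setT (fun x => (f n x)%:E) by exact/measurable_EFinP.
have fgE : {ae mu, forall x, D x -> (f n x)%:E @[n --> \oo] --> (g x)%:E}.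
  apply: filterS fg => x fgx Dx.
  by apply: cvg_EFin; [exact: nearW|exact: fgx].
have [G mG gG] := ae_measurable_cvg mfE fgE.
exists (fine \o G); first exact: measurableT_comp.
by apply: filterS gG => x gGx Dx /=; rewrite -gGx.
Qed.

End ae_measurable.

(** * Integration over the periodic cell *)

Section row_topology.
Context (R : realType).

Lemma continuous_rV (U : topologicalType) n (f : U -> 'rV[R]_n) :
  (forall i, continuous (fun t => f t 0 i)) -> continuous f.
Proof.
move=> cf t; apply/cvg_ballP => e e0.
have : \forall s \near t, forall i, ball (f t 0 i) e (f s 0 i).
  apply: filter_forall => i; have := cf i t.
  by move/cvg_ballP; apply.
apply: filterS => s fs; split => // i j; rewrite ord1; exact: fs.
Qed.

(** The sigma-algebra on row vectors is generated by the coordinates, not by the topology. The two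
    are linked by writing an open set as the countable union of the boxes inside it that have a
    rational centre and a radius of the form 1/(m+1). *)
Lemma open_measurable_rV n (U : set 'rV[R]_n) : open U -> measurable U.
Proof.
move=> oU.
pose B (q : 'rV[rat]_n) (m : nat) : set 'rV[R]_n :=
  \bigcap_(i in [set: 'I_n]) [set x | `|x 0 i - ratr (q 0 i)| < m.+1%:R^-1].
have mB q m : measurable (B q m).
  rewrite /B; apply: fin_bigcap_measurable => // i _.
  change (measurable [set x : 'rV[R]_n | `|x 0 i - ratr (q 0 i)| < m.+1%:R^-1]).
  have -> : [set x : 'rV[R]_n | `|x 0 i - ratr (q 0 i)| < m.+1%:R^-1] =
      (fun x : 'rV[R]_n => x 0 i) @^-1`
      `](ratr (q 0 i) - m.+1%:R^-1), (ratr (q 0 i) + m.+1%:R^-1)[%classic.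
    by apply/seteqP; split => x /=; rewrite in_itv/= ltr_distl.
  rewrite -[X in measurable X]setTI; exact: measurable_coord.
have -> : U = \bigcup_(p in [set: 'rV[rat]_n * nat])
    (if `[< B p.1 p.2 `<=` U >] then B p.1 p.2 else set0).
  apply/seteqP; split; last by move=> x [p _]; case: asboolP => // h /h.
  move=> x Ux; have /nbhs_ballP[e /= e0 eU] : nbhs x U by exact: open_nbhs_nbhs.
  have [m me] : exists m : nat, m.+1%:R^-1 < e / 2.
    have e20 : 0 < e / 2 by rewrite divr_gt0.
    by have [m _ /(_ m (leqnn m))] := near_infty_natSinv_lt (PosNum e20); exists m.
  have rq i : exists q : rat, `|x 0 i - ratr q| < m.+1%:R^-1.
    have [|q] := @rat_in_itvoo R (x 0 i - m.+1%:R^-1) (x 0 i + m.+1%:R^-1).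
      by rewrite ltrD2l gt0_cp// ?invr_gt0.
    by rewrite in_itv/= => xq; exists q; rewrite distrC ltr_distl.
  have [q qx] := choice rq.
  exists (\row_i q i, m) => //=; rewrite ifT.
    by move=> i _ /=; rewrite mxE.
  apply/asboolP => y By; apply: eU; split => // i j.
  rewrite ord1 /ball/= (le_lt_trans (ler_distD (ratr (q j)) _ _))//.
  rewrite [ltRHS]splitr ltrD// ?(lt_trans _ me)//.
  by rewrite distrC; have := By j I; rewrite /= mxE.
apply: countable_bigcupT_measurable => [|p]; first exact: countableP.
by case: ifP.
Qed.

Lemma continuous_measurable_rV n (f : 'rV[R]_n -> R) :
  continuous f -> measurable_fun setT f.
Proof.
move=> /continuousP cf; apply: (measurability _ (RGenOpens.measurableE R)).
move=> _ [_ [a [b ->] <-]]; rewrite setTI; apply: open_measurable_rV.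
exact/cf/interval_open.
Qed.

Lemma compact_box n (L : 'rV[R]_n) :
  compact [set x : 'rV[R]_n | forall i, x 0 i \in `[0, L 0 i]].
Proof.
by apply: (@rV_compact _ _ (fun i => `[0, L 0 i]%classic)) => i; exact: segment_compact.
Qed.

Lemma continuous_bounded_cell n (L : 'rV[R]_n) (f : 'rV[R]_n -> R) :
  continuous f -> exists M, forall x, cell L x -> `|f x| <= M.
Proof.
move=> cf.
have /compact_bounded[M [_ HM]] : compact (f @` [set x : 'rV[R]_n | forall i, x 0 i \in `[0, L 0 i]]).
  by apply: continuous_compact; [exact: continuous_subspaceT|exact: compact_box].
exists (M + 1) => x cx; apply: (HM (M + 1)); first by rewrite ltrDl.
exists x => // i; have /andP[? /ltW ?] := cx i.
by rewrite in_itv/=; apply/andP.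
Qed.

Lemma continuous_bounded_cylinder n (L : 'rV[R]_n) (f : R * 'rV[R]_n -> R) a b :
  continuous f -> exists M, forall t x, t \in `[a, b] -> cell L x -> `|f (t, x)| <= M.
Proof.
move=> cf.
have /compact_bounded[M [_ HM]] : compact (f @` (`[a, b]%classic `*`
    [set x : 'rV[R]_n | forall i, x 0 i \in `[0, L 0 i]])).
  apply: continuous_compact; first exact: continuous_subspaceT.
  by apply: compact_setX; [exact: segment_compact|exact: compact_box].
exists (M + 1) => t x tab cx; apply: (HM (M + 1)); first by rewrite ltrDl.
exists (t, x) => //; split => //= i; have /andP[? /ltW ?] := cx i.
by rewrite in_itv/=; apply/andP.
Qed.

End row_topology.

Section derive_affine.
Context (R : realType) (V W : normedModType R).

(** Along the line through [x] directed by [v], [g] is affine with velocity [w], so the two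
    difference quotients are literally equal. This replaces the chain rule and requires no
    differentiability of [f]. *)
Lemma derivable_line (g : V -> W) (f : W -> R) x v w :
  (forall h : R, g (h *: v + x) = h *: w + g x) ->
  derivable f (g x) w -> derivable (f \o g) x v.
Proof.
move=> gE; rewrite /derivable.
by under [X in _ -> cvg (X @ _)]eq_fun do rewrite /= gE.
Qed.

Lemma derive_line (g : V -> W) (f : W -> R) x v w :
  (forall h : R, g (h *: v + x) = h *: w + g x) ->
  'D_v (f \o g) x = 'D_w f (g x).
Proof.
by move=> gE; rewrite /derive; under eq_fun do rewrite /= gE.
Qed.

End derive_affine.

Section cell_integral.
Context (R : realType).

Definition tail_rV n (L : 'rV[R]_n.+1) : 'rV[R]_n := \row_i L 0 (lift ord0 i).

Lemma cell_cons n (L : 'rV[R]_n.+1) a x :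
  cell L (cons_rV (a, x)) <-> (0 <= a < L 0 ord0) /\ cell (tail_rV L) x.
Proof.
split => [H|[H1 H2] i].
  split; first by have := H ord0; rewrite mxE unlift_none.
  by move=> i; have := H (lift ord0 i); rewrite !mxE liftK.
by rewrite mxE; case: unliftP => [j|] -> //=; have := H2 j; rewrite mxE.
Qed.

Lemma measurable_cell n (L : 'rV[R]_n) : (forall i, 0 < L 0 i) ->
  measurable (cell L).
Proof. by move=> L0; have [] := lebesgue_rV_cell (fun i => ltW (L0 i)). Qed.

Lemma lebesgue_cell n (L : 'rV[R]_n) : (forall i, 0 < L 0 i) ->
  lebesgue_rV R n (cell L) = (volume L)%:E.
Proof. by move=> L0; have [] := lebesgue_rV_cell (fun i => ltW (L0 i)). Qed.

Lemma lebesgue_cell_fin n (L : 'rV[R]_n) : (forall i, 0 < L 0 i) ->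
  (lebesgue_rV R n (cell L) < +oo)%E.
Proof. by move=> L0; rewrite lebesgue_cell// ltry. Qed.

Lemma volume_gt0 n (L : 'rV[R]_n) : (forall i, 0 < L 0 i) -> 0 < volume L.
Proof. by move=> L0; apply: prodr_gt0. Qed.

Lemma bounded_integrable_cell n (L : 'rV[R]_n) (f : 'rV[R]_n -> R) M :
  (forall i, 0 < L 0 i) -> measurable_fun setT f ->
  (forall x, cell L x -> `|f x| <= M) ->
  (lebesgue_rV R n).-integrable (cell L) (EFin \o f).
Proof.
move=> L0 mf fM; apply: measurable_bounded_integrable.
- exact: measurable_cell.
- exact: lebesgue_cell_fin.
- exact: measurable_funTS.
- exists M; split; first exact: num_real.
  by move=> y My x /= cx; rewrite (le_trans (fM _ cx))// ltW.
Qed.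

Lemma continuous_integrable_cell n (L : 'rV[R]_n) (f : 'rV[R]_n -> R) :
  (forall i, 0 < L 0 i) -> continuous f ->
  (lebesgue_rV R n).-integrable (cell L) (EFin \o f).
Proof.
move=> L0 cf; have [M fM] := continuous_bounded_cell L cf.
by apply: (bounded_integrable_cell L0 _ fM); exact: continuous_measurable_rV.
Qed.

Section fubini_cell.
Context n (L : 'rV[R]_n.+1) (f : 'rV[R]_n.+1 -> R).
Hypothesis L0 : forall i, 0 < L 0 i.
Hypothesis mf : measurable_fun setT f.
Hypothesis intf : (lebesgue_rV R n.+1).-integrable (cell L) (EFin \o f).

Let g := (EFin \o f) \_ (cell L) \o @cons_rV R n.

Let intg : (lebesgue_measure \x lebesgue_rV R n)%E.-integrable setT g.
Proof.
apply/integrableP; split.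
  apply: measurableT_comp; last exact: measurable_cons_rV.
  apply/(measurable_restrictT _ (measurable_cell L0)).
  by apply: measurable_funTS; exact/measurable_EFinP.
have /integrableP[_] := intf.
rewrite integral_mkcond /= /lebesgue_cons.
rewrite ge0_integral_pushforward//=; last 3 first.
- exact: measurable_cons_rV.
- apply: measurable_funTS; apply/(measurable_restrictT _ (measurable_cell L0)).
  by apply: measurable_funTS; apply/measurable_EFinP; exact: measurableT_comp.
- by move=> x _; rewrite patchE; case: ifP.
apply: le_lt_trans; rewrite le_eqVlt; apply/orP; left; apply/eqP.
rewrite preimage_setT; apply: eq_integral => x _ /=.
by rewrite /g /= !patchE; case: ifP => //=; rewrite normr0.
Qed.

Let fE : (\int[lebesgue_rV R n.+1]_(x in cell L) (f x)%:E =
  \int[lebesgue_measure \x lebesgue_rV R n]_p g p)%E.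
Proof.
have mf' : measurable_fun setT ((EFin \o f) \_ (cell L)).
  apply/(measurable_restrictT _ (measurable_cell L0)).
  by apply: measurable_funTS; exact/measurable_EFinP.
rewrite integral_mkcond /= /lebesgue_cons.
rewrite integral_pushforward//; exact: measurable_cons_rV.
Qed.

Let gE a x : g (a, x) = ((fun a => ((fun x => (f (cons_rV (a, x)))%:E) \_ (cell (tail_rV L)) x)) \_ `[0%R, (L 0 ord0)%R[) a.
Proof.
rewrite /g /= !patchE; case: ifPn => [/set_mem/cell_cons[aL cx]|nc].
  by rewrite !mem_set.
case: ifPn => // /set_mem /= aL; case: ifPn => // /set_mem cx.
by move: nc; rewrite notin_setE => ncell; exfalso; apply/ncell/cell_cons.
Qed.

(** The measure on row vectors is the image of a product measure under [cons_rV], so Fubini's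
    theorem applies after pulling back. Both orders of integration are kept, because a derivative
    may act on the first coordinate or on a later one. *)
Lemma fubini_cell1 : (\int[lebesgue_rV R n.+1]_(x in cell L) (f x)%:E =
  \int[lebesgue_measure]_(a in `[0%R, (L 0 ord0)%R[)
    \int[lebesgue_rV R n]_(x in cell (tail_rV L)) (f (cons_rV (a, x)))%:E)%E.
Proof.
rewrite fE -(integral12_prod_meas1 intg) [RHS]integral_mkcond.
apply: eq_integral => a _; rewrite patchE; case: ifPn => aL.
  rewrite [RHS]integral_mkcond; apply: eq_integral => x _.
  by rewrite gE patchE aL.
by apply: integral0_eq => x _; rewrite gE patchE (negbTE aL).
Qed.

Lemma fubini_cell2 : (\int[lebesgue_rV R n.+1]_(x in cell L) (f x)%:E =
  \int[lebesgue_rV R n]_(x in cell (tail_rV L))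
    \int[lebesgue_measure]_(a in `[0%R, (L 0 ord0)%R[) (f (cons_rV (a, x)))%:E)%E.
Proof.
rewrite fE -(integral21_prod_meas1 intg) [RHS]integral_mkcond.
apply: eq_integral => x _; rewrite patchE; case: ifPn => cx.
  rewrite [RHS]integral_mkcond; apply: eq_integral => a _.
  by rewrite gE !patchE cx; case: ifP.
by apply: integral0_eq => a _; rewrite gE !patchE (negbTE cx); case: ifP.
Qed.

End fubini_cell.

Lemma cons_line n (a : R) (x : 'rV[R]_n) (j : 'I_n) (h : R) :
  cons_rV (a, h *: delta_mx 0 j + x) =
  h *: delta_mx 0 (lift ord0 j) + cons_rV (a, x).
Proof.
apply/rowP => i; rewrite !mxE; case: unliftP => [k|] -> /=.
  by rewrite !mxE /= (inj_eq lift_inj).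
by rewrite mulr0 add0r.
Qed.

Lemma cons_line0 n (a : R) (x : 'rV[R]_n) (h : R) :
  cons_rV (h *: 1 + a, x) = h *: delta_mx 0 ord0 + cons_rV (a, x).
Proof.
apply/rowP => i; rewrite !mxE; case: unliftP => [k|] -> /=.
  by rewrite mulr0 add0r.
by [].
Qed.

Lemma continuous_cons n (a : R) : continuous (fun x : 'rV[R]_n => cons_rV (a, x)).
Proof.
apply: continuous_rV => i; under eq_fun do rewrite mxE /=.
by case: (unlift ord0 i) => [j|]; [exact: coord_continuous|exact: cst_continuous].
Qed.

Lemma continuous_cons0 n (x : 'rV[R]_n) : continuous (fun a : R => cons_rV (a, x)).
Proof.
apply: continuous_rV => i; under eq_fun do rewrite mxE /=.
by case: (unlift ord0 i) => [j|]; [exact: cst_continuous|move=> ?; exact: cvg_id].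
Qed.

Lemma integral_itv_derive (f : R -> R) b : 0 < b ->
  (forall a, derivable f a 1) -> continuous ('D_1 f) -> f b = f 0 ->
  (\int[lebesgue_measure]_(a in `[0%R, b[) ('D_1 f a)%:E = 0)%E.
Proof.
move=> b0 df cf fb.
have cfT : continuous f.
  by move=> x; apply/differentiable_continuous/derivable1_diffP.
have := @continuous_FTC2 R ('D_1 f) f 0 b b0.
rewrite fb -EFinB subrr => H; rewrite -[RHS]H //.
- rewrite integral_itv_bndo_bndc//.
  by apply/measurable_funTS/measurable_EFinP; exact: continuous_measurable_fun.
- exact: continuous_subspaceT.
- split => //; [apply: cvg_at_right_filter|apply: cvg_at_left_filter]; exact: cfT.
- by move=> x _; rewrite derive1E.
Qed.

(** By induction on the dimension. A derivative in the first coordinate is integrated first, by the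
    fundamental theorem of calculus and periodicity. A derivative in a later coordinate falls under
    the induction hypothesis on the slices where the first coordinate is frozen. *)
Lemma integral_cell_derive n (L : 'rV[R]_n) (f : 'rV[R]_n -> R) (i : 'I_n) :
  (forall i, 0 < L 0 i) -> (forall x, derivable f x (delta_mx 0 i)) ->
  continuous ('D_(delta_mx 0 i) f) -> Defs.periodic L f ->
  \int[lebesgue_rV R n]_(x in cell L) 'D_(delta_mx 0 i) f x = 0.
Proof.
move=> L0 df cf pf; suff H : (\int[lebesgue_rV R n]_(x in cell L)
  ('D_(delta_mx 0 i) f x)%:E = 0)%E by rewrite /Rintegral H.
elim: n => [|n IH] in L f i L0 df cf pf *; first by case: i {df cf}.
have mDf := continuous_measurable_rV cf.
have iDf := continuous_integrable_cell L0 cf.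
case: (unliftP ord0 i) => [j|] iE; subst i.
  rewrite fubini_cell1//; apply: integral0_eq => a _.
  have gE x : 'D_(delta_mx 0 j) (f \o (fun x => cons_rV (a, x))) x =
      'D_(delta_mx 0 (lift ord0 j)) f (cons_rV (a, x)).
    by apply: derive_line => h; exact: cons_line.
  under eq_integral do rewrite -gE.
  apply: IH.
  - by move=> i; rewrite mxE.
  - by move=> x; apply: derivable_line; [move=> h; exact: cons_line|exact: df].
  - rewrite (_ : 'D_ _ _ = 'D_(delta_mx 0 (lift ord0 j)) f \o (fun x => cons_rV (a, x))).
      by move=> x; apply: continuous_comp; [exact: continuous_cons|exact: cf].
    by apply/funext => x; rewrite gE.
  - move=> x i /=; rewrite addrC mxE cons_line addrC; exact: pf.
rewrite fubini_cell2//; apply: integral0_eq => x _.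
have gE a : 'D_1 (f \o (fun a => cons_rV (a, x))) a =
    'D_(delta_mx 0 ord0) f (cons_rV (a, x)).
  by apply: derive_line => h; exact: cons_line0.
under eq_integral do rewrite -gE.
apply: integral_itv_derive => //.
- by move=> a; apply: derivable_line; [move=> h; exact: cons_line0|exact: df].
- rewrite (_ : 'D_ _ _ = 'D_(delta_mx 0 ord0) f \o (fun a => cons_rV (a, x))).
    by move=> a; apply: continuous_comp; [exact: continuous_cons0|exact: cf].
  by apply/funext => a; rewrite gE.
- have := pf (cons_rV (0, x)) ord0.
  by rewrite /= addrC -cons_line0 /= [_ *: 1]mulr1 addr0.
Qed.

End cell_integral.

(** * Smooth functions *)

Section smooth_functions.
Context (R : realType).

Lemma derive_dir (g : R -> R) (y w : R) : derivable g y 1 ->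
  derivable g y w /\ 'D_w g y = w * derive1 g y.
Proof.
move=> /derivable1_diffP dg; split; first exact: diff_derivable.
rewrite derive1E' // deriveE // -[w in LHS]mulr1.
by rewrite -[w * 1]/(w *: (1 : R)) linearZ.
Qed.

Lemma derive_line_comp (V : normedModType R) (g : R -> R) (l : V -> R) v w x :
  (forall h : R, l (h *: v + x) = h * w + l x) -> derivable g (l x) 1 ->
  derivable (g \o l) x v /\ 'D_v (g \o l) x = w * derive1 g (l x).
Proof.
move=> lE /(@derive_dir _ _ w)[dg <-]; split; first exact: derivable_line dg.
exact: derive_line.
Qed.

Section smooth_class.
Context (V : normedModType R).
Implicit Types f : V -> R.

Lemma iter_derive_cat f us vs :
  iter_derive f (us ++ vs) = iter_derive (iter_derive f vs) us.
Proof. by elim: us => //= u us ->. Qed.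

Lemma smooth_derive f v : smooth f -> smooth ('D_v f).
Proof.
by move=> sf vs; rewrite -[iter_derive _ _]/(iter_derive (iter_derive f [:: v]) vs) -iter_derive_cat.
Qed.

(** A coinduction principle: iterated derivatives of a member of a class stable under directional
    derivatives never leave the class, so continuity and derivability need only be known on the
    class. *)
Lemma smooth_stable (P : (V -> R) -> Prop) :
  (forall f, P f -> [/\ continuous f, forall x v, derivable f x v &
    forall v, P ('D_v f)]) ->
  forall f, P f -> smooth f.
Proof.
move=> stP f Pf vs.
have /stP[] // : P (iter_derive f vs) by elim: vs => //= v vs /stP[].
Qed.

End smooth_class.

Lemma smooth_affine (V W : normedModType R) (g : W -> V) (A : W -> V) f :
  continuous g -> (forall h v x, g (h *: v + x) = h *: A v + g x) ->
  smooth f -> smooth (f \o g).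
Proof.
move=> cg gE sf vs.
have E : iter_derive (f \o g) vs = iter_derive f (map A vs) \o g.
  elim: vs => //= v vs ->; apply/funext => x.
  exact: derive_line.
rewrite E; have [cf df] := sf (map A vs); split.
  by move=> x; apply: continuous_comp; [exact: cg|exact: cf].
by move=> x v; apply: derivable_line; [move=> h; exact: gE|exact: df].
Qed.

Definition smooth1 (g : R -> R) := forall n x, derivable (derive1n n g) x 1.

Lemma smooth1_stable (P : (R -> R) -> Prop) :
  (forall g, P g -> (forall x, derivable g x 1) /\ P (derive1 g)) ->
  forall g, P g -> smooth1 g.
Proof.
move=> stP g Pg n; elim: n g Pg => [|n IH] g /stP[dg Pg']; first exact: dg.
by rewrite derive1Sn; exact: IH.
Qed.

Lemma smooth1_derive g : smooth1 g -> smooth1 (derive1 g).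
Proof. by move=> sg n x; rewrite -derive1Sn; exact: sg. Qed.

Lemma smooth1_continuous g : smooth1 g -> continuous g.
Proof.
by move=> /(_ 0%N) dg x; apply/differentiable_continuous/derivable1_diffP; exact: dg.
Qed.

Lemma smooth1_trig (a b : R) : smooth1 (fun x => a * cos x + b * sin x).
Proof.
pose P (g : R -> R) := exists a b : R, g = (fun x => a * cos x + b * sin x).
apply: (@smooth1_stable P); last by exists a, b.
move=> _ [{}a [{}b ->]].
have dg (x : R) : is_derive x 1 (fun x => a * cos x + b * sin x) (b * cos x + - a * sin x).
  apply: is_derive_eq; rewrite /= /GRing.scale /=; ring.
split; first by move=> x; have [] := dg x.
by exists b, (- a); apply/funext => x; rewrite derive1E; have [_ ->] := dg x.
Qed.

(** Sums and products of smooth one-variable functions of affine forms; [A] is the linear part of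
    the form [l]. The class contains the waves and the cutoffs, and the product and chain rules make
    it stable under directional derivatives. *)
Inductive elementary (V : normedModType R) : (V -> R) -> Prop :=
| elementary_comp (g : R -> R) (l A : V -> R) : smooth1 g -> continuous l ->
    (forall h v x, l (h *: v + x) = h * A v + l x) ->
    elementary (fun x => g (l x))
| elementary_add f g : elementary f -> elementary g ->
    elementary (fun x => f x + g x)
| elementary_mul f g : elementary f -> elementary g ->
    elementary (fun x => f x * g x).

Lemma smooth1_cst (c : R) : smooth1 (fun=> c).
Proof.
apply: (@smooth1_stable (fun g => exists c, g = fun=> c)); last by exists c.
move=> _ [{}c ->]; split; first by move=> x; exact: derivable_cst.
by exists 0; apply/funext => x; rewrite derive1E derive_cst.
Qed.

Lemma elementary_cst (V : normedModType R) (c : R) : elementary (fun _ : V => c).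
Proof.
apply: (@elementary_comp V (fun=> c) (fun=> 0) (fun=> 0)).
- exact: smooth1_cst.
- exact: cst_continuous.
- by move=> h v x; rewrite mulr0 addr0.
Qed.

Lemma elementary_stable (V : normedModType R) (f : V -> R) : elementary f ->
  [/\ continuous f, forall x v, derivable f x v &
    forall v, elementary ('D_v f)].
Proof.
elim=> {f} [g l A sg cl lE|f g _ [cf df ef] _ [cg dg eg]|f g Ef [cf df ef] Eg [cg dg eg]].
- have E x v := derive_line_comp (fun h => lE h v x) (sg 0%N (l x)).
  split.
  + by move=> x; apply: continuous_comp; [exact: cl|exact: smooth1_continuous].
  + by move=> x v; have [] := E x v.
  + move=> v; rewrite (_ : 'D_v _ = fun x => A v * derive1 g (l x)).
      apply: elementary_mul; first exact: elementary_cst.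
      by apply: elementary_comp cl lE; exact: smooth1_derive.
    by apply/funext => x; have [_ <-] := E x v.
- split.
  + by move=> x; apply: cvgD; [exact: cf|exact: cg].
  + by move=> x v; apply: derivableD; [exact: df|exact: dg].
  + move=> v; rewrite (_ : 'D_v _ = fun x => 'D_v f x + 'D_v g x).
      exact: elementary_add.
    by apply/funext => x; exact: deriveD.
- split.
  + by move=> x; apply: cvgM; [exact: cf|exact: cg].
  + by move=> x v; apply: derivableM; [exact: df|exact: dg].
  + move=> v; rewrite (_ : 'D_v _ = fun x => f x * 'D_v g x + g x * 'D_v f x).
      by apply: elementary_add; exact: elementary_mul.
    by apply/funext => x; exact: deriveM.
Qed.

Lemma smooth_elementary (V : normedModType R) (f : V -> R) :
  elementary f -> smooth f.
Proof. by apply: smooth_stable => ?; exact: elementary_stable. Qed.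

End smooth_functions.

(** * Flat functions on the line *)

Section flat_functions.
Context (R : realType).

(* exp(-1/x) extended by 0; the functions p(1/x) exp(-1/x) are stable under
   differentiation. *)
Definition flat (p : {poly R}) (x : R) : R :=
  if 0 < x then p.[x^-1] * expR (- x^-1) else 0.

Lemma flat_le0 p x : x <= 0 -> flat p x = 0.
Proof. by move=> x0; rewrite /flat ltNge x0. Qed.

(** With y = 1/x, the Taylor bound y^(n+1) / (n+1)! <= exp y gives y^n exp(-y) <= (n+1)! / y. *)
Lemma flatX_bound n x : `|flat 'X^n x| <= n.+1`!%:R * `|x|.
Proof.
rewrite /flat; case: ifPn => x0; last by rewrite normr0 mulr_ge0.
rewrite hornerXn (gtr0_norm x0) ger0_norm; last first.
  by rewrite mulr_ge0 ?expR_ge0// exprn_ge0// invr_ge0 ltW.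
rewrite expRN ler_pdivrMr ?expR_gt0//.
have y0 : 0 < x^-1 by rewrite invr_gt0.
have := expR_ge1Dxn n (ltW y0).
have f0 : 0 < n.+1`!%:R :> R by rewrite ltr0n fact_gt0.
move=> H; have {}H : x^-1 ^+ n.+1 <= n.+1`!%:R * expR x^-1.
  by rewrite mulrC -ler_pdivrMr// (le_trans _ H)// lerDr.
rewrite (_ : x^-1 ^+ n = x * x^-1 ^+ n.+1); last first.
  by rewrite exprS mulrA divff ?mul1r// gt_eqF.
by rewrite [n.+1`!%:R * x]mulrC -mulrA ler_pM2l.
Qed.

Lemma flat_sum (p : {poly R}) x :
  flat p x = \sum_(i < size p) p`_i * flat 'X^i x.
Proof.
rewrite /flat; case: ifPn => x0; last by rewrite big1// => i _; rewrite mulr0.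
rewrite horner_coef mulr_suml; apply: eq_bigr => i _.
by rewrite hornerXn mulrA.
Qed.

Lemma flat_bound p : exists2 K, 0 <= K & forall x, `|flat p x| <= K * `|x|.
Proof.
exists (\sum_(i < size p) `|p`_i| * i.+1`!%:R).
  by apply: sumr_ge0 => i _; rewrite mulr_ge0.
move=> x; rewrite flat_sum (le_trans (ler_norm_sum _ _ _))// mulr_suml.
by apply: ler_sum => i _; rewrite normrM -mulrA ler_wpM2l// flatX_bound.
Qed.

(** For x > 0 and y = 1/x, the derivative of p(y) exp(-y) is y^2 (p(y) - p'(y)) exp(-y). At 0 the
    difference quotient is [flat ('X * p) h], which tends to 0 by the linear bound [flat_bound]. *)
Lemma flat_derive (p : {poly R}) (x : R) : is_derive x 1 (flat p) (flat ('X^2 * (p - p^`())) x).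
Proof.
have [x0|x0|->] := ltgtP x 0.
- rewrite flat_le0 ?ltW//; apply: (@near_eq_is_derive _ _ _ (cst 0)) => //.
  near=> y; rewrite /= flat_le0//; apply: ltW; near: y; exact: lt_nbhsl.
- have xn0 : x != 0 by rewrite gt_eqF.
  apply: (@near_eq_is_derive R R R (fun y : R => p.[y^-1] * expR (- y^-1))).
    near=> y; rewrite /flat ifT//; near: y; exact: lt_nbhsr.
  rewrite /flat x0.
  have dV : is_derive x 1 (fun y : R => y^-1) (- x^-2).
    by have := is_deriveV xn0 (is_derive_id x 1); rewrite /= /GRing.scale /= mulr1.
  have dp : is_derive x 1 (fun y : R => p.[y^-1]) (p^`().[x^-1] * - x^-2).
    exact: (@is_derive1_comp R (horner p) (fun y : R => y^-1)).
  have de : is_derive x 1 (fun y : R => expR (- y^-1)) (expR (- x^-1) * - - x^-2).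
    exact: (@is_derive1_comp R expR (fun y : R => - y^-1)).
  have dpe := is_deriveM dp de.
  rewrite (_ : _ * expR _ = p.[x^-1] *: (expR (- x^-1) * - - x ^- 2) +
    expR (- x^-1) *: (p^`().[x^-1] * - x ^- 2)); first exact: dpe.
  rewrite /GRing.scale /= hornerM hornerXn hornerD hornerN -[x ^- 2]exprVn.
  by move: p.[_] p^`().[_] (expR _) (x^-1 ^+ 2) => a c e y; ring.
- rewrite flat_le0//.
  have [K K0 HK] := flat_bound ('X * p).
  suff dl : (fun h : R => h^-1 *: (flat p (h *: 1 + 0) - flat p 0)) @ 0^' --> (0 : R).
    by apply: DeriveDef; [apply/cvg_ex; exists 0|apply/cvg_lim].
  have E (h : R) : h != 0 ->
      h^-1 *: (flat p (h *: 1 + 0) - flat p 0) = flat ('X * p) h.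
    move=> h0; rewrite [h *: 1]mulr1 addr0 (flat_le0 _ (lexx 0)) subr0 /flat.
    case: ifP => _; last by rewrite scaler0.
    by rewrite !hornerE /GRing.scale /= mulrA.
  apply/cvgrPdist_le => e e0; near=> h.
  rewrite sub0r normrN E; last by near: h; exact: nbhs_dnbhs_neq.
  rewrite (le_trans (HK _))//.
  rewrite (@le_trans _ _ ((K + 1) * `|h|))// ?ler_wpM2r ?lerDl//.
  rewrite mulrC -ler_pdivlMr ?ltr_pwDr//.
  near: h; apply: dnbhs0_le; rewrite divr_gt0// ltr_pwDr//.
Unshelve. all: by end_near. Qed.

Lemma smooth1_flat p : smooth1 (flat p).
Proof.
apply: (@smooth1_stable R (fun g => exists p, g = flat p)); last by exists p.
move=> _ [{}p ->]; split; first by move=> x; have [] := flat_derive p x.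
exists ('X^2 * (p - p^`())); apply/funext => x.
by rewrite derive1E; have [_ ->] := flat_derive p x.
Qed.

Lemma flat1_ge0 x : 0 <= flat 1 x.
Proof. by rewrite /flat; case: ifP => // _; rewrite hornerE mul1r expR_ge0. Qed.

Lemma flat1_le1 x : flat 1 x <= 1.
Proof.
rewrite /flat; case: ifP => // x0; rewrite hornerE mul1r -expR0 ler_expR.
by rewrite oppr_le0 invr_ge0 ltW.
Qed.

(** For x > 0 the value lies between 1 - 1/((n+1) x) and 1. Dilating this profile thus turns smooth
    cutoffs into indicators in the limit, with all values bounded by 1. *)
Lemma flat1_cvg x : flat 1 (n.+1%:R * x) @[n --> \oo] --> (if 0 < x then 1 : R else 0).
Proof.
case: ifPn => x0; last first.
  rewrite (_ : (fun n => _) = cst 0); first exact: cvg_cst.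
  apply/funext => n; rewrite flat_le0//; apply: mulr_ge0_le0 => //.
  by rewrite leNgt.
apply: (@squeeze_cvgr _ _ _ _ (fun n : nat => 1 - (n.+1%:R * x)^-1) (fun=> 1)); last 2 first.
- rewrite -[X in _ --> X]subr0; apply: cvgB; first exact: cvg_cst.
  under eq_fun do rewrite invfM.
  rewrite -(mul0r x^-1); apply: cvgM; [exact: cvg_harmonic|exact: cvg_cst].
- exact: cvg_cst.
near=> n; rewrite flat1_le1 andbT /flat.
have nx : 0 < n.+1%:R * x by rewrite mulr_gt0.
by rewrite nx hornerE mul1r (le_trans _ (expR_ge1Dx _)).
Unshelve. all: by end_near. Qed.

End flat_functions.

(** * The Hartley basis *)

Section Rintegral_tools.
Context d (T : measurableType d) (R : realType) (mu : {measure set T -> \bar R}).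
Context (D : set T).
Hypothesis mD : measurable D.

Lemma Rintegral_cvg (f : nat -> T -> R) (g h : T -> R) :
  (forall n, measurable_fun D (f n)) ->
  (forall x, D x -> f n x @[n --> \oo] --> g x) ->
  mu.-integrable D (EFin \o h) ->
  (forall n x, D x -> `|f n x| <= h x) ->
  \int[mu]_(x in D) f n x @[n --> \oo] --> \int[mu]_(x in D) g x.
Proof.
move=> mf fg ih fh; apply: fine_cvg.
have mfE n : measurable_fun D (EFin \o f n) by exact/measurable_EFinP.
have fgE x : D x -> (EFin \o f n) x @[n --> \oo] --> (EFin \o g) x.
  by move=> Dx; apply: cvg_EFin; [exact: nearW|exact: fg].
have fhE n x : D x -> (`|(EFin \o f n) x| <= (EFin \o h) x)%E.
  by move=> Dx; rewrite lee_fin; exact: fh.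
have mg : measurable_fun D (EFin \o g).
  exact: (@emeasurable_fun_cvg _ _ _ _ (fun n => EFin \o f n)).
have [||ig _ H] := @dominated_convergence _ _ _ mu D mD (fun n => EFin \o f n) _ _ mfE mg _ ih.
- by apply: aeW => x; exact: fgE.
- by apply: aeW => x n; exact: fhE.
rewrite fineK; last exact: integrable_fin_num.
exact: H.
Qed.

Definition bounded_measurable (m : T -> R) :=
  measurable_fun setT m /\ exists M, forall x, `|m x| <= M.

Lemma integrable_bounded (f m : T -> R) :
  measurable_fun setT f -> mu.-integrable D (EFin \o f) ->
  bounded_measurable m -> mu.-integrable D (EFin \o (fun x => f x * m x)).
Proof.
move=> mf fi [mm [M mM]].
apply: (@le_integrable _ _ _ mu D mD _ (EFin \o (fun x => `|f x| * M))).
- by apply/measurable_EFinP; apply: measurable_funM; exact: measurable_funTS.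
- move=> x Dx; rewrite lee_fin normrM [leRHS]normrM normr_id ler_wpM2l//.
  exact: le_trans (ler_norm _).
- rewrite (_ : EFin \o _ = (fun x => M%:E * (EFin \o (fun x => `|f x|%R)) x)%E).
    apply: integrableZl => //; exact: (integrable_abse fi).
  by apply/funext => x /=; rewrite -EFinM mulrC.
Qed.

Lemma bounded_measurable_cst c : bounded_measurable (fun=> c).
Proof. by split; [exact: measurable_cst|exists `|c|]. Qed.

Lemma bounded_measurableD m1 m2 : bounded_measurable m1 ->
  bounded_measurable m2 -> bounded_measurable (fun x => m1 x + m2 x).
Proof.
move=> [? [M1 H1]] [? [M2 H2]]; split; first exact: measurable_funD.
by exists (M1 + M2) => x; rewrite (le_trans (ler_normD _ _))// lerD.
Qed.

Lemma bounded_measurableM m1 m2 : bounded_measurable m1 ->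
  bounded_measurable m2 -> bounded_measurable (fun x => m1 x * m2 x).
Proof.
move=> [? [M1 H1]] [? [M2 H2]]; split; first exact: measurable_funM.
by exists (M1 * M2) => x; rewrite normrM ler_pM.
Qed.

End Rintegral_tools.

Section hartley.
Context (R : realType) (d : nat) (L : 'rV[R]_d).
Hypothesis L0 : forall i, 0 < L 0 i.
Implicit Types (k l : 'rV[int]_d) (x v : 'rV[R]_d).

Definition phase k x : R := 2 * pi * dot (freq L k) x.

Definition wavenumber k (i : 'I_d) : R := 2 * pi * ((k 0 i)%:~R / L 0 i).

Lemma phaseE k x : phase k x = \sum_i wavenumber k i * x 0 i.
Proof.
by rewrite /phase /dot mulr_sumr; apply: eq_bigr => i _; rewrite mxE mulrA.
Qed.

Lemma wavenumberD k l i : wavenumber (k + l) i = wavenumber k i + wavenumber l i.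
Proof. by rewrite /wavenumber mxE intrD; ring. Qed.

Lemma wavenumberN k i : wavenumber (- k) i = - wavenumber k i.
Proof. by rewrite /wavenumber mxE intrN mulNr mulrN. Qed.

Lemma phaseD k l x : phase (k + l) x = phase k x + phase l x.
Proof.
rewrite !phaseE -big_split; apply: eq_bigr => i _ /=.
by rewrite wavenumberD mulrDl.
Qed.

Lemma phaseN k x : phase (- k) x = - phase k x.
Proof.
rewrite !phaseE -sumrN; apply: eq_bigr => i _ /=.
by rewrite wavenumberN mulNr.
Qed.

Lemma phase0 x : phase 0 x = 0.
Proof.
rewrite phaseE big1// => i _; by rewrite /wavenumber mxE mul0r mulr0 mul0r.
Qed.

Lemma phase_line k h v x : phase k (h *: v + x) = h * phase k v + phase k x.
Proof.
rewrite !phaseE mulr_sumr -big_split; apply: eq_bigr => i _ /=.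
by rewrite !mxE mulrDr mulrCA.
Qed.

Lemma phase_delta k i : phase k (delta_mx 0 i) = wavenumber k i.
Proof.
rewrite phaseE (bigD1 i)//= big1 ?addr0 => [|j ji].
  by rewrite !mxE !eqxx mulr1.
by rewrite mxE (negbTE ji) mulr0.
Qed.

Lemma continuous_phase k : continuous (phase k).
Proof.
have ci i : continuous (fun x : 'rV[R]_d => wavenumber k i * x 0 i).
  move=> x; apply: (continuous_comp (f := fun y : 'rV[R]_d => y 0 i)).
    exact: coord_continuous.
  exact: mulrl_continuous.
have cs (s : seq 'I_d) : continuous (fun x : 'rV[R]_d => \sum_(i <- s) wavenumber k i * x 0 i).
  elim: s => [|i s IH].
    by under eq_fun do rewrite big_nil; exact: cst_continuous.
  have -> : (fun x : 'rV[R]_d => \sum_(j <- i :: s) wavenumber k j * x 0 j) =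
      (fun x => wavenumber k i * x 0 i) \+ (fun x => \sum_(j <- s) wavenumber k j * x 0 j).
    by apply/funext => x; rewrite big_cons.
  by move=> x; exact: (cvgD (ci i x) (IH x)).
have -> : phase k = fun x => \sum_i wavenumber k i * x 0 i.
  by apply/funext => x; exact: phaseE.
exact: cs.
Qed.

Definition wave (a b : R) k x : R := a * cos (phase k x) + b * sin (phase k x).

Lemma elementary_wave a b k : elementary (wave a b k).
Proof.
apply: (@elementary_comp R _ (fun y => a * cos y + b * sin y) (phase k) (phase k)).
- exact: smooth1_trig.
- exact: continuous_phase.
- by move=> h v x; exact: phase_line.
Qed.

Lemma wave_derive a b k v x :
  derivable (wave a b k) x v /\ 'D_v (wave a b k) x = phase k v * wave b (- a) k x.
Proof.
have [? E] := derive_line_comp (fun h => phase_line k h v x) (@smooth1_trig R a b 0%N (phase k x)).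
rewrite [LHS]E; split=> //; congr (_ * _); rewrite derive1E.
suff [_ ->] : is_derive (phase k x : R) 1 (fun y : R => a * cos y + b * sin y)
  (b * cos (phase k x) + - a * sin (phase k x)) by [].
by apply: is_derive_eq; rewrite /= /GRing.scale /=; ring.
Qed.

Lemma trig_int (f : R -> R) (z : int) (x : R) :
  (forall y, f (y + pi *+ 2) = f y) -> f (x + pi *+ 2 * z%:~R) = f x.
Proof.
move=> fp; have H (n : nat) y : f (y + pi *+ 2 * n%:R) = f y.
  elim: n y => [|n IH] y; first by rewrite mulr0 addr0.
  by rewrite -natr1 mulrDr mulr1 addrA fp.
case: z => n; first by rewrite -(H n x).
by rewrite NegzE mulrNz mulrN -(H n.+1 (x - _)) subrK.
Qed.

Lemma phase_period k x i :
  phase k (x + L 0 i *: delta_mx 0 i) = phase k x + pi *+ 2 * (k 0 i)%:~R.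
Proof.
rewrite addrC phase_line phase_delta addrC /wavenumber mulrCA; congr (_ + _).
by rewrite [L 0 i * _]mulrC divfK ?gt_eqF// mulr_natl.
Qed.

Lemma periodic_wave a b k : Defs.periodic L (wave a b k).
Proof.
move=> x i; rewrite /wave phase_period !trig_int// => y; [exact: sinD2pi|exact: cosD2pi].
Qed.

Lemma continuous_wave a b k : continuous (wave a b k).
Proof. by have [c _ _] := elementary_stable (elementary_wave a b k); exact: c. Qed.

Lemma bounded_measurable_wave a b k : bounded_measurable (wave a b k).
Proof.
split; first by apply: continuous_measurable_rV; exact: continuous_wave.
exists (`|a| + `|b|) => x; rewrite (le_trans (ler_normD _ _))// !normrM.
by rewrite lerD// ler_piMr// ?cos_max ?sin_max.
Qed.

Lemma wavenumber_neq0 k : k != 0 -> exists i, wavenumber k i != 0.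
Proof.
move=> k0; have [i ki] : exists i, k 0 i != 0.
  apply/existsP; apply: contraNT k0; rewrite negb_exists => /forallP k0.
  by apply/eqP/rowP => i; rewrite mxE; apply/eqP/negPn/k0.
exists i; rewrite /wavenumber !mulf_eq0 !negb_or pnatr_eq0 intr_eq0 ki invr_eq0.
by rewrite (gt_eqF (L0 i)) (gt_eqF (pi_gt0 R)).
Qed.

(** For k != 0 some wavenumber is nonzero, and up to that factor the wave is the derivative of a
    periodic wave. *)
Lemma integral_wave a b k : k != 0 ->
  \int[lebesgue_rV R d]_(x in cell L) wave a b k x = 0.
Proof.
move=> /wavenumber_neq0[i ki].
have E x : 'D_(delta_mx 0 i) (wave (- b) a k) x = wavenumber k i * wave a b k x.
  by have [_ ->] := wave_derive (- b) a k (delta_mx 0 i) x; rewrite phase_delta opprK.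
have /eqP : \int[lebesgue_rV R d]_(x in cell L) 'D_(delta_mx 0 i) (wave (- b) a k) x = 0.
  apply: integral_cell_derive => //.
  - by move=> x; have [] := wave_derive (- b) a k (delta_mx 0 i) x.
  - have [_ _ /(_ (delta_mx 0 i)) /elementary_stable[]//] :=
      elementary_stable (elementary_wave (- b) a k).
  - exact: periodic_wave.
under eq_Rintegral do rewrite E.
rewrite RintegralZl//; last 2 first.
- exact: measurable_cell.
- exact/continuous_integrable_cell/continuous_wave.
by rewrite mulf_eq0 (negbTE ki) => /eqP.
Qed.

(* Hartley's kernel: a real orthonormal system indexed by all frequencies k. *)
Definition cas k := wave 1 1 k.

(** The derivative of cos + sin is cos - sin, which is cos + sin at the opposite phase: hence the
    exchange of k and - k. *)
Lemma cas_derive k v x :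
  derivable (cas k) x v /\ 'D_v (cas k) x = phase k v * cas (- k) x.
Proof.
have [? ->] := wave_derive 1 1 k v x; split => //.
by rewrite /cas /wave phaseN cosN sinN mulrN mulNr.
Qed.

Lemma cas_mul k l x : cas k x * cas l x = wave 1 0 (k - l) x + wave 0 1 (k + l) x.
Proof.
by rewrite /cas /wave !phaseD !phaseN !cosD !sinD cosN sinN; ring.
Qed.

(** Together with [cas_mul_sin], this shows that multiplication by a cosine or a sine maps the
    system to combinations of its members, so orthogonality to the whole system survives such a
    multiplication. *)
Lemma cas_mul_cos k l x :
  cas l x * wave 1 0 k x = 2^-1 * (cas (l + k) x + cas (l - k) x).
Proof.
rewrite /cas /wave !phaseD !phaseN !cosD !sinD cosN sinN; by field.
Qed.

Lemma cas_mul_sin k l x :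
  cas l x * wave 0 1 k x = 2^-1 * (cas (- (l - k)) x - cas (- (l + k)) x).
Proof.
rewrite /cas /wave !phaseN !phaseD !phaseN !cosN !sinN !cosD !sinD cosN sinN; by field.
Qed.

Lemma integral_cas_mul k l :
  \int[lebesgue_rV R d]_(x in cell L) (cas k x * cas l x) = volume L *+ (k == l).
Proof.
under eq_Rintegral do rewrite cas_mul.
rewrite RintegralD; last 3 first.
- exact: measurable_cell.
- exact/continuous_integrable_cell/continuous_wave.
- exact/continuous_integrable_cell/continuous_wave.
(* At k + l = 0, where [integral_wave] does not apply, the sine is identically zero. *)
have -> : \int[lebesgue_rV R d]_(x in cell L) wave 0 1 (k + l) x = 0.
  have [->|kl] := eqVneq (k + l) 0; last exact: integral_wave.
  under eq_Rintegral do rewrite /wave phase0 sin0 mulr0 mul0r addr0.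
  by rewrite Rintegral_cst ?mul0r//; exact: measurable_cell.
rewrite addr0; have [->|kl] := eqVneq k l.
  under eq_Rintegral do rewrite subrr /wave phase0 cos0 mulr1 mul0r addr0.
  rewrite Rintegral_cst; last exact: measurable_cell.
  by rewrite mul1r [X in fine X](lebesgue_cell L0).
by rewrite integral_wave// subr_eq0.
Qed.

End hartley.

(** * Completeness of the Hartley basis *)

(** A bounded approximation of the indicator of y > 0 that uses only products and exponentials,
    hence available in an algebra closed under bounded limits. With N = n+1, if y > 0 then N exp(-N
    y) <= 2 / (y^2 N) by the quadratic Taylor bound; if y <= 0 then N exp(-N y) >= N, and exp(-N) <=
    1/N. *)
Lemma exp_exp_cvg (R : realType) (y : R) :
  expR (- (n.+1%:R * expR (- (n.+1%:R * y)))) @[n --> \oo] --> (if 0 < y then 1 : R else 0).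
Proof.
case: ltP => y0.
  apply: (@squeeze_cvgr _ _ _ _ (fun n : nat => 1 - 2 / y ^+ 2 * harmonic n) (fun=> 1)); last 2 first.
  - rewrite -[X in _ --> X]subr0; apply: cvgB; first exact: cvg_cst.
    rewrite -(mulr0 (2 / y ^+ 2)); apply: cvgM; [exact: cvg_cst|exact: cvg_harmonic].
  - exact: cvg_cst.
  apply: nearW => n; apply/andP; split; last first.
    by rewrite -[leRHS]expR0 ler_expR oppr_le0 mulr_ge0// expR_ge0.
  apply: le_trans (expR_ge1Dx _); rewrite lerD2l lerN2 /harmonic /=.
  set N : R := n.+1%:R; have N0 : 0 < N by rewrite ltr0n.
  have Ny : 0 < N * y by rewrite mulr_gt0.
  rewrite expRN ler_pdivrMr ?expR_gt0//.
  have := expR_ge1Dxn 1 (ltW Ny); rewrite (_ : 2`!%:R = 2 :> R)// => H.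
  apply: (@le_trans _ _ (2 / y ^+ 2 / N * ((N * y) ^+ 2 / 2))); last first.
    rewrite ler_wpM2l//; first by rewrite !divr_ge0// ?exprn_ge0 ?ltW.
    by apply: le_trans H; rewrite lerDr.
  rewrite (_ : _ / N * _ = N)//; field.
  by rewrite !gt_eqF.
apply: (@squeeze_cvgr _ _ _ _ (fun=> 0) harmonic); last 2 first.
- exact: cvg_cst.
- exact: cvg_harmonic.
apply: nearW => n; rewrite expR_ge0 /= /harmonic /=.
set N : R := n.+1%:R; have N0 : 0 < N by rewrite ltr0n.
apply: (@le_trans _ _ (expR (- N))).
  rewrite ler_expR lerN2 -[leLHS]mulr1 ler_pM2l// -[leLHS]expR0 ler_expR.
  by rewrite oppr_ge0 mulr_ge0_le0// ltW.
rewrite expRN lef_pV2 ?posrE ?expR_gt0//.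
by apply: le_trans (expR_ge1Dx _); rewrite lerDr.
Qed.

(** * Arcs of the circle in terms of sine and cosine *)

Section arcs.
Context (R : realType).
Implicit Types a t : R.

Let sin_lt0 t : pi < t < pi *+ 2 -> sin t < 0.
Proof.
move=> /andP[t1 t2]; rewrite -(subrK pi t) sinDpi oppr_lt0 sin_gt0_pi//.
by rewrite subr_gt0 t1 ltrBlDr -mulr2n.
Qed.

(** The cosine is monotone only on each half circle, so the arc beyond [a] is described by a cosine
    condition together with the sign of the sine that tells the halves apart. This lemma and the
    next treat the two possible positions of [a]. *)
Lemma arc_lt_pi a t : 0 <= a < pi -> 0 <= t < pi *+ 2 ->
  (a < t) = (sin t < 0) || (cos t < cos a).
Proof.
move=> /andP[a0 ap] /andP[t0 tp]; have [tpi|pit] := leP t pi.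
  have -> : (sin t < 0) = false by apply/negbTE; rewrite -leNgt sin_ge0_pi ?t0.
  by rewrite /= ltr_cos ?in_itv/= ?t0 ?a0 ?tpi ?ltW.
by rewrite sin_lt0 ?pit//= (lt_trans ap).
Qed.

Lemma arc_ge_pi a t : pi <= a < pi *+ 2 -> 0 <= t < pi *+ 2 ->
  (a < t) = (sin t < 0) && (cos a < cos t).
Proof.
move=> /andP[pa a2] /andP[t0 tp]; have [tpi|pit] := leP t pi.
  rewrite ltNge (le_trans tpi pa)/=; apply/esym/negbTE; rewrite negb_and.
  by rewrite -leNgt sin_ge0_pi ?t0.
rewrite sin_lt0 ?pit//= -{2}(subrK pi a) -{2}(subrK pi t) !cosDpi ltrN2.
rewrite ltr_cos ?in_itv/= ?ltrD2r// ?subr_ge0 ?pa ?(ltW pit)//= lerBlDr -mulr2n ltW//.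
Qed.

End arcs.

Section completeness.
Context (R : realType) (d : nat) (L : 'rV[R]_d).
Hypothesis L0 : forall i, 0 < L 0 i.
Variable f : 'rV[R]_d -> R.
Hypothesis mf : measurable_fun setT f.
Hypothesis fi : (lebesgue_rV R d).-integrable (cell L) (EFin \o f).
Hypothesis f0 : forall k, \int[lebesgue_rV R d]_(x in cell L) (f x * cas L k x) = 0.

Let I (m : 'rV[R]_d -> R) := \int[lebesgue_rV R d]_(x in cell L) (f x * m x).

Let mcell : measurable (cell L). Proof. exact: measurable_cell. Qed.

Let intf m : bounded_measurable m ->
  (lebesgue_rV R d).-integrable (cell L) (EFin \o (fun x => f x * m x)).
Proof. exact: integrable_bounded. Qed.

Let ID m1 m2 : bounded_measurable m1 -> bounded_measurable m2 ->
  I (fun x => m1 x + m2 x) = I m1 + I m2.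
Proof.
move=> b1 b2; rewrite /I -RintegralD//; [|exact: intf..].
by apply: eq_Rintegral => x _; rewrite mulrDr.
Qed.

Let IZ c m : bounded_measurable m -> I (fun x => c * m x) = c * I m.
Proof.
move=> b1; rewrite /I -RintegralZl//; last exact: intf.
by apply: eq_Rintegral => x _; rewrite mulrCA.
Qed.

Let Icvg (m : nat -> 'rV[R]_d -> R) g M :
  (forall n, bounded_measurable (m n)) -> (forall n x, `|m n x| <= M) ->
  (forall x, m n x @[n --> \oo] --> g x) -> I (m n) @[n --> \oo] --> I g.
Proof.
move=> bm mM mg; apply: (@Rintegral_cvg _ _ _ _ _ mcell _ _ (fun x => `|f x| * M)).
- by move=> n; have /integrableP[/measurable_EFinP + _] := intf (bm n).
- by move=> x _; apply: cvgMr; exact: mg.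
- have bM : bounded_measurable (fun _ : 'rV[R]_d => `|M|) by exact: bounded_measurable_cst.
  apply: le_integrable (intf bM) => //.
    by apply/measurable_EFinP; apply: measurable_funM => //;
      apply: measurable_funTS; exact: measurableT_comp.
  by move=> x _ /=; rewrite lee_fin !normrM !normr_id.
- by move=> n x _; rewrite normrM ler_wpM2l.
Qed.

(* The bounded multipliers preserving [Ann] form an algebra closed under bounded
   pointwise limits and containing the trigonometric functions. Hence it contains
   the indicators of all Borel subsets of the cell, in particular the sign of f. *)
Let Ann p := bounded_measurable p /\ forall k, I (fun x => p x * cas L k x) = 0.

Let Mul m := bounded_measurable m /\ forall p, Ann p -> Ann (fun x => m x * p x).

Let bcas k : bounded_measurable (cas L k).
Proof. exact: bounded_measurable_wave. Qed.

Let Ann1 : Ann (fun=> 1).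
Proof.
split; first exact: bounded_measurable_cst.
by move=> k; rewrite -[RHS](f0 k); apply: eq_Rintegral => x _; rewrite mul1r.
Qed.

Let AnnD p q : Ann p -> Ann q -> Ann (fun x => p x + q x).
Proof.
move=> [bp p0] [bq q0]; split; first exact: bounded_measurableD.
move=> k; have -> : (fun x => (p x + q x) * cas L k x) =
    (fun x => p x * cas L k x + q x * cas L k x).
  by apply/funext => x; rewrite mulrDl.
by rewrite ID ?p0 ?q0 ?addr0//; exact: bounded_measurableM.
Qed.

Let AnnZ c p : Ann p -> Ann (fun x => c * p x).
Proof.
move=> [bp p0]; split.
  by apply: bounded_measurableM => //; exact: bounded_measurable_cst.
move=> k; have -> : (fun x => (c * p x) * cas L k x) = (fun x => c * (p x * cas L k x)).
  by apply/funext => x; rewrite mulrA.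
by rewrite IZ ?p0 ?mulr0//; exact: bounded_measurableM.
Qed.

Let MulD m1 m2 : Mul m1 -> Mul m2 -> Mul (fun x => m1 x + m2 x).
Proof.
move=> [b1 h1] [b2 h2]; split; first exact: bounded_measurableD.
move=> p Ap; have -> : (fun x => (m1 x + m2 x) * p x) = (fun x => m1 x * p x + m2 x * p x).
  by apply/funext => x; rewrite mulrDl.
by apply: AnnD; [exact: h1|exact: h2].
Qed.

Let MulM m1 m2 : Mul m1 -> Mul m2 -> Mul (fun x => m1 x * m2 x).
Proof.
move=> [b1 h1] [b2 h2]; split; first exact: bounded_measurableM.
move=> p Ap; have -> : (fun x => (m1 x * m2 x) * p x) = (fun x => m1 x * (m2 x * p x)).
  by apply/funext => x; rewrite mulrA.
exact/h1/h2.
Qed.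

Let MulC c : Mul (fun=> c).
Proof. by split; [exact: bounded_measurable_cst|exact: AnnZ]. Qed.

Let Mul_sum (m : nat -> 'rV[R]_d -> R) n :
  (forall i, Mul (m i)) -> Mul (fun x => \sum_(0 <= i < n) m i x).
Proof.
move=> hm; elim: n => [|n IH].
  by under eq_fun do rewrite big_nil; exact: MulC.
by under eq_fun do rewrite big_nat_recr//=; exact: MulD.
Qed.

Let MulX m n : Mul m -> Mul (fun x => m x ^+ n).
Proof.
move=> hm; elim: n => [|n IH]; first by under eq_fun do rewrite expr0; exact: MulC.
by under eq_fun do rewrite exprS; exact: MulM.
Qed.

Let Mul_cvg (m : nat -> 'rV[R]_d -> R) g M :
  (forall n, Mul (m n)) -> (forall n x, `|m n x| <= M) ->
  (forall x, m n x @[n --> \oo] --> g x) -> Mul g.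
Proof.
move=> hm mM mg.
have bg : bounded_measurable g.
  split.
    apply: (@measurable_fun_cvg _ _ _ _ m) => [n|x _]; [by have [[]] := hm n|exact: mg].
  exists M => x; have mgx : `|m n x| @[n --> \oo] --> `|g x| by apply: cvg_norm; exact: mg.
  rewrite -(cvg_lim (@Rhausdorff R) mgx).
  by apply: limr_le; [exact: cvgP mgx|apply: nearW => n; exact: mM].
split=> // p Ap; have [bp _] := Ap; split; first exact: bounded_measurableM.
move=> k.
have [_ [Mp pM]] := bp.
have : I (fun x => m n x * p x * cas L k x) @[n --> \oo] --> I (fun x => g x * p x * cas L k x).
  apply: (@Icvg (fun n x => m n x * p x * cas L k x) _ (M * (Mp * 2))).
  - by move=> n; apply: bounded_measurableM => //; apply: bounded_measurableM => //;
      have [] := hm n.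
  - move=> n x; rewrite -mulrA normrM ler_pM// normrM ler_pM//.
    rewrite (le_trans (ler_normD _ _))// !mul1r.
    by rewrite (_ : 2 = 1 + 1)// lerD ?cos_max ?sin_max.
  - by move=> x; apply: cvgMl; apply: cvgMl; exact: mg.
rewrite (_ : (fun n => I _) = cst 0); last first.
  by apply/funext => n; have [_ h] := hm n; have [_ ->] := h _ Ap.
by move/(cvg_lim (@Rhausdorff R)) => <-; rewrite lim_cst.
Qed.

(** The partial sums of the exponential series are polynomials in [m], bounded by exp M when |m| <=
    M, so the exponential is a bounded limit of multipliers. *)
Let Mul_exp m : Mul m -> Mul (fun x => expR (m x)).
Proof.
move=> hm; have [[_ [M mM]] _] := hm.
apply: (@Mul_cvg (fun n x => series (exp_coeff (m x)) n) _ (expR M)).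
- move=> n; apply: Mul_sum => i.
  rewrite /exp_coeff /=; apply: MulM; [exact: MulX|exact: MulC].
- move=> n x; apply: le_trans (_ : series (exp_coeff `|m x|) n <= _).
    rewrite /series /= (le_trans (ler_norm_sum _ _ _))//.
    by apply: ler_sum => i _; rewrite /exp_coeff /= normrM normrX [`|_%:R^-1|]ger0_norm.
  apply: le_trans (_ : expR `|m x| <= _); last by rewrite ler_expR.
  apply: nondecreasing_cvgn_le; last exact: is_cvg_series_exp_coeff.
  apply: nondecreasing_series => i _ _.
  by rewrite /exp_coeff /= divr_ge0// exprn_ge0.
- by move=> x; exact: is_cvg_series_exp_coeff.
Qed.

Let Mul_pos m : Mul m -> Mul (\1_[set x | 0 < m x]).
Proof.
move=> hm.
apply: (@Mul_cvg (fun n x => expR (- (n.+1%:R * expR (- (n.+1%:R * m x))))) _ 1).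
- move=> n; apply: Mul_exp.
  under eq_fun do rewrite -mulN1r; apply: MulM; first exact: MulC.
  apply: MulM; first exact: MulC.
  apply: Mul_exp.
  by under eq_fun do rewrite -mulN1r; apply: MulM; [exact: MulC|apply: MulM => //; exact: MulC].
- move=> n x; rewrite ger0_norm ?expR_ge0// -[leRHS]expR0 ler_expR oppr_le0.
- move=> x; rewrite indicE; have := @exp_exp_cvg R (m x).
  by case: ifPn => mx; [rewrite mem_set|rewrite memNset//; exact/negP].
Qed.

Let G : set (set 'rV[R]_d) := [set A | measurable A /\ Mul (\1_A)].

Let GC A : G A -> G (~` A).
Proof.
move=> [mA hA]; split; first exact: measurableC.
have -> : \1_(~` A) = (fun x => 1 + -1 * \1_A x) :> ('rV[R]_d -> R).
  apply/funext => x; rewrite !indicE in_setC mulN1r.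
  by case: (x \in A) => /=; rewrite ?subrr ?subr0.
by apply: MulD; [exact: MulC|apply: MulM => //; exact: MulC].
Qed.

Let GI A B : G A -> G B -> G (A `&` B).
Proof.
move=> [mA hA] [mB hB]; split; first exact: measurableI.
have -> : \1_(A `&` B) = (fun x => \1_A x * \1_B x) :> ('rV[R]_d -> R).
  apply/funext => x; rewrite !indicE in_setI.
  by case: (x \in A) => /=; rewrite ?mul1r ?mul0r.
exact: MulM.
Qed.

Let GT : G setT.
Proof.
split => //; rewrite (_ : \1_setT = fun=> 1); first exact: MulC.
by apply/funext => x; rewrite indicE in_setT.
Qed.

Let G_bigcap_ord (F : nat -> set 'rV[R]_d) n : (forall i, G (F i)) ->
  G (\big[setI/setT]_(i < n) F i).
Proof. by move=> GF; apply: big_ind => [||i _]; [exact: GT|exact: GI|exact: GF]. Qed.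

Let G_bigcap (F : nat -> set 'rV[R]_d) : (forall i, G (F i)) ->
  G (\bigcap_i F i).
Proof.
move=> GF; split; first by apply: bigcapT_measurable => i; have [] := GF i.
apply: (@Mul_cvg (fun n => \1_(\big[setI/setT]_(i < n) F i)) _ 1).
- by move=> n; have [] := G_bigcap_ord n GF.
- by move=> n x; rewrite indicE; case: (_ \in _); rewrite ?normr1 ?normr0.
move=> x; have [xF|] := pselect ((\bigcap_i F i) x).
  rewrite [X in _ --> X](_ : _ = 1); last by rewrite indicE mem_set.
  rewrite (_ : (fun n => _) = cst 1); first exact: cvg_cst.
  apply/funext => n; rewrite indicE mem_set//.
  by rewrite -bigcap_mkord => i _; exact: xF.
move=> xF; rewrite [X in _ --> X](_ : _ = 0); last by rewrite indicE memNset.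
have [i nFi] : exists i, ~ F i x.
  by apply: contrapT => H; apply: xF => i _; apply: contrapT => nF; apply: H; exists i.
apply: cvg_near_cst; exists i.+1 => // n /= ni.
by rewrite indicE memNset// -bigcap_mkord => /(_ i ni).
Qed.

Let sigmaG : sigma_algebra setT G.
Proof.
split.
- by have := GC GT; rewrite setCT.
- by move=> A GA; rewrite setTD; exact: GC.
- move=> F GF; rewrite -[X in G X]setCK setC_bigcup; apply: GC; apply: G_bigcap => i.
  exact: GC.
Qed.

(** All integrals are over the cell, so only the trace of a set on the cell matters. This allows
    sets described by periodic functions to stand for non-periodic ones. *)
Let G_cell A B : measurable A -> A `&` cell L = B `&` cell L -> G B -> G A.
Proof.
move=> mA AB [mB [_ hB]]; split=> //; split.
  by split; [exact: measurable_indic|exists 1 => x; rewrite indicE; case: (_ \in _); rewrite ?normr1 ?normr0].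
move=> p Ap; split.
  apply: bounded_measurableM; last by have [] := Ap.
  by split; [exact: measurable_indic|exists 1 => x; rewrite indicE; case: (_ \in _); rewrite ?normr1 ?normr0].
move=> k; have [_ /(_ k) <-] := hB _ Ap.
apply: eq_Rintegral => x /set_mem cx; congr (_ * (_ * _ * _)); rewrite !indicE; congr (_%:R).
congr nat_of_bool; apply/idP/idP => /set_mem Ax; apply/mem_set.
  have : (A `&` cell L) x by []. by rewrite AB => -[].
have : (B `&` cell L) x by []. by rewrite -AB => -[].
Qed.

Let Mul_cos k : Mul (wave L 1 0 k).
Proof.
split; first exact: bounded_measurable_wave.
move=> p [bp p0]; split.
  by apply: bounded_measurableM => //; exact: bounded_measurable_wave.
move=> l.
have -> : (fun x => wave L 1 0 k x * p x * cas L l x) =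
  (fun x => 2^-1 * (p x * cas L (l + k) x + p x * cas L (l - k) x)).
  by apply/funext => x; rewrite -mulrDr mulrCA -(cas_mul_cos L k l x); ring.
by rewrite IZ ?ID ?p0 ?addr0 ?mulr0//; try apply: bounded_measurableD; exact: bounded_measurableM.
Qed.

Let Mul_sin k : Mul (wave L 0 1 k).
Proof.
split; first exact: bounded_measurable_wave.
move=> p [bp p0]; split.
  by apply: bounded_measurableM => //; exact: bounded_measurable_wave.
move=> l.
have -> : (fun x => wave L 0 1 k x * p x * cas L l x) =
  (fun x => 2^-1 * (p x * cas L (- (l - k)) x + -1 * (p x * cas L (- (l + k)) x))).
  apply/funext => x; rewrite mulN1r -mulrBr mulrCA -(cas_mul_sin L k l x); ring.
have b1 k' : bounded_measurable (fun x => p x * cas L k' x) by exact: bounded_measurableM.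
have b2 k' : bounded_measurable (fun x => -1 * (p x * cas L k' x)).
  by apply: bounded_measurableM => //; exact: bounded_measurable_cst.
by rewrite IZ ?ID ?IZ ?p0 ?mulr0 ?addr0 ?mulr0//; exact: bounded_measurableD.
Qed.

Let Gpos m : Mul m -> G [set x | 0 < m x].
Proof.
move=> hm; split; last exact: Mul_pos.
have [[mm _] _] := hm.
have := mm measurableT _ (measurable_itv `]0, +oo[); rewrite setTI.
rewrite (_ : _ @^-1` _ = [set x | 0 < m x])//.
by apply/seteqP; split => x /=; rewrite in_itv/= andbT.
Qed.

Let GU A B : G A -> G B -> G (A `|` B).
Proof.
by move=> GA GB; rewrite -[_ `|` _]setCK setCU; apply/GC/GI; exact: GC.
Qed.

Let angle i (x : 'rV[R]_d) : phase L (delta_mx 0 i) x = 2 * pi * (x 0 i / L 0 i).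
Proof.
rewrite phaseE (bigD1 i)//= big1 ?addr0 => [|j ji].
  by rewrite /wavenumber mxE !eqxx [_%:~R](_ : _ = 1 :> R)//; ring.
by rewrite /wavenumber mxE (negbTE ji) mul0r mulr0 mul0r.
Qed.

Let G_sin i : G [set x | sin (phase L (delta_mx 0 i) x) < 0].
Proof.
have := Gpos (MulM (MulC (-1)) (Mul_sin (delta_mx 0 i))).
rewrite (_ : mkset _ = [set x | sin (phase L (delta_mx 0 i) x) < 0])//.
by apply/seteqP; split => x /=; rewrite /wave mul0r add0r mul1r mulN1r oppr_gt0.
Qed.

Let G_cos i c : G [set x | cos (phase L (delta_mx 0 i) x) < c].
Proof.
have := Gpos (MulD (MulC c) (MulM (MulC (-1)) (Mul_cos (delta_mx 0 i)))).
rewrite (_ : mkset _ = [set x | cos (phase L (delta_mx 0 i) x) < c])//.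
by apply/seteqP; split => x /=; rewrite /wave mul0r addr0 mul1r mulN1r subr_gt0.
Qed.

Let G_cos' i c : G [set x | c < cos (phase L (delta_mx 0 i) x)].
Proof.
have := Gpos (MulD (Mul_cos (delta_mx 0 i)) (MulC (- c))).
rewrite (_ : mkset _ = [set x | c < cos (phase L (delta_mx 0 i) x)])//.
by apply/seteqP; split => x /=; rewrite /wave mul0r addr0 mul1r subr_gt0.
Qed.

(** On the cell the angle 2 pi x_i / L_i stays in [0, 2 pi), where the condition a < x_i cuts out an
    arc. The arc is a union or an intersection of sets defined by a sine and a cosine, according to
    the half circle in which it starts. For [a] outside [0, L_i) the trace on the cell is full or
    empty. *)
Let G_ray i a : G [set x | a < x 0 i].
Proof.
have mA : measurable [set x : 'rV[R]_d | a < x 0 i].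
  have := @measurable_coord R d i measurableT _ (measurable_itv `]a, +oo[); rewrite setTI.
  rewrite (_ : _ @^-1` _ = [set x : 'rV[R]_d | a < x 0 i])//.
  by apply/seteqP; split => x /=; rewrite in_itv/= andbT.
have [a0|a0] := ltP a 0.
  apply: (G_cell mA _ GT); rewrite setTI; apply/setIidr => x cx /=.
  by have /andP[+ _] := cx i; exact: lt_le_trans.
have [aL|La] := ltP a (L 0 i); last first.
  have : G set0 by have := GC GT; rewrite setCT.
  apply: (G_cell mA); rewrite set0I; apply/seteqP; split => // x [/= ax cx].
  by have /andP[_ xL] := cx i; have := lt_trans ax xL; rewrite ltNge La.
pose al : R := 2 * pi * (a / L 0 i).
have p2 : 0 < 2 * pi :> R by rewrite mulr_gt0// pi_gt0.
have Li := L0 i.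
have al0 : 0 <= al by rewrite mulr_ge0 ?(ltW p2)// divr_ge0// (ltW Li).
have al2 : al < pi *+ 2 by rewrite /al -[pi *+ 2]mulr_natl gtr_pMr// ltr_pdivrMr// mul1r.
have tht x : cell L x -> 0 <= phase L (delta_mx 0 i) x < pi *+ 2.
  move=> /(_ i)/andP[x0 xL]; rewrite angle; apply/andP; split.
    by rewrite mulr_ge0 ?(ltW p2)// divr_ge0// (ltW Li).
  by rewrite -[pi *+ 2]mulr_natl gtr_pMr// ltr_pdivrMr// mul1r.
have E (x : 'rV[R]_d) : (a < x 0 i) = (al < phase L (delta_mx 0 i) x).
  by rewrite angle /al ltr_pM2l// ltr_pM2r// invr_gt0.
have [alp|pal] := ltP al pi.
  apply: (G_cell mA _ (GU (G_sin i) (G_cos i (cos al)))).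
  apply/seteqP; split => x [/= ax cx]; split=> //.
    by move: ax; rewrite E (arc_lt_pi _ (tht x cx)) ?al0// => /orP.
  by rewrite E (arc_lt_pi _ (tht x cx)) ?al0//; exact/orP.
apply: (G_cell mA _ (GI (G_sin i) (G_cos' i (cos al)))).
apply/seteqP; split => x [/= ax cx]; split=> //.
  by move: ax; rewrite E (arc_ge_pi _ (tht x cx)) ?pal// => /andP.
by rewrite E (arc_ge_pi _ (tht x cx)) ?pal//; exact/andP.
Qed.

Let G_coord i (Y : set R) : measurable Y -> G ((fun x : 'rV[R]_d => x 0 i) @^-1` Y).
Proof.
have GG : @RGenOInfty.G R `<=` [set Y | G ((fun x : 'rV[R]_d => x 0 i) @^-1` Y)].
  move=> _ [a ->]; change (G ((fun x : 'rV[R]_d => x 0 i) @^-1` `]a, +oo[)).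
  suff -> : (fun x : 'rV[R]_d => x 0 i) @^-1` `]a, +oo[ = [set x | a < x 0 i] by exact: G_ray.
  by apply/seteqP; split => x /=; rewrite in_itv/= andbT.
suff sH : sigma_algebra setT [set Y | G ((fun x : 'rV[R]_d => x 0 i) @^-1` Y)].
  have := smallest_sub sH GG.
  move=> H mY; apply: H; have : measurable Y by exact: mY.
  by rewrite [X in X Y -> _](RGenOInfty.measurableE R).
case: sigmaG => s0 sC sU; split => /=.
- by rewrite preimage_set0.
- by move=> A GA; rewrite setTD preimage_setC; exact: GC.
- by move=> A GA; rewrite preimage_bigcup; exact: sU.
Qed.

Let G_all A : measurable A -> G A.
Proof.
move=> mA; apply: (smallest_sub sigmaG _ mA).
move=> B; rewrite -bigcup_seq => -[i _] [Y mY <-].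
by rewrite setTI; exact: G_coord.
Qed.

(** The difference of the indicators of f > 0 and f < 0 is a multiplier. Applied to the constant 1
    and tested at frequency 0, where [cas] is 1, it shows that the integral of |f| vanishes. *)
Lemma cas_complete : {ae lebesgue_rV R d, forall x, cell L x -> f x = 0}.
Proof.
have mpos (g : 'rV[R]_d -> R) : measurable_fun setT g -> measurable [set x | 0 < g x].
  move=> mg; have := mg measurableT _ (measurable_itv `]0, +oo[); rewrite setTI.
  rewrite (_ : _ @^-1` _ = [set x | 0 < g x])//.
  by apply/seteqP; split => x /=; rewrite in_itv/= andbT.
have [_ M1] := G_all (mpos _ mf).
have [_ M2] := G_all (mpos _ (measurableT_comp (@oppr_measurable R setT) mf)).
have [[b _] hM] := MulD M1 (MulM (MulC (-1)) M2).
have [_ /(_ 0)] := hM _ Ann1.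
move=> I0.
have {I0} : \int[lebesgue_rV R d]_(x in cell L) `|f x| = 0.
  rewrite -[RHS]I0; apply: eq_Rintegral => x _.
  rewrite /cas /wave phase0 cos0 sin0 !mulr1 mulr0 addr0 !mulr1 mulN1r.
  rewrite !indicE; have [f1|f1|f1] := ltgtP (f x) 0.
  - rewrite memNset /=; last by rewrite ltNge (ltW f1).
    by rewrite mem_set /= ?oppr_gt0// ltr0_norm// sub0r mulrN1.
  - rewrite mem_set //= memNset /=; last by rewrite oppr_gt0 ltNge (ltW f1).
    by rewrite gtr0_norm// subr0 mulr1.
  - by rewrite f1 normr0 mul0r.
have ifa : (lebesgue_rV R d).-integrable (cell L) (EFin \o (fun x => `|f x|)).
  exact: (integrable_abse fi).
rewrite /Rintegral => I0.
have : (\int[lebesgue_rV R d]_(x in cell L) `|(EFin \o f) x| = 0)%E.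
  have := integrable_fin_num mcell ifa => /fineK; rewrite -[X in fine X]/(\int[lebesgue_rV R d]_(x in cell L) (`|f x|)%:E)%E I0 => /esym.
  by [].
move/ae_eq_integral_abs => /(_ mcell) [].
  by apply/measurable_EFinP; exact: measurable_funTS.
move=> N [mN N0 H]; exists N; split => // x /= nx; apply: H => /= H; apply: nx => cx.
by have [] := H cx.
Qed.

End completeness.

(** * Hilbert space theory *)

Section esum_seq.
Context (R : realType) (K : choiceType) (a : K -> R).

Lemma esum_ge_seq (s : seq K) : uniq s ->
  ((\sum_(k <- s) a k)%:E <= \esum_(k in [set: K]) (a k)%:E)%E.
Proof.
move=> us; apply: esum_ge; exists [set` s]; first by split.
by rewrite -fsbig_seq//= sumEFin.
Qed.

Lemma esum_le_seq (M : \bar R) :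
  (forall s, uniq s -> ((\sum_(k <- s) a k)%:E <= M)%E) ->
  (\esum_(k in [set: K]) (a k)%:E <= M)%E.
Proof.
move=> aM; apply: ge_ereal_sup => _ [A [fA _] <-].
rewrite fsbig_finite//= sumEFin; apply: aM; exact: finmap.fset_uniq.
Qed.

Lemma esum_approx_seq (S e : R) : \esum_(k in [set: K]) (a k)%:E = S%:E ->
  0 < e -> exists2 s, uniq s & S - e <= \sum_(k <- s) a k.
Proof.
move=> aS e0; apply: contrapT => H.
have : (\esum_(k in [set: K]) (a k)%:E <= (S - e)%:E)%E.
  apply: esum_le_seq => s us; rewrite lee_fin leNgt; apply/negP => lts.
  by apply: H; exists s => //; exact: ltW.
by rewrite aS lee_fin lerBrDr gerDl leNgt e0.
Qed.

End esum_seq.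

Lemma le_geometric (R : realType) (x a C : R) :
  (forall n, x <= a + C * 4^-1 ^+ n) -> x <= a.
Proof.
move=> H; have lima : a + C * 4^-1 ^+ n @[n --> \oo] --> a.
  rewrite -[X in _ --> X]addr0 -(mulr0 C); apply: cvgD; first exact: cvg_cst.
  apply: cvgM; [exact: cvg_cst|apply: cvg_expr].
  by rewrite ger0_norm// invf_lt1// ltr1n.
rewrite -(cvg_lim (@Rhausdorff R) lima).
by apply: limr_ge; [exact: cvgP lima|exact: nearW].
Qed.

Section L2_theory.
Context (R : realType) (d : nat) (L : 'rV[R]_d).
Hypothesis L0 : forall i, 0 < L 0 i.
Implicit Types (f g : 'rV[R]_d -> R) (k : 'rV[int]_d) (s t : seq 'rV[int]_d).

Local Notation mu := (lebesgue_rV R d).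

Let mcell : measurable (cell L). Proof. exact: measurable_cell. Qed.
Let V0 : 0 < volume L. Proof. exact: volume_gt0. Qed.

Definition square_integrable f := measurable_fun setT f /\
  (\int[mu]_(x in cell L) (f x ^+ 2)%:E < +oo)%E.

(** Normalized by the volume, which makes the functions [cas L k] orthonormal and matches the
    normalization of [L2_sqnorm]. *)
Definition ip f g : R := (volume L)^-1 * \int[mu]_(x in cell L) (f x * g x).

Lemma integrable_square f : square_integrable f ->
  mu.-integrable (cell L) (EFin \o (fun x => f x ^+ 2)).
Proof.
move=> [mf f2]; apply/integrableP; split.
  by apply/measurable_EFinP/measurable_funTS; exact: measurable_funX.
by apply: le_lt_trans f2; under eq_integral do rewrite /= ger0_norm ?sqr_ge0//.
Qed.

Lemma integrable_mul f g : square_integrable f -> square_integrable g ->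
  mu.-integrable (cell L) (EFin \o (fun x => f x * g x)).
Proof.
move=> hf hg; have [mf _] := hf; have [mg _] := hg.
apply: (le_integrable mcell _ _ (integrableD mcell (integrable_square hf) (integrable_square hg))).
  by apply/measurable_EFinP/measurable_funTS; exact: measurable_funM.
move=> x _ /=; rewrite lee_fin normrM [leRHS]ger0_norm ?addr_ge0 ?sqr_ge0//.
rewrite -(real_normK (num_real (f x))) -(real_normK (num_real (g x))).
have := sqr_ge0 (`|f x| - `|g x|); have : 0 <= `|f x| * `|g x| by rewrite mulr_ge0.
by move: (`|f x|) (`|g x|) => u v; nra.
Qed.

Lemma square_integrable_bounded f : bounded_measurable f -> square_integrable f.
Proof.
move=> bf; have [mf [M fM]] := bf; split=> //.
have : mu.-integrable (cell L) (EFin \o (fun x => f x ^+ 2)).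
  apply: (@bounded_integrable_cell _ _ _ _ (M ^+ 2)) => //; first exact: measurable_funX.
  by move=> x _; rewrite normrX lerXn2r ?nnegrE// (le_trans _ (fM x)).
by move=> /integrableP[_]; under eq_integral do rewrite /= ger0_norm ?sqr_ge0//.
Qed.

Lemma square_integrable_integrable f : square_integrable f ->
  mu.-integrable (cell L) (EFin \o f).
Proof.
move=> hf; have h1 : square_integrable (fun=> 1).
  by apply: square_integrable_bounded; exact: bounded_measurable_cst.
have := integrable_mul hf h1; rewrite (_ : EFin \o _ = EFin \o f)//.
by apply/funext => x /=; rewrite mulr1.
Qed.

Lemma integrable_square_integrable f : measurable_fun setT f ->
  mu.-integrable (cell L) (EFin \o (fun x => f x ^+ 2)) -> square_integrable f.
Proof.
move=> mf /integrableP[_ fi]; split => //; apply: le_lt_trans fi.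
by rewrite le_eqVlt; apply/orP; left; apply/eqP; apply: eq_integral => x _ /=;
  rewrite ger0_norm ?sqr_ge0.
Qed.

Lemma square_integrableZ c f : square_integrable f ->
  square_integrable (fun x => c * f x).
Proof.
move=> hf; have [mf _] := hf.
apply: integrable_square_integrable; first exact: measurable_funM.
rewrite (_ : EFin \o _ = (fun x => (c ^+ 2)%:E * (EFin \o (fun x => (f x ^+ 2)%R)) x)%E).
  exact/integrableZl/integrable_square.
by apply/funext => x /=; rewrite -EFinM exprMn.
Qed.

Lemma square_integrableD f g : square_integrable f -> square_integrable g ->
  square_integrable (fun x => f x + g x).
Proof.
move=> hf hg; have [mf _] := hf; have [mg _] := hg.
apply: integrable_square_integrable; first exact: measurable_funD.
have := integrableD mcell (integrableD mcell (integrable_square hf)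
  (integrableZl mcell 2 (integrable_mul hf hg))) (integrable_square hg).
rewrite (_ : (fun x => _) = EFin \o (fun x => (f x + g x) ^+ 2))//.
by apply/funext => x /=; rewrite -!EFinD; congr EFin; ring.
Qed.

Lemma square_integrableB f g : square_integrable f -> square_integrable g ->
  square_integrable (fun x => f x - g x).
Proof.
move=> hf hg; rewrite (_ : (fun x => _) = (fun x => f x + -1 * g x)); last first.
  by apply/funext => x; rewrite mulN1r.
by apply: square_integrableD => //; exact: square_integrableZ.
Qed.

Lemma ipC f g : ip f g = ip g f.
Proof. by rewrite /ip; congr (_ * _); apply: eq_Rintegral => x _; rewrite mulrC. Qed.

Lemma ipDl f g h : square_integrable f -> square_integrable g ->
  square_integrable h -> ip (fun x => f x + g x) h = ip f h + ip g h.
Proof.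
move=> hf hg hh; rewrite /ip -mulrDr -RintegralD//; [|exact: integrable_mul..].
by congr (_ * _); apply: eq_Rintegral => x _; rewrite mulrDl.
Qed.

Lemma ipZl c f h : square_integrable f -> square_integrable h ->
  ip (fun x => c * f x) h = c * ip f h.
Proof.
move=> hf hh; rewrite /ip mulrCA; congr (_ * _).
rewrite -RintegralZl//; last exact: integrable_mul.
by apply: eq_Rintegral => x _; rewrite mulrA.
Qed.

Lemma ipBl f g h : square_integrable f -> square_integrable g ->
  square_integrable h -> ip (fun x => f x - g x) h = ip f h - ip g h.
Proof.
move=> hf hg hh; rewrite (_ : (fun x => _) = (fun x => f x + -1 * g x)); last first.
  by apply/funext => x; rewrite mulN1r.
by rewrite ipDl ?ipZl ?mulN1r//; exact: square_integrableZ.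
Qed.

Lemma ip_ge0 f : 0 <= ip f f.
Proof.
rewrite mulr_ge0 ?invr_ge0 ?(ltW V0)//; apply: Rintegral_ge0 => x _.
by rewrite -expr2 sqr_ge0.
Qed.

Lemma ipBB f g : square_integrable f -> square_integrable g ->
  ip (fun x => f x - g x) (fun x => f x - g x) = ip f f - 2 * ip f g + ip g g.
Proof.
move=> hf hg; have hB := square_integrableB hf hg.
rewrite ipBl// ![ip _ (fun x => f x - g x)]ipC !ipBl// (ipC g f); ring.
Qed.

Lemma cauchy_schwarz f g : square_integrable f -> square_integrable g ->
  ip f g ^+ 2 <= ip f f * ip g g.
Proof.
move=> hf hg.
have H c : 0 <= ip f f - 2 * (c * ip f g) + c ^+ 2 * ip g g.
  have := ip_ge0 (fun x => f x - c * g x).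
  have hcg := square_integrableZ c hg.
  by rewrite ipBB// (ipC f) !ipZl// (ipC g (fun x => c * g x)) ipZl// (ipC g f) [_ * (_ * ip g g)]mulrA -expr2.
have := ip_ge0 g; rewrite le_eqVlt => /predU1P[g0|g0].
  rewrite -g0 mulr0; have [->|b0] := eqVneq (ip f g) 0; first by rewrite expr0n.
  (* When [ip g g = 0] the polynomial in [c] is affine, and this value of [c] makes it equal to
     -1. *)
  have := H ((ip f f + 1) / (2 * ip f g)).
  rewrite -g0 mulr0 addr0 (_ : 2 * _ = ip f f + 1); last by field.
  by move=> h; exfalso; lra.
have := H (ip f g / ip g g).
rewrite (_ : _ + _ = (ip f f * ip g g - ip f g ^+ 2) / ip g g); last first.
  by field; rewrite gt_eqF.
by rewrite pmulr_lge0 ?invr_gt0// subr_ge0.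
Qed.

Definition hcoef k f := ip f (cas L k).

Lemma square_integrable_cas k : square_integrable (cas L k).
Proof. by apply: square_integrable_bounded; exact: bounded_measurable_wave. Qed.

Lemma ip_cas k l : ip (cas L k) (cas L l) = (k == l)%:R.
Proof.
by rewrite /ip integral_cas_mul// -[volume L *+ _]mulr_natr mulrA mulVf ?mul1r// gt_eqF.
Qed.

Definition hpartial (c : 'rV[int]_d -> R) s : 'rV[R]_d -> R :=
  fun x => \sum_(k <- s) c k * cas L k x.

Lemma square_integrable_hpartial c s : square_integrable (hpartial c s).
Proof.
elim: s => [|k s IH].
  rewrite (_ : hpartial _ _ = fun=> 0); last by apply/funext => x; rewrite /hpartial big_nil.
  by apply: square_integrable_bounded; exact: bounded_measurable_cst.
rewrite (_ : hpartial _ _ = fun x => c k * cas L k x + hpartial c s x); last first.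
  by apply/funext => x; rewrite /hpartial big_cons.
by apply: square_integrableD => //; exact/square_integrableZ/square_integrable_cas.
Qed.

Lemma ip_hpartial f c s : square_integrable f ->
  ip (hpartial c s) f = \sum_(k <- s) c k * hcoef k f.
Proof.
move=> hf; elim: s => [|k s IH].
  rewrite big_nil /ip (_ : Rintegral _ _ _ = 0) ?mulr0//.
  under eq_Rintegral do rewrite /hpartial big_nil mul0r.
  by rewrite Rintegral_cst// mul0r.
rewrite (_ : hpartial _ _ = fun x => c k * cas L k x + hpartial c s x); last first.
  by apply/funext => x; rewrite /hpartial big_cons.
have hk := square_integrable_cas k.
rewrite ipDl//; [|exact: square_integrableZ|exact: square_integrable_hpartial].
by rewrite IH ipZl// big_cons /hcoef ipC.
Qed.

Lemma hcoef_hpartial c s k : uniq s ->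
  hcoef k (hpartial c s) = if k \in s then c k else 0.
Proof.
move=> us; rewrite /hcoef ip_hpartial; last exact: square_integrable_cas.
case: ifPn => ks.
  rewrite (bigD1_seq k)//= /hcoef ip_cas eqxx mulr1 big1 ?addr0// => l lk.
  by rewrite /hcoef ip_cas eq_sym (negbTE lk) mulr0.
rewrite big_seq big1// => l ls; rewrite /hcoef ip_cas.
by case: eqVneq ls ks => [->->//|]; rewrite mulr0.
Qed.

Lemma ip_hpartial_sub c s t : uniq s -> uniq t -> {subset s <= t} ->
  ip (hpartial c s) (hpartial c t) = \sum_(k <- s) c k ^+ 2.
Proof.
move=> us ut st; rewrite ip_hpartial; last exact: square_integrable_hpartial.
rewrite big_seq [RHS]big_seq; apply: eq_bigr => k ks.
by rewrite hcoef_hpartial// st.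
Qed.

Lemma bessel_eq f s : square_integrable f -> uniq s ->
  let g := hpartial (hcoef^~ f) s in
  ip (fun x => f x - g x) (fun x => f x - g x) = ip f f - \sum_(k <- s) hcoef k f ^+ 2.
Proof.
move=> hf us /=; rewrite ipBB//; last exact: square_integrable_hpartial.
rewrite ip_hpartial_sub// ipC ip_hpartial//.
rewrite [X in 2 * X](_ : _ = \sum_(k <- s) hcoef k f ^+ 2); last first.
  by apply: eq_bigr => k _; rewrite expr2.
ring.
Qed.

Lemma bessel f s : square_integrable f -> uniq s ->
  \sum_(k <- s) hcoef k f ^+ 2 <= ip f f.
Proof. by move=> hf us; rewrite -subr_ge0 -bessel_eq// ip_ge0. Qed.

(** * The Riesz-Fischer theorem *)

Section riesz_fischer.
Variables (c : 'rV[int]_d -> R) (S : R).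
Hypothesis cS : \esum_(k in [set: 'rV[int]_d]) (c k ^+ 2)%:E = S%:E.

Let c0 k : 0 <= c k ^+ 2. Proof. exact: sqr_ge0. Qed.

Let sumS s : uniq s -> \sum_(k <- s) c k ^+ 2 <= S.
Proof. by move=> us; rewrite -lee_fin -cS; exact: esum_ge_seq. Qed.

(** These bound squared errors; the errors themselves are bounded by 2^-n, which is summable, and
    this yields convergence almost everywhere without extracting a subsequence. *)
Let e n : R := 4^-1 ^+ n.
Let e0 n : 0 < e n. Proof. by rewrite exprn_gt0. Qed.

Let ex_seq : exists t : nat -> seq 'rV[int]_d, forall n,
  uniq (t n) /\ S - e n <= \sum_(k <- t n) c k ^+ 2.
Proof.
have H n : exists s, uniq s /\ S - e n <= \sum_(k <- s) c k ^+ 2.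
  by have [s us sS] := esum_approx_seq cS (e0 n); exists s.
by have [t tH] := choice H; exists t.
Qed.

(** Once the finite sets are nested, the difference of two partial sums has as squared norm the
    difference of the two sums of squares, which is at most [e n]. *)
Let mono_seq : exists t : nat -> seq 'rV[int]_d, forall n,
  [/\ uniq (t n), S - e n <= \sum_(k <- t n) c k ^+ 2 &
    forall m, (n <= m)%N -> {subset t n <= t m}].
Proof.
have [t Ht] := ex_seq.
pose T := fix T n := if n is m.+1 then undup (T m ++ t n) else t n.
have uT n : uniq (T n).
  by case: n => [|n]; [have [] := Ht 0%N|exact: undup_uniq].
have tT n : {subset t n <= T n}.
  by case: n => [//|n] k kt /=; rewrite mem_undup mem_cat kt orbT.
exists T => n; split => //.
- have [un tn] := Ht n; apply: (le_trans tn).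
  rewrite [leRHS](bigID (fun k => k \in t n)) -[leLHS]addr0 lerD//; last exact: sumr_ge0.
  rewrite -big_filter le_eqVlt; apply/orP; left; apply/eqP.
  apply: perm_big; apply: uniq_perm => //; first by rewrite filter_uniq.
  by move=> k; rewrite mem_filter; case: (boolP (k \in t n)) => // kt; rewrite tT.
- move=> m; elim: m => [|m IH]; first by rewrite leqn0 => /eqP ->.
  rewrite leq_eqVlt => /predU1P[->//|nm] k kn /=.
  by rewrite mem_undup mem_cat (IH nm).
Qed.

(** The increments of the partial sums along nested sets have an integrable sum, so the partial sums
    converge almost everywhere. Fatou's lemma bounds the distance from each partial sum to the
    limit, and the Cauchy-Schwarz inequality transfers this bound to the coefficients. *)
Lemma riesz_fischer : exists f, [/\ square_integrable f, Defs.periodic L f,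
  forall k, hcoef k f = c k & ip f f <= S].
Proof.
have [t Ht] := mono_seq.
pose u n := hpartial c (t n).
have su n : square_integrable (u n) by exact: square_integrable_hpartial.
have mu_ n : measurable_fun setT (u n) by have [] := su n.
have uu m n : (n <= m)%N ->
    ip (fun x => u m x - u n x) (fun x => u m x - u n x) <= e n.
  move=> nm; have [un tn nt] := Ht n; have [um tm _] := Ht m.
  rewrite ipBB// (ipC (u m) (u n)) !ip_hpartial_sub//; last exact: nt.
  have := sumS um; lra.
have uE m n : (n <= m)%N ->
    (\int[mu]_(x in cell L) ((u m x - u n x) ^+ 2)%:E <= (volume L * e n)%:E)%E.
  move=> nm; have si := square_integrableB (su m) (su n).
  rewrite -(fineK (integrable_fin_num mcell (integrable_square si))) lee_fin.
  by have := uu _ _ nm; rewrite /ip mulrC ler_pdivrMr// mulrC.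
have ucvg : {ae mu, forall x, cell L x -> cvgn (u ^~ x)}.
  pose w n x := `|u n.+1 x - u n x|.
  have iw n : (\int[mu]_(x in cell L) (w n x)%:E <= (volume L * 2^-1 ^+ n)%:E)%E.
    have si := square_integrableB (su n.+1) (su n).
    have ig2 := integrable_square si.
    have iw : mu.-integrable (cell L) (EFin \o w n).
      exact: (integrable_abse (square_integrable_integrable si)).
    rewrite -(fineK (integrable_fin_num mcell iw)) lee_fin.
    (* Young's inequality z <= h/2 + z^2 / (2 h) is used with h^2 = [e n], which balances the two
       terms: each integrates to at most h/2 times the volume. *)
    set h : R := 2^-1 ^+ n; have h0 : 0 < h by rewrite exprn_gt0.
    have eh : e n = h ^+ 2.
      by rewrite /e /h -exprM mulnC exprM; congr (_ ^+ _); field.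
    have ic : mu.-integrable (cell L) (EFin \o (fun=> h / 2)).
      apply: (@bounded_integrable_cell _ _ _ _ `|h / 2|) => //.
    have ig3 : mu.-integrable (cell L) (EFin \o (fun x => h^-1 / 2 * (u n.+1 x - u n x) ^+ 2)).
      rewrite (_ : EFin \o _ = (fun x => (h^-1 / 2)%:E * (EFin \o (fun x => ((u n.+1 x - u n x) ^+ 2)%R)) x)%E).
        exact: integrableZl.
      by apply/funext => x /=; rewrite EFinM.
    apply: (@le_trans _ _ (\int[mu]_(x in cell L) (h / 2 + h^-1 / 2 * (u n.+1 x - u n x) ^+ 2))).
      apply: le_Rintegral => //.
        exact: (integrableD mcell ic ig3).
      move=> x _; rewrite /w -(real_normK (num_real (u n.+1 x - u n x))).
      set z := `|_|; rewrite -(ler_pM2l h0) mulrDr !mulrA divff ?gt_eqF// mul1r.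
      have := sqr_ge0 (h - z); nra.
    rewrite RintegralD// Rintegral_cst// RintegralZl//.
    have : \int[mu]_(x in cell L) ((u n.+1 x - u n x) ^+ 2) <= volume L * e n.
      rewrite -lee_fin fineK; first exact: uE.
      exact: (integrable_fin_num mcell ig2).
    have -> : fine (mu (cell L)) = volume L by rewrite [X in fine X](lebesgue_cell L0).
    move: (Rintegral _ _ _) => z; rewrite eh => zle.
    rewrite -(ler_pM2l h0) mulrDr !mulrA divff ?gt_eqF// mul1r; nra.
  have wS : mu.-integrable (cell L) (fun x => \sum_(n <oo) (w n x)%:E)%E.
    have mw n : measurable_fun (cell L) (fun x => (w n x)%:E).
      by apply/measurable_EFinP/measurable_funTS; apply: measurableT_comp => //; exact: measurable_funB.
    apply/integrableP; split.
      by apply: (ge0_emeasurable_sum (h := fun n x => (w n x)%:E)) => // n x _ _; rewrite lee_fin normr_ge0.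
    under eq_integral.
      move=> x _; rewrite gee0_abs; last by apply: nneseries_ge0 => n _ _; rewrite lee_fin normr_ge0.
      over.
    rewrite integral_nneseries//; last by move=> n x _; rewrite lee_fin normr_ge0.
    apply: le_lt_trans (ltry (volume L * 2)); apply: lime_le.
      by apply: is_cvg_nneseries => n _ _; apply: integral_ge0 => x _; rewrite lee_fin normr_ge0.
    apply: nearW => n; apply: (@le_trans _ _ (\sum_(0 <= i < n) (volume L * 2^-1 ^+ i)%:E)%E).
      by apply: lee_sum => i _; exact: iw.
    rewrite sumEFin lee_fin -mulr_sumr ler_pM2l//.
    have -> : \sum_(0 <= i < n) 2^-1 ^+ i = 2 - 2 * 2^-1 ^+ n :> R.
      elim: n => [|n IH]; first by rewrite big_nil expr0; ring.
      by rewrite big_nat_recr//= IH exprS; field.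
    by rewrite gerBl mulr_ge0// exprn_ge0.
  apply: filterS (integrable_ae mcell wS) => x wx cx; have {}wx := wx cx.
  have cw : cvgn (series (w ^~ x)).
    apply: nondecreasing_is_cvgn.
      by apply: nondecreasing_series => n _ _; exact: normr_ge0.
    exists (fine (\sum_(n <oo) (w n x)%:E)) => _ [n _ <-].
    rewrite -lee_fin fineK// /series /= -sumEFin.
    by apply: nneseries_lim_ge => i _ _; rewrite lee_fin normr_ge0.
  have ct : cvgn (series (telescope (u ^~ x))) by apply: normed_cvg; exact: cw.
  rewrite (_ : u ^~ x = fun n => u 0%N x + series (telescope (u ^~ x)) n).
    by apply: is_cvgD => //; exact: is_cvg_cst.
  by apply/funext => n; exact: eq_sum_telescope.
(* The upper limit exists at every point: it is measurable, and it inherits periodicity from the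
   partial sums everywhere, not only where they converge. *)
pose f x := fine (limn_esup (fun n => (u n x)%:E)).
have mf : measurable_fun setT f.
  apply: measurableT_comp => //; apply: measurable_fun_limn_esup => n.
  exact/measurable_EFinP.
have uf : {ae mu, forall x, cell L x -> u n x @[n --> \oo] --> f x}.
  apply: filterS ucvg => x cu cx; have {}cu := cu cx.
  have cuE : (u n x)%:E @[n --> \oo] --> (limn (u ^~ x))%:E.
    by apply: cvg_EFin; [exact: nearW|exact: cu].
  by rewrite /f (is_cvg_limn_esupE (cvgP _ cuE)) (cvg_lim _ cuE).
have fu n : (\int[mu]_(x in cell L) ((f x - u n x) ^+ 2)%:E <= (volume L * e n)%:E)%E.
  have mD m : measurable_fun (cell L) (fun x => ((u m x - u n x) ^+ 2)%:E).
    by apply/measurable_EFinP/measurable_funTS/measurable_funX/measurable_funB.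
  apply: (@le_trans _ _ (\int[mu]_(x in cell L) limn_einf (fun m => ((u m x - u n x) ^+ 2)%:E))%E).
    apply: le_integral_ae.
    - by move=> x _; rewrite lee_fin sqr_ge0.
    - move=> x _; rewrite limn_einf_lim; apply: lime_ge; first exact: is_cvg_einfs.
      apply: nearW => m; apply: le_ereal_inf_tmp => _ [k _ <-].
      by rewrite lee_fin sqr_ge0.
    - apply: filterS uf => x ufx cx.
      have H : ((u m x - u n x) ^+ 2)%:E @[m --> \oo] --> ((f x - u n x) ^+ 2)%:E.
        apply: cvg_EFin; first exact: nearW.
        by rewrite expr2; under eq_cvg do rewrite /= expr2;
          apply: cvgM; apply: cvgB; (try exact: cvg_cst); exact: ufx.
      by rewrite (is_cvg_limn_einfE (cvgP _ H)) (cvg_lim _ H).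
  apply: (le_trans (fatou mu mcell mD _)); first by move=> m x _; rewrite lee_fin sqr_ge0.
  rewrite limn_einf_lim; apply: lime_le; first exact: is_cvg_einfs.
  (* The infimum over indices beyond [m] is bounded by its value at an index that is also beyond
     [n], where [uE] applies. *)
  apply: nearW => m; apply: (@le_trans _ _ (\int[mu]_(x in cell L) ((u (maxn m n) x - u n x) ^+ 2)%:E)%E).
    by apply: ereal_inf_lbound; exists (maxn m n) => //=; rewrite leq_maxl.
  by apply: uE; rewrite leq_maxr.
have sfu n : square_integrable (fun x => f x - u n x).
  split; first exact: measurable_funB.
  by apply: le_lt_trans (fu n) _; rewrite ltry.
have sf : square_integrable f.
  rewrite (_ : f = fun x => (f x - u 0%N x) + u 0%N x); last by apply/funext => x; rewrite subrK.
  exact: square_integrableD.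
have ipfu n : ip (fun x => f x - u n x) (fun x => f x - u n x) <= e n.
  rewrite /ip mulrC ler_pdivrMr// mulrC -lee_fin.
  rewrite fineK; first by under eq_integral do rewrite -expr2; exact: fu.
  exact: (integrable_fin_num mcell (integrable_mul (sfu n) (sfu n))).
have hf k : hcoef k f = c k.
  have sk := square_integrable_cas k.
  (* Two errors of square at most [e n] each, combined by (x + y)^2 <= 2 x^2 + 2 y^2. *)
  have H n : (hcoef k f - c k) ^+ 2 <= 4 * e n.
    have [un tn nt] := Ht n.
    have h1 : (hcoef k f - hcoef k (u n)) ^+ 2 <= e n.
      rewrite /hcoef -ipBl//; apply: (le_trans (cauchy_schwarz (sfu n) sk)).
      by rewrite ip_cas eqxx mulr1.
    (* If [k] is not in [t n], adjoining it cannot push the sum of squares above [S], and [t n]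
       already reaches [S - e n]. *)
    have h2 : (hcoef k (u n) - c k) ^+ 2 <= e n.
      rewrite hcoef_hpartial//; case: ifPn => kt; first by rewrite subrr expr0n/= ltW.
      have := @sumS (k :: t n); rewrite /= kt un => /(_ isT); rewrite big_cons.
      by rewrite sub0r sqrrN; lra.
    have := sqr_ge0 ((hcoef k f - hcoef k (u n)) - (hcoef k (u n) - c k)).
    nra.
  apply/eqP; rewrite -subr_eq0 -sqrf_eq0 eq_le sqr_ge0 andbT.
  by apply: (@le_geometric _ _ _ 4) => n; rewrite add0r; exact: H.
exists f; split => //.
- move=> x i; rewrite /f; congr (fine (limn_esup _)); apply/funext => n; congr EFin.
  by apply: eq_bigr => k _; congr (_ * _); exact: periodic_wave.
- apply: (@le_geometric _ _ _ 1) => n; have [un tn nt] := Ht n.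
  have := bessel_eq sf un; have -> : hcoef^~ f = c by apply/funext => k; exact: hf.
  move=> /=; rewrite (eq_bigr (fun k => c k ^+ 2)) => [E|k _]; last by rewrite hf.
  by rewrite mul1r -/(e n); have := ipfu n; rewrite E; have := sumS un; lra.
Qed.

End riesz_fischer.
Lemma hcoef_inj f g : square_integrable f -> square_integrable g ->
  (forall k, hcoef k f = hcoef k g) ->
  {ae mu, forall x, cell L x -> f x = g x}.
Proof.
move=> hf hg fg; have hB := square_integrableB hf hg; have [mB _] := hB.
have H : {ae mu, forall x, cell L x -> f x - g x = 0}.
  apply: (cas_complete L0 mB (square_integrable_integrable hB)) => k.
  have : hcoef k (fun x => f x - g x) = 0.
    rewrite /hcoef ipBl//; last exact: square_integrable_cas.
    by rewrite -/(hcoef k f) fg subrr.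
  by move/eqP; rewrite mulf_eq0 invr_eq0 (gt_eqF V0)/= => /eqP.
by apply: filterS H => x H cx; apply/eqP; rewrite -subr_eq0 H.
Qed.

Lemma ip_ae f g h : {ae mu, forall x, cell L x -> f x = g x} -> ip f h = ip g h.
Proof.
move=> fg; congr (_ * _); apply: eq_Rintegral_ae.
by apply: filterS fg => x fgx cx; rewrite fgx.
Qed.

(** Bessel's inequality is one half. For the other, Riesz-Fischer rebuilds from the coefficients a
    function of squared norm at most their sum of squares, and completeness identifies it with
    [f]. *)
Lemma parseval f : square_integrable f ->
  \esum_(k in [set: 'rV[int]_d]) (hcoef k f ^+ 2)%:E = (ip f f)%:E.
Proof.
move=> hf.
have le1 : (\esum_(k in [set: 'rV[int]_d]) (hcoef k f ^+ 2)%:E <= (ip f f)%:E)%E.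
  by apply: esum_le_seq => s us; rewrite lee_fin bessel.
have fin : \esum_(k in [set: 'rV[int]_d]) (hcoef k f ^+ 2)%:E \is a fin_num.
  rewrite ge0_fin_numE; first exact: le_lt_trans le1 (ltry _).
  by apply: esum_ge0 => k _; rewrite lee_fin sqr_ge0.
apply/eqP; rewrite eq_le le1 /= -(fineK fin) lee_fin.
have [g [hg _ gk gS]] := riesz_fischer (esym (fineK fin)).
apply: le_trans gS; have gf := hcoef_inj hg hf gk.
by rewrite -(ip_ae _ gf) ipC -(ip_ae _ gf).
Qed.

(** Unconditional summation along finite sets of frequencies. Frequencies have no preferred order,
    and this notion is insensitive to the change of index k to - k. *)
Definition netcvg (a : 'rV[int]_d -> R) (l : R) := forall e, 0 < e ->
  exists s0, forall s, uniq s -> {subset s0 <= s} -> `|l - \sum_(k <- s) a k| <= e.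

Lemma netcvg_unique a l l' : netcvg a l -> netcvg a l' -> l = l'.
Proof.
move=> al al'; apply/eqP; rewrite -subr_eq0 -normr_le0.
apply/ler_addgt0Pl => e e0; rewrite addr0.
have [s1 H1] := al _ (divr_gt0 e0 (ltr0Sn R 1)).
have [s2 H2] := al' _ (divr_gt0 e0 (ltr0Sn R 1)).
pose s := undup (s1 ++ s2); have us : uniq s by exact: undup_uniq.
rewrite (le_trans (ler_distD (\sum_(k <- s) a k) _ _))// [leRHS]splitr lerD//.
  by apply: H1 => // k kin; rewrite mem_undup mem_cat kin.
by rewrite distrC; apply: H2 => // k kin; rewrite mem_undup mem_cat kin orbT.
Qed.

Lemma netcvgD a b l l' : netcvg a l -> netcvg b l' ->
  netcvg (fun k => a k + b k) (l + l').
Proof.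
move=> al al' e e0.
have [s1 H1] := al _ (divr_gt0 e0 (ltr0Sn R 1)).
have [s2 H2] := al' _ (divr_gt0 e0 (ltr0Sn R 1)).
exists (s1 ++ s2) => s us ss; rewrite big_split /= opprD addrACA.
rewrite (le_trans (ler_normD _ _))// [leRHS]splitr lerD//.
  by apply: H1 => // k kin; apply: ss; rewrite mem_cat kin.
by apply: H2 => // k kin; apply: ss; rewrite mem_cat kin orbT.
Qed.

Lemma netcvg0 a : (forall k, a k = 0) -> netcvg a 0.
Proof.
move=> a0 e e0; exists [::] => s _ _.
by rewrite big1 ?subr0 ?normr0 ?ltW// => k _; exact: a0.
Qed.

Lemma netcvg_sum (I : Type) (r : seq I) (a : I -> 'rV[int]_d -> R) (l : I -> R) :
  (forall i, netcvg (a i) (l i)) ->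
  netcvg (fun k => \sum_(i <- r) a i k) (\sum_(i <- r) l i).
Proof.
move=> al; elim: r => [|i r IH].
  by rewrite big_nil; apply: netcvg0 => k; rewrite big_nil.
rewrite big_cons; under [X in netcvg X _]eq_fun do rewrite big_cons.
exact: netcvgD.
Qed.

Lemma netcvg_reindex sg a l : involutive sg -> netcvg a l ->
  netcvg (fun k => a (sg k)) l.
Proof.
move=> sgK al e e0; have [s0 H] := al _ e0; exists (map sg s0) => s us ss.
have := H (map sg s); rewrite big_map; apply.
  by rewrite map_inj_uniq//; exact: inv_inj.
move=> k ks; rewrite -(sgK k); apply: map_f; apply: ss; exact: map_f.
Qed.

(** The polarized form of Parseval's identity: the error is the inner product of [g] with the
    remainder of [f], whose squared norm is a tail of the sum of squares. *)
Lemma netcvg_ip f g : square_integrable f -> square_integrable g ->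
  netcvg (fun k => hcoef k f * hcoef k g) (ip f g).
Proof.
move=> hf hg e e0.
(* Chosen so that the Cauchy-Schwarz bound on the squared error is e^2; the [+ 1] keeps the divisor
   positive when [g] has norm zero. *)
pose e' := e ^+ 2 / (ip g g + 1).
have g1 : 0 < ip g g + 1 by rewrite ltr_wpDl ?ip_ge0.
have e'0 : 0 < e' by rewrite divr_gt0// exprn_gt0.
have [s0 us0 H] := esum_approx_seq (parseval hf) e'0.
exists s0 => s us ss.
have hp := square_integrable_hpartial (hcoef^~ f) s.
have -> : ip f g - \sum_(k <- s) hcoef k f * hcoef k g =
    ip (fun x => f x - hpartial (hcoef^~ f) s x) g.
  by rewrite ipBl// ip_hpartial.
rewrite -(ler_pXn2r (ltn0Sn 1)) ?nnegrE ?(ltW e0)// real_normK ?num_real//.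
apply: le_trans (cauchy_schwarz (square_integrableB hf hp) hg) _.
have -> : e ^+ 2 = e' * (ip g g + 1) by rewrite /e' divfK// gt_eqF.
rewrite bessel_eq// ler_pM ?ip_ge0 ?lerDl// -?bessel_eq// ?ip_ge0//.
rewrite bessel_eq// lerBlDr -lerBlDl (le_trans H)//.
rewrite [leRHS](bigID (fun k => k \in s0)) -[leLHS]addr0 lerD//; last first.
  by apply: sumr_ge0 => k _; exact: sqr_ge0.
rewrite -big_filter le_eqVlt; apply/orP; left; apply/eqP.
apply: perm_big; apply: uniq_perm => //; first by rewrite filter_uniq.
by move=> k; rewrite mem_filter; case: (boolP (k \in s0)) => // kt; rewrite ss.
Qed.

Lemma riesz_fischer_lt (c : 'rV[int]_d -> R) :
  (\esum_(k in [set: 'rV[int]_d]) (c k ^+ 2)%:E < +oo)%E ->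
  exists f, [/\ square_integrable f, Defs.periodic L f & forall k, hcoef k f = c k].
Proof.
move=> cfin.
have fin : \esum_(k in [set: 'rV[int]_d]) (c k ^+ 2)%:E \is a fin_num.
  by rewrite ge0_fin_numE//; apply: esum_ge0 => k _; rewrite lee_fin sqr_ge0.
by have [f [? ? ? _]] := riesz_fischer (esym (fineK fin)); exists f.
Qed.

Lemma square_integrable_continuous f : Defs.periodic L f -> continuous f ->
  square_integrable f.
Proof.
move=> pf cf; have [M fM] := continuous_bounded_cell L cf.
apply: integrable_square_integrable; first exact: continuous_measurable_rV.
apply: (@bounded_integrable_cell _ _ _ _ (M ^+ 2)) => //.
  by apply: measurable_funX; exact: continuous_measurable_rV.
by move=> x cx; rewrite normrX lerXn2r ?nnegrE// ?fM// (le_trans _ (fM _ cx)).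
Qed.

(** The derivative of [f] times [cas L k] has zero integral over the cell, and the two terms of the
    product rule give the two coefficients. *)
Lemma hcoef_derive f k i : Defs.periodic L f -> continuous f ->
  (forall x, derivable f x (delta_mx 0 i)) -> continuous ('D_(delta_mx 0 i) f) ->
  hcoef k ('D_(delta_mx 0 i) f) = - wavenumber L k i * hcoef (- k) f.
Proof.
move=> pf cf df cDf.
have ck l : continuous (cas L l) by exact: continuous_wave.
pose h x := f x * cas L k x.
have dk x := cas_derive L k (delta_mx 0 i) x.
have hE x : 'D_(delta_mx 0 i) h x =
    'D_(delta_mx 0 i) f x * cas L k x + wavenumber L k i * (f x * cas L (- k) x).
  have [d1 d2] := dk x; rewrite (deriveM (df x) d1) d2 phase_delta /GRing.scale /=; ring.
have i1 : mu.-integrable (cell L) (EFin \o (fun x => 'D_(delta_mx 0 i) f x * cas L k x)).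
  by apply: continuous_integrable_cell => // x; exact: (cvgM (cDf x) (ck k x)).
have i2 : mu.-integrable (cell L) (EFin \o (fun x => f x * cas L (- k) x)).
  by apply: continuous_integrable_cell => // x; exact: (cvgM (cf x) (ck (- k) x)).
have i3 : mu.-integrable (cell L) (EFin \o (fun x => wavenumber L k i * (f x * cas L (- k) x))).
  apply: continuous_integrable_cell => // x.
  exact: (cvgM (cvg_cst _) (cvgM (cf x) (ck (- k) x))).
have : \int[mu]_(x in cell L) 'D_(delta_mx 0 i) h x = 0.
  apply: integral_cell_derive; first exact: L0.
  - by move=> x; apply: derivableM; [exact: df|have [] := dk x].
  - rewrite (_ : 'D_ _ h = fun x => 'D_(delta_mx 0 i) f x * cas L k x +
        wavenumber L k i * (f x * cas L (- k) x)); last exact/funext.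
    move=> x; exact: (cvgD (cvgM (cDf x) (ck k x))
      (cvgM (cvg_cst _) (cvgM (cf x) (ck (- k) x)))).
  - by move=> x j; rewrite /h pf; congr (_ * _); exact: periodic_wave.
under eq_Rintegral do rewrite hE.
rewrite RintegralD// RintegralZl// => /eqP; rewrite addr_eq0 => /eqP E.
by rewrite /hcoef /ip E; ring.
Qed.

End L2_theory.

(** * Vector fields and their coefficients *)

Section ae_integrable.
Context d (T : measurableType d) (R : realType) (mu : {measure set T -> \bar R}).
Variables (D : set T) (mD : measurable D).
Implicit Types f g : T -> R.

(** The form in which pairings with time-dependent fields are integrable: they agree almost
    everywhere with an integrable function, which suffices for linearity of their integrals. *)
Definition ae_integrable f := exists2 g,
  mu.-integrable D (EFin \o g) & {ae mu, forall x, D x -> f x = g x}.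

Lemma integrable_ae_integrable f :
  mu.-integrable D (EFin \o f) -> ae_integrable f.
Proof. by exists f => //; exact: aeW. Qed.

Lemma ae_integrable_eq f g : {ae mu, forall x, D x -> f x = g x} ->
  ae_integrable g -> ae_integrable f.
Proof.
move=> fg [h hi gh]; exists h => //.
by apply: filterS2 fg gh => x fgx ghx Dx; rewrite fgx ?ghx.
Qed.

Lemma ae_integrableZ c f : ae_integrable f -> ae_integrable (fun x => c * f x).
Proof.
move=> [g gi fg]; exists (fun x => c * g x).
  by have := integrableZl mD c gi; rewrite (_ : (fun x => _) = EFin \o (fun x => c * g x)).
by apply: filterS fg => x fgx Dx; rewrite fgx.
Qed.

Lemma ae_integrableD f g : ae_integrable f -> ae_integrable g ->
  ae_integrable (fun x => f x + g x).
Proof.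
move=> [f' fi ff'] [g' gi gg']; exists (fun x => f' x + g' x).
  exact: (integrableD mD fi gi).
by apply: filterS2 ff' gg' => x ffx ggx Dx; rewrite ffx ?ggx.
Qed.

Lemma ae_RintegralZ c f : ae_integrable f ->
  \int[mu]_(x in D) (c * f x) = c * \int[mu]_(x in D) f x.
Proof.
move=> [g gi fg]; rewrite (eq_Rintegral_ae fg) -RintegralZl//.
by apply: eq_Rintegral_ae; apply: filterS fg => x fgx Dx; rewrite fgx.
Qed.

Lemma ae_RintegralD f g : ae_integrable f -> ae_integrable g ->
  \int[mu]_(x in D) (f x + g x) = \int[mu]_(x in D) f x + \int[mu]_(x in D) g x.
Proof.
move=> [f' fi ff'] [g' gi gg'].
rewrite (eq_Rintegral_ae ff') (eq_Rintegral_ae gg') -RintegralD//.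
apply: eq_Rintegral_ae.
by apply: filterS2 ff' gg' => x ffx ggx Dx; rewrite ffx ?ggx.
Qed.

Lemma ae_integrable_sum I (s : seq I) (f : I -> T -> R) :
  (forall i, ae_integrable (f i)) -> ae_integrable (fun x => \sum_(i <- s) f i x).
Proof.
move=> fi; elim: s => [|i s IH].
  exists (fun=> 0); first exact: (integrable0 mu D).
  by apply: aeW => x _; rewrite big_nil.
by under eq_fun do rewrite big_cons; exact: ae_integrableD.
Qed.

Lemma ae_Rintegral_sum I (s : seq I) (f : I -> T -> R) :
  (forall i, ae_integrable (f i)) ->
  \int[mu]_(x in D) (\sum_(i <- s) f i x) = \sum_(i <- s) \int[mu]_(x in D) f i x.
Proof.
move=> fi; elim: s => [|i s IH].
  under eq_Rintegral do rewrite big_nil.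
  by rewrite big_nil /Rintegral integral0.
under eq_Rintegral do rewrite big_cons.
by rewrite ae_RintegralD// ?IH ?big_cons//; exact: ae_integrable_sum.
Qed.

End ae_integrable.

Section fields.
Context (R : realType) (d : nat) (L : 'rV[R]_d).
Hypothesis L0 : forall i, 0 < L 0 i.
Implicit Types (u v f g : 'rV[R]_d -> 'rV[R]_d) (k : 'rV[int]_d) (s : R).

Local Notation mu := (lebesgue_rV R d).

Let mcell : measurable (cell L). Proof. exact: measurable_cell. Qed.
Let V0 : 0 < volume L. Proof. exact: volume_gt0. Qed.

Definition component u i := fun x => u x 0 i.

Definition coefs u k i : R := hcoef L k (component u i).

Lemma L2_sqnormE u : (forall i, square_integrable L (component u i)) ->
  L2_sqnorm L u = (\sum_i ip L (component u i) (component u i))%:E.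
Proof.
move=> hu; rewrite /L2_sqnorm /dot.
under eq_integral do rewrite -sumEFin.
rewrite (integral_sum mcell (f := fun i x => (u x 0 i * u x 0 i)%:E)).
  rewrite -mulr_sumr EFinM -sumEFin; congr (_ * _)%E; apply: eq_bigr => i _.
  rewrite fineK//; exact: (integrable_fin_num mcell (integrable_mul L0 (hu i) (hu i))).
by move=> i; exact: (integrable_mul L0 (hu i) (hu i)).
Qed.

Lemma L2perP u : L2per L u <->
  (forall i, square_integrable L (component u i)) /\ Defs.periodic L u.
Proof.
split=> [[mu_ pu u2]|[hu pu]]; last first.
  split=> //; last by rewrite L2_sqnormE// ltry.
  by apply: measurable_rV => i; have [] := hu i.
split=> // i; split.
  by apply: (measurableT_comp (@measurable_coord R d i)).
have : (\int[mu]_(x in cell L) (dot (u x) (u x))%:E < +oo)%E.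
  rewrite ltNge leye_eq; apply/negP => /eqP E; move: u2.
  by rewrite /L2_sqnorm E gt0_muley ?ltxx// lte_fin invr_gt0.
apply: le_lt_trans; apply: le_integral_ae => [x _|x _|].
- by rewrite lee_fin sqr_ge0.
- by rewrite lee_fin /dot sumr_ge0// => j _; rewrite -expr2 sqr_ge0.
- apply: aeW => x _; rewrite lee_fin /dot (bigD1 i)//= -expr2 lerDl sumr_ge0//.
  by move=> j _; rewrite -expr2 sqr_ge0.
Qed.

Lemma L2per_coord u i : L2per L u -> square_integrable L (component u i).
Proof. by move=> /L2perP[]. Qed.

Lemma square_integrable0 : square_integrable L (fun=> 0).
Proof. by apply: square_integrable_bounded => //; exact: bounded_measurable_cst. Qed.

Lemma hcoef0 k : hcoef L k (fun=> 0) = 0.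
Proof.
rewrite /hcoef /ip; under eq_Rintegral do rewrite mul0r.
by rewrite /Rintegral integral0 mulr0.
Qed.

Lemma L2per_fct0 : L2per L 0.
Proof.
apply/L2perP; split => // i; rewrite (_ : component 0 i = fun=> 0).
  exact: square_integrable0.
by apply/funext => x; rewrite /component mxE.
Qed.

Lemma coefs0 k i : coefs 0 k i = 0.
Proof.
rewrite /coefs (_ : component 0 i = fun=> 0) ?hcoef0//.
by apply/funext => x; rewrite /component mxE.
Qed.

Lemma L2perD u v : L2per L u -> L2per L v -> L2per L (u + v).
Proof.
move=> /L2perP[hu pu] /L2perP[hv pv]; apply/L2perP; split.
  move=> i; rewrite (_ : component _ _ = fun x => component u i x + component v i x).
    exact: square_integrableD.
  by apply/funext => x; rewrite /component mxE.
by move=> x i; rewrite !fctE pu pv.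
Qed.

Lemma coefsD u v k i : L2per L u -> L2per L v ->
  coefs (u + v) k i = coefs u k i + coefs v k i.
Proof.
move=> hu hv; rewrite /coefs (_ : component (u + v) _ = fun x => component u i x + component v i x).
  by rewrite /hcoef ipDl//; [exact: L2per_coord..|exact: square_integrable_cas].
by apply/funext => x; rewrite /component mxE.
Qed.

Lemma L2perZ c u : L2per L u -> L2per L (c *: u).
Proof.
move=> /L2perP[hu pu]; apply/L2perP; split.
  move=> i; rewrite (_ : component _ _ = fun x => c * component u i x).
    exact: square_integrableZ.
  by apply/funext => x; rewrite /component mxE.
by move=> x i; rewrite !fctE pu.
Qed.

Lemma coefsZ c u k i : L2per L u -> coefs (c *: u) k i = c * coefs u k i.
Proof.
move=> hu; rewrite /coefs (_ : component _ _ = fun x => c * component u i x).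
  by rewrite /hcoef ipZl//; [exact: L2per_coord..|exact: square_integrable_cas].
by apply/funext => x; rewrite /component mxE.
Qed.

Lemma L2perB u v : L2per L u -> L2per L v -> L2per L (u - v).
Proof. by move=> hu hv; rewrite -scaleN1r; apply: L2perD => //; exact: L2perZ. Qed.

Lemma coefsB u v k i : L2per L u -> L2per L v ->
  coefs (u - v) k i = coefs u k i - coefs v k i.
Proof.
move=> hu hv; rewrite -scaleN1r coefsD ?coefsZ ?mulN1r//; exact: L2perZ.
Qed.

Lemma L2per_comb (I : Type) (r : seq I) (c : I -> R) (f : I -> 'rV[R]_d -> 'rV[R]_d) :
  (forall j, L2per L (f j)) -> L2per L (\sum_(j <- r) c j *: f j).
Proof.
move=> hf; elim: r => [|j r IH]; first by rewrite big_nil; exact: L2per_fct0.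
by rewrite big_cons; apply: L2perD => //; exact: L2perZ.
Qed.

Lemma coefs_comb (I : Type) (r : seq I) (c : I -> R) (f : I -> 'rV[R]_d -> 'rV[R]_d) k i :
  (forall j, L2per L (f j)) ->
  coefs (\sum_(j <- r) c j *: f j) k i = \sum_(j <- r) c j * coefs (f j) k i.
Proof.
move=> hf; elim: r => [|j r IH]; first by rewrite !big_nil coefs0.
rewrite !big_cons coefsD ?coefsZ ?IH//; first exact: L2perZ.
exact: L2per_comb.
Qed.

(** If a and b are the real and imaginary parts of the Fourier coefficient at k, then a - b and a +
    b are the Hartley coefficients at k and - k; the formula is the parallelogram law. *)
Lemma sqnormC_fourier u k : L2per L u -> sqnormC (fourier_coef L u k) =
  2^-1 * (\sum_i coefs u k i ^+ 2 + \sum_i coefs u (- k) i ^+ 2).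
Proof.
move=> hu; rewrite /sqnormC -big_split mulr_sumr; apply: eq_bigr => i _.
rewrite !mxE /=.
have hi := L2per_coord i hu.
have bw a b : bounded_measurable (wave L a b k) by exact: bounded_measurable_wave.
have hs a b : square_integrable L (wave L a b k) by exact: square_integrable_bounded.
set a := (volume L)^-1 * _; set b := - _.
have aE : a = ip L (component u i) (wave L 1 0 k).
  by congr (_ * _); apply: eq_Rintegral => x _; rewrite /wave mul1r mul0r addr0.
have bE : b = - ip L (component u i) (wave L 0 1 k).
  by congr (- (_ * _)); apply: eq_Rintegral => x _; rewrite /wave mul1r mul0r add0r.
have E1 : coefs u k i = a - b.
  rewrite aE bE opprK /coefs /hcoef ipC [X in X + _]ipC [X in _ + X]ipC -ipDl//.
  by congr ip; apply/funext => x; rewrite /cas /wave; ring.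
have E2 : coefs u (- k) i = a + b.
  rewrite aE bE /coefs /hcoef ipC [X in X - _]ipC [X in _ - X]ipC -ipBl//.
  by congr ip; apply/funext => x; rewrite /cas /wave phaseN cosN sinN; ring.
by rewrite E1 E2; field.
Qed.

Definition weight s k : R := (1 + sqnormZ R k) `^ s.

Lemma sqnormZ_ge0 k : 0 <= sqnormZ R k.
Proof. by apply: sumr_ge0 => i _; exact: sqr_ge0. Qed.

Lemma weight_gt0 s k : 0 < weight s k.
Proof. by rewrite powR_gt0// ltr_pwDl// sqnormZ_ge0. Qed.

Lemma sqnormZN k : sqnormZ R (- k) = sqnormZ R k.
Proof. by apply: eq_bigr => i _; rewrite mxE intrN sqrrN. Qed.

(** The weight is even in k, so the average over k and - k given by [sqnormC_fourier] disappears on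
    reindexing half of the sum. *)
Lemma Hs_sqnormE s u : L2per L u -> Hs_sqnorm L s u =
  \esum_(k in [set: 'rV[int]_d]) (weight s k * \sum_i coefs u k i ^+ 2)%:E.
Proof.
move=> hu; rewrite /Hs_sqnorm.
have H0 k : (0 <= (2^-1 * (weight s k * \sum_i coefs u k i ^+ 2))%:E)%E.
  rewrite lee_fin mulr_ge0// mulr_ge0 ?(ltW (weight_gt0 _ _))//.
  by apply: sumr_ge0 => i _; exact: sqr_ge0.
under eq_esum => k _.
  rewrite -/(weight s k) (sqnormC_fourier k hu) mulrCA mulrDr mulrDr EFinD; over.
rewrite esumD//; last first.
  by move=> k _; have := H0 (- k); rewrite /weight sqnormZN.
rewrite [X in (_ + X)%E](_ : _ = \esum_(k in [set: 'rV[int]_d])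
    (2^-1 * (weight s k * \sum_i coefs u k i ^+ 2))%:E)%E.
  rewrite -esumD//.
  by apply: eq_esum => k _; rewrite -EFinD; congr EFin; field.
rewrite [RHS](@reindex_esum _ _ _ [set: 'rV[int]_d] [set: 'rV[int]_d] (fun k => - k)).
  by apply: eq_esum => k _; rewrite /weight sqnormZN.
split; [by []|by move=> x y _ _ /oppr_inj|].
by move=> x _; exists (- x) => //; rewrite opprK.
Qed.

Lemma Hs_sqnorm_ge0 s u : (0 <= Hs_sqnorm L s u)%E.
Proof.
apply: esum_ge0 => k _; rewrite lee_fin mulr_ge0 ?(ltW (weight_gt0 _ _))//.
by apply: sumr_ge0 => i _; rewrite addr_ge0 ?sqr_ge0.
Qed.

Lemma L2_sqnorm_ge0 u : (0 <= L2_sqnorm L u)%E.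
Proof.
rewrite mule_ge0 ?lee_fin ?invr_ge0 ?(ltW V0)//; apply: integral_ge0 => x _.
by rewrite lee_fin sumr_ge0// => i _; rewrite -expr2 sqr_ge0.
Qed.

Lemma L2_sqnorm_Hs u : L2per L u -> L2_sqnorm L u = Hs_sqnorm L 0 u.
Proof.
move=> hu; rewrite L2_sqnormE => [|i]; last exact: L2per_coord.
rewrite Hs_sqnormE// -sumEFin.
under eq_bigr => i _ do rewrite -(parseval L0 (L2per_coord i hu)).
rewrite -esum_sum; last by move=> k i _ _; rewrite lee_fin sqr_ge0.
by apply: eq_esum => k _; rewrite sumEFin /weight powRr0 mul1r.
Qed.

(** From (x + y)^2 <= 2 x^2 + 2 y^2 on each coefficient. The constant is harmless: the bound serves
    for finiteness and for convergence to 0. *)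
Lemma Hs_sqnormD s u v : L2per L u -> L2per L v ->
  (Hs_sqnorm L s (u + v)%R <= 2%:E * (Hs_sqnorm L s u + Hs_sqnorm L s v))%E.
Proof.
move=> hu hv; rewrite Hs_sqnormE; last exact: L2perD.
have C0 w k : 0 <= weight s k * \sum_i coefs w k i ^+ 2.
  rewrite mulr_ge0 ?(ltW (weight_gt0 _ _))//.
  by apply: sumr_ge0 => i _; exact: sqr_ge0.
apply: esum_le_seq => r ur.
apply: (@le_trans _ _ (2 * (\sum_(k <- r) weight s k * \sum_i coefs u k i ^+ 2 +
    \sum_(k <- r) weight s k * \sum_i coefs v k i ^+ 2))%:E).
  rewrite lee_fin -big_split mulr_sumr; apply: ler_sum => k _ /=.
  rewrite -mulrDr mulrCA ler_pM2l ?weight_gt0// -big_split mulr_sumr.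
  apply: ler_sum => i _ /=; rewrite coefsD//.
  by have := sqr_ge0 (coefs u k i - coefs v k i); lra.
rewrite EFinM lee_wpmul2l ?lee_fin// EFinD leeD// Hs_sqnormE//; exact: esum_ge_seq.
Qed.

Lemma HsperD s u v : Hsper L s u -> Hsper L s v -> Hsper L s (u + v).
Proof.
move=> [hu su] [hv sv]; split; first exact: L2perD.
apply: le_lt_trans (Hs_sqnormD s hu hv) _.
by apply: lte_mul_pinfty => //; exact: lte_add_pinfty.
Qed.

(** * Fourier multipliers between Sobolev spaces *)

Section multiplier.
Variables (m : 'rV[int]_d -> R) (sg : 'rV[int]_d -> 'rV[int]_d) (s s' K : R).
Hypotheses (sgK : involutive sg) (sgE : forall k, sqnormZ R (sg k) = sqnormZ R k)
  (K0 : 0 <= K) (s'0 : 0 <= s')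
  (mK : forall k, m k ^+ 2 * weight s' k <= K * weight s k).

(** A relation rather than an operator, since the coefficients determine [g] only up to a null set.
    The involution [sg] is the identity for the Laplacian, and k to - k for the inverse of a
    first-order operator. *)
Definition multiplier f g :=
  L2per L g /\ forall k i, coefs g k i = m k * coefs f (sg k) i.

Let sum_le f (a : 'rV[int]_d -> R) :
  L2per L f ->
  (forall k, a k <= weight s' k * \sum_i (m k * coefs f (sg k) i) ^+ 2) ->
  (\esum_(k in [set: 'rV[int]_d]) (a k)%:E <= K%:E * Hs_sqnorm L s f)%E.
Proof.
move=> hf aE; apply: esum_le_seq => r ur.
apply: (@le_trans _ _ (K%:E * (\sum_(k <- map sg r) weight s k * \sum_i coefs f k i ^+ 2)%:E)%E).
  rewrite -EFinM lee_fin big_map mulr_sumr; apply: ler_sum => k _.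
  apply: (le_trans (aE k)); rewrite /weight sgE -/(weight s k).
  under eq_bigr do rewrite exprMn.
  rewrite -mulr_sumr !mulrA ler_wpM2r//; first by apply: sumr_ge0 => i _; exact: sqr_ge0.
  by apply: le_trans (mK k); rewrite expr2 -/(weight s' k) le_eqVlt; apply/orP; left; apply/eqP; ring.
rewrite lee_wpmul2l ?lee_fin// Hs_sqnormE//; apply: esum_ge_seq.
by rewrite map_inj_uniq//; exact: inv_inj.
Qed.

Lemma multiplier_le f g : L2per L f -> multiplier f g ->
  (Hs_sqnorm L s' g <= K%:E * Hs_sqnorm L s f)%E.
Proof.
move=> hf [hg gE]; rewrite Hs_sqnormE//; apply: sum_le => // k.
by rewrite le_eqVlt; apply/orP; left; apply/eqP; congr (_ * _); apply: eq_bigr => i _; rewrite gE.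
Qed.

(** Riesz-Fischer is applied to each component. The prescribed coefficients are square summable
    because the weights of exponent [s'] are at least 1. *)
Lemma multiplier_ex f : Hsper L s f -> exists g, multiplier f g.
Proof.
move=> [hf sf].
have H (i : 'I_d) : exists g : 'rV[R]_d -> R, [/\ square_integrable L g, Defs.periodic L g &
    forall k, hcoef L k g = m k * coefs f (sg k) i].
  apply: riesz_fischer_lt => //; apply: (@le_lt_trans _ _ (K%:E * Hs_sqnorm L s f)%E).
    apply: sum_le => // k; rewrite -[leLHS]mul1r ler_pM ?sqr_ge0//.
      by rewrite -(powRr0 (1 + sqnormZ R k)) ler_powR// lerDl sqnormZ_ge0.
    by rewrite (bigD1 i)//= lerDl sumr_ge0// => j _; exact: sqr_ge0.
  by rewrite lte_mul_pinfty ?lee_fin.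
have [g gH] := choice H.
exists (fun x => \row_i g i x).
have cE i : component (fun x => \row_i g i x) i = g i.
  by apply/funext => x; rewrite /component mxE.
split.
  apply/L2perP; split => [i|x i]; first by rewrite cE; have [] := gH i.
  by apply/rowP => j; rewrite !mxE; have [_ -> _] := gH j.
by move=> k i; rewrite /coefs cE; have [_ _] := gH i.
Qed.

Lemma multiplierB f g f' g' : L2per L f -> L2per L f' -> multiplier f g ->
  multiplier f' g' -> multiplier (f - f') (g - g').
Proof.
move=> hf hf' [hg gE] [hg' gE']; split; first exact: L2perB.
by move=> k i; rewrite !coefsB// gE gE' mulrBr.
Qed.

Lemma multiplier_comb (I : Type) (r : seq I) (c : I -> R)
    (f g : I -> 'rV[R]_d -> 'rV[R]_d) :
  (forall j, L2per L (f j)) -> (forall j, multiplier (f j) (g j)) ->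
  multiplier (\sum_(j <- r) c j *: f j) (\sum_(j <- r) c j *: g j).
Proof.
move=> hf hg; have hg' j : L2per L (g j) by have [] := hg j.
split; first exact: L2per_comb.
move=> k i; rewrite !coefs_comb// mulr_sumr; apply: eq_bigr => j _.
by have [_ ->] := hg j; rewrite mulrCA.
Qed.

End multiplier.

Lemma zero_meanP u : zero_mean L u <-> forall i, coefs u 0 i = 0.
Proof.
have E i : coefs u 0 i = (volume L)^-1 * \int[mu]_(x in cell L) u x 0 i.
  rewrite /coefs /hcoef /ip; congr (_ * _); apply: eq_Rintegral => x _.
  by rewrite /component /cas /wave phase0 cos0 sin0 !mulr1 mulr0 addr0 mulr1.
split=> H i; first by rewrite E H mulr0.
have /eqP := H i; rewrite E mulf_eq0 invr_eq0 (gt_eqF V0)/= => /eqP //.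
Qed.

Lemma smooth_cas k : smooth (cas L k).
Proof. exact/smooth_elementary/elementary_wave. Qed.

Lemma smooth_continuous (phi : 'rV[R]_d -> R) : smooth phi -> continuous phi.
Proof. by move=> /(_ [::])[]. Qed.

Lemma periodic_derive (phi : 'rV[R]_d -> R) (w : 'rV[R]_d) :
  Defs.periodic L phi -> Defs.periodic L ('D_w phi).
Proof.
move=> p x i; rewrite /derive.
rewrite (_ : (fun h => _) = fun h => h^-1 *: ((phi \o shift x) (h *: w) - phi x))//.
by apply/funext => h /=; rewrite addrA !p.
Qed.

Lemma square_integrable_smooth (phi : 'rV[R]_d -> R) : smooth phi ->
  Defs.periodic L phi -> square_integrable L phi.
Proof. by move=> sp pp; apply: square_integrable_continuous => //; exact: smooth_continuous. Qed.

Lemma hcoef_smooth_derive (phi : 'rV[R]_d -> R) k i : smooth phi ->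
  Defs.periodic L phi ->
  hcoef L k ('D_(delta_mx 0 i) phi) = - wavenumber L k i * hcoef L (- k) phi.
Proof.
move=> sp pp; apply: hcoef_derive => //.
- exact: smooth_continuous.
- by move=> x; have [_] := sp [::]; exact.
- by have [] := sp [:: delta_mx 0 i].
Qed.

(** The derivative stays on the test function, so [u] only has to be square integrable. *)
Lemma ip_field_derive u (phi : 'rV[R]_d -> R) i j : L2per L u ->
  smooth phi -> Defs.periodic L phi ->
  netcvg (fun k => - wavenumber L k j * coefs u k i * hcoef L (- k) phi)
    (ip L (component u i) ('D_(delta_mx 0 j) phi)).
Proof.
move=> hu sp pp.
rewrite (_ : (fun k => _) = fun k =>
    hcoef L k (component u i) * hcoef L k ('D_(delta_mx 0 j) phi)).
  exact: (netcvg_ip L0 (L2per_coord i hu)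
    (square_integrable_smooth (smooth_derive (delta_mx 0 j) sp) (periodic_derive _ pp))).
apply/funext => k; rewrite hcoef_smooth_derive// /coefs; ring.
Qed.

Lemma div_freeE u (phi : 'rV[R]_d -> R) : L2per L u -> smooth phi -> Defs.periodic L phi ->
  \int[mu]_(x in cell L) (\sum_i u x 0 i * 'D_(delta_mx 0 i) phi x) =
  volume L * \sum_i ip L (component u i) ('D_(delta_mx 0 i) phi).
Proof.
move=> hu sp pp; rewrite -mulr_sumr mulrA divff ?gt_eqF// mul1r.
rewrite (ae_Rintegral_sum mcell _ (f := fun i x => u x 0 i * 'D_(delta_mx 0 i) phi x))//.
move=> i; apply: integrable_ae_integrable; apply: integrable_mul => //.
  exact: (L2per_coord i hu).
apply: square_integrable_smooth; [exact: smooth_derive|exact: periodic_derive].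
Qed.

(** Testing against [cas] at - k, whose gradient is a multiple of [cas] at k, gives the condition at
    k. Conversely, summing the pairings of all components makes the terms of the expansion over
    frequencies vanish one by one. *)
Lemma div_freeP u : L2per L u -> div_free L u <->
  forall k, \sum_i wavenumber L k i * coefs u k i = 0.
Proof.
move=> hu; split=> H => [k|phi sp pp].
  have := H _ (smooth_cas (- k)) (periodic_wave L0 1 1 (- k)).
  rewrite div_freeE//; [|exact: smooth_cas|exact: periodic_wave].
  move=> /eqP; rewrite mulf_eq0 (gt_eqF V0)/= => /eqP E; apply: oppr_inj; rewrite oppr0 -[RHS]E.
  rewrite -sumrN; apply: eq_bigr => i _.
  have -> : 'D_(delta_mx 0 i) (cas L (- k)) = fun x => - wavenumber L k i * cas L k x.
    apply/funext => x; have [_ ->] := cas_derive L (- k) (delta_mx 0 i) x.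
    by rewrite opprK phaseN phase_delta.
  rewrite ipC ipZl//; [|exact: square_integrable_cas|exact: L2per_coord].
  by rewrite /coefs /hcoef ipC mulNr.
rewrite div_freeE// [X in _ * X](_ : _ = 0) ?mulr0//.
have H1 := netcvg_sum (index_enum 'I_d) (fun i => ip_field_derive i i hu sp pp).
apply: (netcvg_unique H1); apply: netcvg0 => k.
by rewrite -mulr_suml; under eq_bigr do rewrite mulNr; rewrite sumrN H oppr0 mul0r.
Qed.

Lemma ae_eq_fieldP u v : L2per L u -> L2per L v ->
  (forall k i, coefs u k i = coefs v k i) -> ae_eq_field L u v.
Proof.
move=> hu hv uv.
have H i : {ae mu, forall x, cell L x -> component u i x = component v i x}.
  by apply: hcoef_inj => //; [exact: L2per_coord..|move=> k; exact: uv].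
have /filter_forall := H; apply: filterS => x Hx cx.
by apply/rowP => i; exact: Hx.
Qed.

End fields.

(** * Time-dependent fields *)

Section scaled_integral.
Context d (T : measurableType d) (R : realType) (mu : {measure set T -> \bar R}).
Local Open Scope ereal_scope.

Import HBNNSimple.

(** Dividing by [K] a simple function below K f gives one below f, so no measurability of [f]
    enters. *)
Lemma ge0_integralZl_le D (f : T -> \bar R) (K : R) : (0 < K)%R ->
  (forall x, D x -> 0 <= f x) ->
  \int[mu]_(x in D) (K%:E * f x) <= K%:E * \int[mu]_(x in D) f x.
Proof.
move=> K0 f0; have Kf0 x : D x -> 0 <= K%:E * f x.
  by move=> Dx; rewrite mule_ge0 ?lee_fin ?(ltW K0)// f0.
rewrite !ge0_integralE//; apply: ge_ereal_sup => _ [h hf <-].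
have Ki : (0 <= K^-1)%R by rewrite invr_ge0 ltW.
have -> : sintegral mu h = K%:E * sintegral mu (scale_nnsfun h Ki).
  rewrite (_ : sintegral mu (scale_nnsfun h Ki) = K^-1%:E * sintegral mu h).
    by rewrite muleA -EFinM divff ?gt_eqF// mul1e.
  by rewrite -sintegralrM; apply: eq_sintegral => x.
apply: lee_wpmul2l; first by rewrite lee_fin ltW.
apply: ereal_sup_ubound; exists (scale_nnsfun h Ki) => //= x.
have := hf x; rewrite !patchE; case: ifPn => xD hx.
  rewrite -(@lee_pmul2l _ K%:E) ?lte_fin//.
  by rewrite -EFinM mulrA divff ?gt_eqF// mul1r.
have {}hx : (h x)%:E <= 0 := hx; change ((K^-1 * h x)%:E <= 0).
by rewrite lee_fin mulr_ge0_le0.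
Qed.

End scaled_integral.

Lemma ae_forall_countable d (T : measurableType d) (R : realType)
    (mu : {measure set T -> \bar R}) (K : countType) (P : K -> T -> Prop) :
  (forall k, {ae mu, forall x, P k x}) -> {ae mu, forall x k, P k x}.
Proof.
move=> aeP.
pose Q n x := if pickle_inv n is Some k then P k x else True.
have : {ae mu, forall x n, Q n x}.
  apply: ae_foralln => n; rewrite /Q; case: pickle_inv => [k|]; first exact: aeP.
  exact: aeW.
by apply: filterS => x Qx k; have := Qx (pickle k); rewrite /Q pickleK_inv.
Qed.

(** Rewrites an unordered sum over a countable type as a series, to which the measurability theorem
    for series of functions applies. *)
Lemma esum_nneseries (R : realType) (K : countType) (a : K -> \bar R) :
  (forall k, 0 <= a k)%E -> \esum_(k in [set: K]) a k =
  (\sum_(n <oo | (n : nat) \in predT) (if pickle_inv n is Some k then a k else 0))%E.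
Proof.
move=> a0; rewrite nneseries_esum; last by move=> n _; case: pickle_inv.
rewrite (_ : mkset _ = [set: nat]); last by apply/seteqP; split.
transitivity (\esum_(n in range (@pickle K)) (if pickle_inv n is Some k then a k else 0))%E.
  rewrite (@reindex_esum _ _ _ [set: K] _ (@pickle K)).
    by apply: eq_esum => k _; rewrite pickleK_inv.
  split; [by move=> k _; exists k|by move=> k l _ _; exact: (pcan_inj pickleK_inv)|].
  by move=> _ [k _ <-]; exists k.
rewrite esum_mkcond; apply: eq_esum => n _; case: ifPn => // nr.
move: nr; rewrite notin_setE; case E : pickle_inv => [k|] // []; exists k => //.
by have := @pickle_invK K n; rewrite /= E.
Qed.

#[local] Instance lebesgue_ae_filter (R : realType) :
  Filter (almost_everywhere (@lebesgue_measure R)).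
Proof. exact: ae_filter_ringOfSetsType. Qed.

(** * Maps acting on square integrable functions of time *)

Section bochner_map.
Context (R : realType) (d : nat).
Local Notation field := ('rV[R]_d -> 'rV[R]_d).
Variables (X X' : set field) (N N' : field -> \bar R) (T K : R) (M : field -> field).
Hypotheses (XM : forall f, X f -> X' (M f)) (K0 : 0 < K)
  (N0 : forall f, (0 <= N f)%E) (N'0 : forall f, (0 <= N' f)%E)
  (NM : forall f, X f -> (N' (M f) <= K%:E * N f)%E)
  (NMB : forall n (c : 'I_n -> R) (f : 'I_n -> field) g,
    (forall j, X (f j)) -> X g ->
    (N' (\sum_j c j *: M (f j) - M g)%R <= K%:E * N (\sum_j c j *: f j - g)%R)%E).
Variable u : R -> field.
Hypothesis uX : {ae lebesgue_measure, forall t, t \in `]0, T[ -> X (u t)}.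

(** [M] is applied to the finitely many values of [S]. As [M] picks representatives it need not be
    linear, so the error against [M g] is controlled by [NMB], which bounds combinations of images
    directly. *)
Let simple_map S : simple_field X S -> exists S', simple_field X' S' /\
  forall t g, X g -> (N' (S' t - M g)%R <= K%:E * N (S t - g)%R)%E.
Proof.
move=> [n [A [f [Af SE]]]].
exists (fun t => \sum_i \1_(A i) t *: M (f i)); split.
  exists n, A, (fun i => M (f i)); split=> [i|t x].
    by have [mA Xf] := Af i; split=> //; exact: XM.
  by rewrite fct_sumE.
move=> t g Xg; rewrite (_ : S t = \sum_i \1_(A i) t *: f i).
  by apply: NMB => // j; have [] := Af j.
by apply/funext => x; rewrite SE fct_sumE.
Qed.

Lemma strongly_measurable_map :
  strongly_measurable X N T u -> strongly_measurable X' N' T (fun t => M (u t)).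
Proof.
move=> [S [sS Su]].
have [S' S'H] := choice (fun n => simple_map (sS n)).
exists S'; split; first by move=> n; have [] := S'H n.
apply: filterS2 uX Su => t Xu Sut Dt; have {}Xu := Xu Dt; have {}Sut := Sut Dt.
apply: (@squeeze_cvge _ _ _ _ (fun=> 0%E) _ (fun n => K%:E * N (S n t - u t)%R)%E).
- by apply: nearW => n; rewrite N'0 /=; have [_] := S'H n; exact.
- exact: cvg_cst.
- by rewrite -(mule0 K%:E); apply: cvgeZl.
Qed.

Lemma bochner_norm_map :
  (\int[lebesgue_measure]_(t in `]0%R, T[) N' (M (u t)) <=
   K%:E * \int[lebesgue_measure]_(t in `]0%R, T[) N (u t))%E.
Proof.
apply: le_trans (ge0_integralZl_le _ K0 _) => //.
apply: le_integral_ae => //.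
  by move=> t _; rewrite mule_ge0// lee_fin ltW.
by apply: filterS uX => t Xu Dt; apply: NM; exact: Xu.
Qed.

Lemma bochner_L2_map : bochner_L2 X N T u -> bochner_L2 X' N' T (fun t => M (u t)).
Proof.
move=> [_ smu iu]; split.
- by apply: filterS uX => t Xu Dt; apply: XM; exact: Xu.
- exact: strongly_measurable_map.
- apply: le_lt_trans bochner_norm_map _.
  by rewrite lte_mul_pinfty ?lee_fin ?(ltW K0).
Qed.

End bochner_map.

Section bochner_fields.
Context (R : realType) (d : nat) (L : 'rV[R]_d) (T : R).
Hypotheses (L0 : forall i, 0 < L 0 i).
Local Notation field := ('rV[R]_d -> 'rV[R]_d).
Local Notation leb := (@lebesgue_measure R).
Local Notation D := (`]0%R, T[%classic : set R).
Implicit Types (u v : R -> field) (s : R).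

Definition L2_L2 u := bochner_L2 (L2per L) (L2_sqnorm L) T u.

Lemma L2_sqnorm_le_Hs s f : 0 <= s -> L2per L f ->
  (L2_sqnorm L f <= Hs_sqnorm L s f)%E.
Proof.
move=> s0 hf; rewrite L2_sqnorm_Hs// -[leRHS]mul1e.
apply: (@multiplier_le _ _ _ L0 (fun=> 1) id) => //; last by split=> // k i; rewrite mul1r.
by move=> k; rewrite expr1n !mul1r; apply: ler_powR => //; rewrite lerDl sqnormZ_ge0.
Qed.

Lemma L2_Hs_L2 s u : 0 <= s -> L2_Hs L T s u -> L2_L2 u.
Proof.
move=> s0 hu; have [Xu _ _] := hu.
apply: (@bochner_L2_map _ _ (Hsper L s) _ (Hs_sqnorm L s) _ T 1 id) => //.
- by move=> f [].
- by move=> f; exact: Hs_sqnorm_ge0.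
- by move=> f; exact: L2_sqnorm_ge0.
- by move=> f [hf _]; rewrite mul1e; exact: L2_sqnorm_le_Hs.
- move=> n c f g hf [hg _]; rewrite mul1e; apply: L2_sqnorm_le_Hs => //.
  by apply: L2perB => //; apply: L2per_comb => // j; have [] := hf j.
Qed.

Lemma L2per0_L2 v : bochner_L2 (L2per0 L) (L2_sqnorm L) T v -> L2_L2 v.
Proof.
move=> hv; have [Xv _ _] := hv.
apply: (@bochner_L2_map _ _ (L2per0 L) _ (L2_sqnorm L) _ T 1 id) => //.
- by move=> f [].
- by move=> f; exact: L2_sqnorm_ge0.
- by move=> f; exact: L2_sqnorm_ge0.
- by move=> f _; rewrite mul1e.
- by move=> n c f g hf hg; rewrite mul1e.
Qed.

Section pairing.
Variable phi : R * 'rV[R]_d -> R.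
Hypotheses (cphi : continuous phi) (pphi : forall t, Defs.periodic L (fun x => phi (t, x))).

Let mcell : measurable (cell L). Proof. exact: measurable_cell. Qed.

Lemma continuous_slice t : continuous (fun x => phi (t, x)).
Proof.
move=> x; apply: (@continuous_comp _ _ _ (fun x : 'rV[R]_d => (t, x)) phi); last exact: cphi.
by apply: (@cvg_pair _ _ _ (nbhs x) (nbhs t) (nbhs x)) => //; exact: cvg_cst.
Qed.

Lemma square_integrable_slice t : square_integrable L (fun x => phi (t, x)).
Proof. by apply: square_integrable_continuous => //; exact: continuous_slice. Qed.

Lemma continuous_ip_slice f : square_integrable L f ->
  continuous (fun t => ip L f (fun x => phi (t, x))).
Proof.
move=> hf t; apply/(@cvg_nbhsP _ R^o) => w wt.
apply: cvgMr.
have [B Bw] : exists B, forall n, `|w n| <= B.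
  have [B [_ HB]] := cvg_seq_bounded (cvgP _ wt).
  by exists (B + 1) => n; apply: HB => //; rewrite ltrDl.
have [M HM] := @continuous_bounded_cylinder R d L phi (- B) B cphi.
have fi := square_integrable_integrable L0 hf; have [mf _] := hf.
apply: (@Rintegral_cvg _ _ _ _ _ mcell _ _ (fun x => `|f x| * M)).
- move=> n; apply: measurable_funTS; apply: measurable_funM => //.
  by have [] := square_integrable_slice (w n).
- move=> x cx; apply: cvgMr.
  apply: (@cvg_comp _ _ _ (fun n => (w n, x)) phi _ (nbhs (t, x))); last exact: cphi.
  by apply: (@cvg_pair _ _ _ \oo (nbhs t) (nbhs x)) => //; exact: cvg_cst.
- rewrite (_ : EFin \o _ = fun x => (M%:E * `|(EFin \o f) x|))%E.
    exact/integrableZl/integrable_abse.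
  by apply/funext => x /=; rewrite EFinM muleC.
- move=> n x cx; rewrite normrM ler_wpM2l// HM// in_itv/=.
  by rewrite -ler_norml.
Qed.

Lemma pairing_bound M t f : (forall x, cell L x -> `|phi (t, x)| <= M) ->
  square_integrable L f ->
  ip L f (fun x => phi (t, x)) ^+ 2 <= M ^+ 2 * ip L f f.
Proof.
move=> pM hf; have hp := square_integrable_slice t.
apply: (le_trans (cauchy_schwarz L0 hf hp)).
rewrite mulrC ler_wpM2r ?ip_ge0//.
have V0 := volume_gt0 L0.
rewrite /ip ler_pdivrMl// mulrC.
apply: (@le_trans _ _ (\int[lebesgue_rV R d]_(x in cell L) M ^+ 2)).
  apply: le_Rintegral => //.
  - exact: (integrable_mul L0 hp hp).
  - apply: (@bounded_integrable_cell _ _ _ _ `|M ^+ 2|) => //.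
  - move=> x cx; rewrite -expr2 -(real_normK (num_real (phi (t, x)))).
    by rewrite lerXn2r ?nnegrE// ?pM// (le_trans _ (pM _ cx)).
by rewrite Rintegral_cst// [X in fine X](lebesgue_cell L0).
Qed.

Let bound : exists2 M, 0 < M & forall t x, t \in `[0, T] -> cell L x ->
  `|phi (t, x)| <= M.
Proof.
have [M HM] := @continuous_bounded_cylinder R d L phi 0 T cphi.
exists (`|M| + 1); first by rewrite ltr_wpDl.
by move=> t x tT cx; rewrite (le_trans (HM t x tT cx))// (le_trans (ler_norm _))// lerDl.
Qed.

Let subD t : t \in `]0, T[ -> t \in `[0, T].
Proof. by rewrite !in_itv/= => /andP[t0 tT]; rewrite !ltW. Qed.

(** On a simple field the pairing is a finite sum of indicators times continuous functions of time,
    hence measurable. By [pairing_bound], convergence in norm of the simple fields implies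
    convergence of the pairings at almost every time. *)
Lemma ae_measurable_pairing u i : L2_L2 u -> exists2 G, measurable_fun setT G &
  {ae leb, forall t, D t -> ip L (component (u t) i) (fun x => phi (t, x)) = G t}.
Proof.
move=> [Xu [S [sS Su]] _]; have [M M0 HM] := bound.
pose g n t := ip L (component (S n t) i) (fun x => phi (t, x)).
have SL n t : L2per L (S n t).
  have [p [A [f [Af SE]]]] := sS n.
  rewrite (_ : S n t = \sum_j \1_(A j) t *: f j); last first.
    by apply/funext => x; rewrite SE fct_sumE.
  by apply: L2per_comb => // j; have [] := Af j.
apply: (@ae_measurable_cvgR _ _ _ leb D g).
  move=> n; have [p [A [f [Af SE]]]] := sS n.
  have gE : g n = fun t => \sum_j \1_(A j) t * ip L (component (f j) i) (fun x => phi (t, x)).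
    apply/funext => t; have hp := square_integrable_slice t.
    have hf j : square_integrable L (component (f j) i).
      by apply: L2per_coord => //; have [] := Af j.
    rewrite /g (_ : component (S n t) i = fun x => \sum_j \1_(A j) t * component (f j) i x); last first.
      by apply/funext => x; rewrite /component SE summxE; apply: eq_bigr => j _; rewrite mxE.
    rewrite /ip; under eq_Rintegral do rewrite mulr_suml.
    rewrite ae_Rintegral_sum//; last first.
      by move=> j; apply: integrable_ae_integrable; apply: (integrable_mul L0) => //; exact: square_integrableZ.
    rewrite mulr_sumr; apply: eq_bigr => j _; rewrite mulrCA; congr (_ * _).
    rewrite -RintegralZl//; last exact: (integrable_mul L0).
    by apply: eq_Rintegral => x _; rewrite mulrA.
  rewrite gE; apply: measurable_sum => j; have [mA hfj] := Af j.
  apply: measurable_funM; first exact: measurable_indic.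
  apply: continuous_measurable_fun; apply: continuous_ip_slice.
  exact: L2per_coord.
apply: filterS2 Xu Su => t Xu Su Dt; have {}Xu := Xu Dt; have {}Su := Su Dt.
have hB n := L2perB L0 (SL n t) Xu.
have gB n : g n t - ip L (component (u t) i) (fun x => phi (t, x)) =
    ip L (component (S n t - u t) i) (fun x => phi (t, x)).
  rewrite (_ : component (S n t - u t) i = fun x => component (S n t) i x - component (u t) i x).
    by rewrite ipBl//; [exact: L2per_coord..|exact: square_integrable_slice].
  by apply/funext => x; rewrite /component !mxE.
apply/subr_cvg0; apply/norm_cvg0P; rewrite -sqrtr0.
rewrite (_ : (fun n => _) = fun n => Num.sqrt ((g n t - ip L (component (u t) i) (fun x => phi (t, x))) ^+ 2)); last first.
  by apply/funext => n; rewrite sqrtr_sqr.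
apply: continuous_cvg; first exact: sqrt_continuous.
apply: (@fine_cvg _ _ _ _ (fun n => ((g n t - ip L (component (u t) i) (fun x => phi (t, x))) ^+ 2)%:E)).
apply: (@squeeze_cvge _ _ _ _ (fun=> 0%E) _ (fun n => (M ^+ 2)%:E * L2_sqnorm L (S n t - u t)%R)%E).
- apply: nearW => n; rewrite lee_fin sqr_ge0 /= gB (L2_sqnormE L0) => [|j]; last exact: L2per_coord.
  rewrite -EFinM lee_fin; apply: (@le_trans _ _ (M ^+ 2 * ip L (component (S n t - u t) i) (component (S n t - u t) i))).
    apply: pairing_bound; last exact: L2per_coord.
    by move=> x cx; apply: HM => //; exact: subD.
  rewrite ler_pM2l ?exprn_gt0// (bigD1 i)//= lerDl sumr_ge0// => j _.
  exact: ip_ge0.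
- exact: cvg_cst.
- by have := @cvgeZl _ _ _ _ _ (M ^+ 2)%:E isT Su; rewrite mule0.
Qed.

End pairing.

Lemma ae_measurable_coefs u k i : L2_L2 u -> exists2 G, measurable_fun setT G &
  {ae leb, forall t, D t -> coefs L (u t) k i = G t}.
Proof.
move=> hu; have ck := @continuous_wave R d L 1 1 k.
apply: (@ae_measurable_pairing (fun p => cas L k p.2)) => //.
- move=> p; apply: (@continuous_comp _ _ _ snd (cas L k)); last exact: ck.
  exact: cvg_snd.
- by move=> t; exact: periodic_wave.
Qed.

(** There are countably many coefficients, each with a measurable version, so one null set serves
    for all of them and the norm becomes a series of measurable functions. *)
Lemma ae_measurable_Hs s u : L2_L2 u -> exists2 G : R -> \bar R, measurable_fun setT G &
  {ae leb, forall t, D t -> Hs_sqnorm L s (u t) = G t}.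
Proof.
move=> hu; have [Xu _ _] := hu.
have [G HG] : exists G : 'rV[int]_d * 'I_d -> R -> R, forall p,
    measurable_fun setT (G p) /\ {ae leb, forall t, D t -> coefs L (u t) p.1 p.2 = G p t}.
  have /choice[G HG] : forall p : 'rV[int]_d * 'I_d, exists g : R -> R, measurable_fun setT g /\
      {ae leb, forall t, D t -> coefs L (u t) p.1 p.2 = g t}; last by exists G.
  move=> p.
  by have [g mg gE] := ae_measurable_coefs p.1 p.2 hu; exists g.
pose a k t := (weight s k * \sum_i G (k, i) t ^+ 2)%:E.
have a0 k t : (0 <= a k t)%E.
  rewrite lee_fin mulr_ge0 ?(ltW (weight_gt0 _ _))//.
  by apply: sumr_ge0 => i _; exact: sqr_ge0.
exists (fun t => \esum_(k in [set: 'rV[int]_d]) a k t).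
  under eq_fun do rewrite esum_nneseries//.
  apply: (ge0_emeasurable_sum (h := fun n t => if pickle_inv n is Some k then a k t else 0%E)).
    by move=> n t _ _; case: pickle_inv.
  move=> n _; case: pickle_inv => [k|]; last exact: measurable_cst.
  apply/measurable_EFinP; apply: measurable_funM => //.
  by apply: measurable_sum => i; apply: measurable_funX; have [] := HG (k, i).
have H : {ae leb, forall t p, D t -> coefs L (u t) p.1 p.2 = G p t}.
  by apply: ae_forall_countable => p; have [] := HG p.
apply: filterS2 Xu H => t Xu H Dt; rewrite Hs_sqnormE//; last exact: Xu.
apply: eq_esum => k _; rewrite /a; congr (_ * _)%:E; apply: eq_bigr => i _.
by rewrite -(H (k, i)).
Qed.

(** Simple approximations of the two fields are concatenated. Bounding the integral of the sum of
    the norms by the sum of the integrals needs measurable integrands, whence the versions given by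
    [ae_measurable_Hs]. *)
Lemma L2_HsD s u v : 0 <= s -> L2_Hs L T s u -> L2_Hs L T s v ->
  L2_Hs L T s (fun t => u t + v t).
Proof.
move=> s0 hu hv; have [Xu [S [sS Su]] iu] := hu; have [Xv [S' [sS' Sv]] iv] := hv.
have N0 f : (0 <= Hs_sqnorm L s f)%E by exact: Hs_sqnorm_ge0.
have SL (X : nat -> R -> field) n t : simple_field (Hsper L s) (X n) -> L2per L (X n t).
  move=> [p [A [f [Af SE]]]].
  rewrite (_ : X n t = \sum_j \1_(A j) t *: f j); last first.
    by apply/funext => x; rewrite SE fct_sumE.
  by apply: L2per_comb => // j; have [_ []] := Af j.
split.
- by apply: filterS2 Xu Xv => t Xu Xv Dt; apply: HsperD => //; [exact: Xu|exact: Xv].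
- exists (fun n t => S n t + S' n t); split.
    move=> n; have [p [A [f [Af SE]]]] := sS n; have [p' [A' [f' [Af' SE']]]] := sS' n.
    exists (p + p')%N, (fun j => match fintype.split j with inl j => A j | inr j => A' j end),
      (fun j => match fintype.split j with inl j => f j | inr j => f' j end); split.
      by move=> j; case: fintype.split.
    move=> t x; rewrite fctE SE SE' big_split_ord /=.
    by congr (_ + _); apply: eq_bigr => j _; [rewrite (unsplitK (inl j))|rewrite (unsplitK (inr j))].
  apply: filterS (filterI (filterI Xu Xv) (filterI Su Sv)) => t [[Xut Xvt] [Sut Svt]] Dt.
  have [Xu' _] := Xut Dt; have [Xv' _] := Xvt Dt.
  have {}Su := Sut Dt; have {}Sv := Svt Dt.
  apply: (@squeeze_cvge _ _ _ _ (fun=> 0%E) _ (fun n => 2%:E *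
    (Hs_sqnorm L s (S n t - u t)%R + Hs_sqnorm L s (S' n t - v t)%R))%E).
  + apply: nearW => n; rewrite N0 /= opprD addrACA; apply: Hs_sqnormD => //.
      by apply: L2perB => //; exact: SL.
    by apply: L2perB => //; exact: SL.
  + exact: cvg_cst.
  + rewrite -(mule0 2%:E); apply: cvgeZl => //.
    have h0 : ((0 : \bar R) +? 0)%E by [].
    have SS : (Hs_sqnorm L s (S n t - u t)%R + Hs_sqnorm L s (S' n t - v t)%R)%E
        @[n --> \oo] --> ((0 : \bar R) + 0)%E := cvgeD h0 Su Sv.
    rewrite adde0 in SS; exact: SS.
- have hu' := L2_Hs_L2 s0 hu; have hv' := L2_Hs_L2 s0 hv.
  have [G mG GE] := ae_measurable_Hs s hu'; have [G' mG' GE'] := ae_measurable_Hs s hv'.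
  have pos (H : R -> \bar R) : measurable_fun D H -> measurable_fun D (fun t => `|H t|%E).
    exact: measurableT_comp.
  (* The absolute values are there because [G] and [G'] are known to be nonnegative only almost
     everywhere. *)
  apply: (@le_lt_trans _ _ (\int[leb]_(t in D) (2%:E * (`|G t| + `|G' t|)))%E).
    apply: le_integral_ae => //.
      by move=> t _; rewrite mule_ge0 ?adde_ge0.
    apply: filterS (filterI (filterI Xu Xv) (filterI GE GE')) => t [[Xut Xvt] [Et E't]] Dt.
    rewrite -(Et Dt) -(E't Dt) !gee0_abs//; apply: Hs_sqnormD => //.
      by have [] := Xut Dt.
    by have [] := Xvt Dt.
  apply: le_lt_trans (ge0_integralZl_le _ _ _) _ => //.
    by move=> t _; rewrite adde_ge0.
  rewrite ge0_integralD//=; last 2 first.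
  + by apply: pos; exact: measurable_funTS.
  + by apply: pos; exact: measurable_funTS.
  rewrite lte_mul_pinfty// lte_add_pinfty//.
  + apply: le_lt_trans iu; apply: le_integral_ae => //.
    by apply: filterS GE => t Et Dt; rewrite -(Et Dt) gee0_abs.
  + apply: le_lt_trans iv; apply: le_integral_ae => //.
    by apply: filterS GE' => t Et Dt; rewrite -(Et Dt) gee0_abs.
Qed.

(** The square of the pairing is dominated by the squared norm of [u t], and on a bounded interval
    |G| <= 1 + G^2. *)
Lemma ae_integrable_pairing phi u i : continuous phi ->
  (forall t, Defs.periodic L (fun x => phi (t, x))) -> L2_L2 u ->
  ae_integrable leb D (fun t => ip L (component (u t) i) (fun x => phi (t, x))).
Proof.
move=> cphi pphi hu; have [G mG GE] := ae_measurable_pairing cphi pphi i hu.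
have [M HM] := @continuous_bounded_cylinder R d L phi 0 T cphi.
have [Xu _ iu] := hu; exists G => //.
pose c : R := M ^+ 2 + 1; have c0 : 0 < c by rewrite ltr_wpDl// sqr_ge0.
have mGD : measurable_fun D G by exact: measurable_funTS.
have G2 : (\int[leb]_(t in D) (G t ^+ 2)%:E < +oo)%E.
  apply: (@le_lt_trans _ _ (\int[leb]_(t in D) (c%:E * L2_sqnorm L (u t)))%E).
    apply: le_integral_ae => [t _|t _|].
    - by rewrite lee_fin sqr_ge0.
    - by rewrite mule_ge0 ?L2_sqnorm_ge0// lee_fin ltW.
    - apply: filterS2 Xu GE => t Xu GE Dt; have {}Xu := Xu Dt; rewrite -GE//.
      rewrite (L2_sqnormE L0) => [|j]; last exact: L2per_coord.
      rewrite -EFinM lee_fin.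
      apply: (@le_trans _ _ (M ^+ 2 * ip L (component (u t) i) (component (u t) i))).
        apply: pairing_bound => //; last exact: L2per_coord.
        move=> x cx; apply: HM => //; move: Dt; rewrite /= !in_itv/= => /andP[t0 tT].
        by rewrite !ltW.
      apply: ler_pM; rewrite ?sqr_ge0 ?ip_ge0//; first by rewrite lerDl.
      by rewrite (bigD1 i)//= lerDl sumr_ge0// => j _; exact: ip_ge0.
  apply: le_lt_trans (ge0_integralZl_le _ c0 _) _ => [t _|]; first exact: L2_sqnorm_ge0.
  by rewrite lte_mul_pinfty ?lee_fin ?(ltW c0).
have i1 : leb.-integrable D (EFin \o (fun=> 1)).
  apply/integrableP; split; first exact: measurable_cst.
  rewrite integral_cst//= normr1 mul1e.
  by rewrite lebesgue_measure_itv/=; case: ifP => // _; rewrite -EFinD ltry.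
have i2 : leb.-integrable D (EFin \o (fun t => G t ^+ 2)).
  apply/integrableP; split; first by apply/measurable_EFinP; exact: measurable_funX.
  by under eq_integral do rewrite /= ger0_norm ?sqr_ge0//.
apply: (le_integrable _ _ _ (integrableD _ i1 i2)) => //.
  exact/measurable_EFinP.
move=> t _ /=; rewrite lee_fin [leRHS]ger0_norm ?addr_ge0 ?sqr_ge0//.
by rewrite -(real_normK (num_real (G t))); have := sqr_ge0 (`|G t| - 1); have := normr_ge0 (G t); nra.
Qed.

Section bochner_multiplier.
Variables (m : 'rV[int]_d -> R) (sg : 'rV[int]_d -> 'rV[int]_d) (s s' K : R).
Hypotheses (sgK : involutive sg) (sgE : forall k, sqnormZ R (sg k) = sqnormZ R k)
  (K0 : 0 < K) (s'0 : 0 <= s')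
  (mK : forall k, m k ^+ 2 * weight s' k <= K * weight s k).
Variables (X' : set field) (N' : field -> \bar R).
Hypotheses (MX' : forall f g, Hsper L s f -> multiplier L m sg f g -> Hsper L s' g -> X' g)
  (N'E : forall g, L2per L g -> N' g = Hs_sqnorm L s' g)
  (N'0 : forall g, (0 <= N' g)%E).

(** The target [X'], [N'] is a parameter, because one multiplier lands in a Sobolev space and
    another in the mean-zero square integrable fields. A choice of representatives turns the
    relation [multiplier] into a map, which then acts at each time. *)
Lemma bochner_multiplier : exists M : field -> field,
  (forall f, Hsper L s f -> multiplier L m sg f (M f)) /\
  forall u, L2_Hs L T s u ->
    bochner_L2 X' N' T (fun t => M (u t)) /\
    (\int[leb]_(t in D) N' (M (u t)) <= K%:E * \int[leb]_(t in D) Hs_sqnorm L s (u t))%E.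
Proof.
have [M HM] : exists M : field -> field, forall f, Hsper L s f -> multiplier L m sg f (M f).
  have /choice[M HM] : forall f, exists g, Hsper L s f -> multiplier L m sg f g.
    move=> f; have [hf|nf] := pselect (Hsper L s f); last by exists 0.
    by have [g gE] := multiplier_ex L0 sgK sgE (ltW K0) s'0 mK hf; exists g.
  by exists M.
have L2M f : Hsper L s f -> L2per L (M f) by move=> /HM[].
have le f g : L2per L f -> multiplier L m sg f g -> (N' g <= K%:E * Hs_sqnorm L s f)%E.
  move=> hf fg; rewrite N'E; last by have [] := fg.
  exact: (multiplier_le L0 sgK sgE (ltW K0) mK).
have leM f : Hsper L s f -> (N' (M f) <= K%:E * Hs_sqnorm L s f)%E.
  by move=> hf; apply: le; [have [] := hf|exact: HM].
exists M; split=> // u hu; have [Xu _ _] := hu; split; last first.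
  exact: (bochner_norm_map K0 (@Hs_sqnorm_ge0 _ _ L s) N'0 leM Xu).
apply: (@bochner_L2_map _ _ (Hsper L s) _ (Hs_sqnorm L s) _ T K) => //.
- move=> f hf; have [hf' sf] := hf; apply: (MX' hf (HM _ hf)); split; first exact: L2M.
  apply: le_lt_trans (multiplier_le L0 sgK sgE (ltW K0) mK hf' (HM _ hf)) _.
  by rewrite lte_mul_pinfty ?lee_fin ?(ltW K0).
- by move=> f; exact: Hs_sqnorm_ge0.
- move=> n c f g hf hg; have hf' j : L2per L (f j) by have [] := hf j.
  have hg' : L2per L g by have [] := hg.
  apply: le; first by apply: L2perB => //; exact: L2per_comb.
  apply: multiplierB => //; [exact: L2per_comb|apply: multiplier_comb => // j; exact: HM|exact: HM].
Qed.

End bochner_multiplier.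

End bochner_fields.

Section slices.
Context (R : realType) (d : nat) (L : 'rV[R]_d).
Implicit Types (phi : R * 'rV[R]_d -> R).

Lemma derive_slice phi (v : 'rV[R]_d) t x :
  'D_(0, v) phi (t, x) = 'D_v (fun y => phi (t, y)) x.
Proof.
rewrite /derive (_ : (fun h => _) =
  fun h => h^-1 *: (((fun y => phi (t, y)) \o shift x) (h *: v) - phi (t, x)))//.
apply/funext => h /=; congr (_ *: (phi _ - _)); congr pair.
by rewrite /= scaler0 add0r.
Qed.

Lemma smooth_slice phi t : smooth phi -> smooth (fun x => phi (t, x)).
Proof.
move=> sphi; apply: (@smooth_affine _ _ _ (fun x => (t, x)) (fun v => (0, v))) => //.
  by move=> x; apply: (@cvg_pair _ _ _ (nbhs x) (nbhs t) (nbhs x)) => //; exact: cvg_cst.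
by move=> h v x; congr pair; rewrite /= scaler0 add0r.
Qed.

Lemma periodic_slice_derive phi w t : (forall t, Defs.periodic L (fun x => phi (t, x))) ->
  Defs.periodic L (fun x => 'D_w phi (t, x)).
Proof.
move=> p x i; rewrite /derive (_ : (fun h => _) =
  fun h => h^-1 *: ((phi \o shift (t, x)) (h *: w) - phi (t, x)))//.
apply/funext => h /=; rewrite (p t) (_ : h *: w + (t, x + L 0 i *: delta_mx 0 i) =
  (h *: w.1 + t, (h *: w.2 + x) + L 0 i *: delta_mx 0 i)); first by rewrite (p (h *: w.1 + t)).
by congr pair; rewrite /= addrA.
Qed.

End slices.

(** * Cutoffs in time and the fundamental lemma *)

Section test_functions.
Context (R : realType) (d : nat) (L : 'rV[R]_d) (T : R).
Hypotheses (L0 : forall i, 0 < L 0 i).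
Local Notation leb := (@lebesgue_measure R).
Local Notation D := (`]0%R, T[%classic : set R).
Implicit Types (a b t : R) (n : nat) (k : 'rV[int]_d).

(** A smooth function with values in [0, 1], zero outside ]a, b[, which tends pointwise to the
    indicator of ]a, b[ as [n] grows. *)
Definition cutoff a b n t : R := flat 1 (n.+1%:R * (t - a)) * flat 1 (n.+1%:R * (b - t)).

Definition cylinder a b n k (p : R * 'rV[R]_d) : R := cutoff a b n p.1 * cas L k p.2.

Lemma elementary_cutoff (V : normedModType R) (l A : V -> R) a b n : continuous l ->
  (forall h v x, l (h *: v + x) = h * A v + l x) ->
  elementary (fun x => cutoff a b n (l x)).
Proof.
move=> cl lE; apply: elementary_mul.
  apply: (@elementary_comp R V (flat 1) (fun x => n.+1%:R * (l x - a))
    (fun v => n.+1%:R * A v)); first exact: smooth1_flat.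
    move=> x; exact: (cvgM (cvg_cst _) (cvgB (cl x) (cvg_cst _))).
  by move=> h v x; rewrite lE; ring.
apply: (@elementary_comp R V (flat 1) (fun x => n.+1%:R * (b - l x))
  (fun v => - n.+1%:R * A v)); first exact: smooth1_flat.
  move=> x; exact: (cvgM (cvg_cst _) (cvgB (cvg_cst _) (cl x))).
by move=> h v x; rewrite lE; ring.
Qed.

Lemma derivable_cutoff a b n t : derivable (cutoff a b n) t 1.
Proof.
have E : elementary (cutoff a b n).
  by apply: (@elementary_cutoff R id id) => [x|h v x] //; exact: cvg_id.
by have [_ dE _] := elementary_stable E; exact: dE.
Qed.

Lemma continuous_cutoff a b n : continuous (cutoff a b n).
Proof.
by move=> t; apply/differentiable_continuous/derivable1_diffP; exact: derivable_cutoff.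
Qed.

Lemma smooth_cylinder a b n k : smooth (cylinder a b n k).
Proof.
apply: smooth_elementary; apply: elementary_mul.
  apply: (@elementary_cutoff _ fst fst) => [x|h v x] //; exact: cvg_fst.
apply: (@elementary_comp R _ (fun x => 1 * cos x + 1 * sin x)
  (fun x : R * 'rV[R]_d => phase L k x.2) (fun v : R * 'rV[R]_d => phase L k v.2)).
  exact: smooth1_trig.
  move=> x; apply: (@continuous_comp _ _ _ snd (phase L k)); first exact: cvg_snd.
  exact: continuous_phase.
by move=> h v x /=; rewrite phase_line.
Qed.

Lemma test_function_cylinder a b n k : 0 < a -> b < T ->
  test_function L T (cylinder a b n k).
Proof.
move=> a0 bT; split; first exact: smooth_cylinder.
  by move=> t x i; rewrite /cylinder /=; congr (_ * _); exact: periodic_wave.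
exists a, b; split=> // t x; rewrite in_itv/= negb_and -!ltNge /cylinder /cutoff /=.
have le0 y : y < 0 -> flat 1 (n.+1%:R * y) = 0 :> R.
  by move=> y0; rewrite flat_le0// mulr_ge0_le0// ltW.
by case/orP => H; [rewrite (le0 (t - a))|rewrite (le0 (b - t))];
  rewrite ?subr_lt0// ?mulr0 !mul0r.
Qed.

Lemma cylinder_derive_time a b n k t x :
  'D_(1 : R, 0 : 'rV[R]_d) (cylinder a b n k) (t, x) = 'D_1 (cutoff a b n) t * cas L k x.
Proof.
have dc : 'D_1 (fun s => cutoff a b n s * cas L k x) t = 'D_1 (cutoff a b n) t * cas L k x.
  have := @deriveM _ _ (cutoff a b n) (cst (cas L k x)) t 1 (@derivable_cutoff a b n t) (derivable_cst _ _ _).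
  rewrite derive_cst scaler0 add0r => E.
  by rewrite (_ : (fun s => _) = cutoff a b n * cst (cas L k x))// E /GRing.scale /= mulrC.
rewrite -dc /derive (_ : (fun h => _) =
  fun h => h^-1 *: (((fun s => cutoff a b n s * cas L k x) \o shift t) (h *: 1) -
    cutoff a b n t * cas L k x))//.
by apply/funext => h /=; rewrite /cylinder /= scaler0 add0r.
Qed.

Lemma cylinder_derive_space a b n k j t x :
  'D_(0 : R, delta_mx 0 j : 'rV[R]_d) (cylinder a b n k) (t, x) =
  cutoff a b n t * (wavenumber L k j * cas L (- k) x).
Proof.
rewrite derive_slice /cylinder /=; have [dc Dc] := cas_derive L k (delta_mx 0 j) x.
have := @deriveZ _ _ _ (cas L k) (cutoff a b n t) x (delta_mx 0 j) dc.
by rewrite Dc phase_delta.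
Qed.

(** In the limit of the cutoffs, the integral of [h] over every interval inside ]0, T[ vanishes. A
    primitive is then constant on ]0, T[, and Lebesgue's differentiation theorem says that its
    derivative is [h] almost everywhere. *)
Lemma fundamental_lemma (h : R -> R) : 0 < T -> ae_integrable leb D h ->
  (forall a b n, 0 < a -> b < T -> \int[leb]_(t in D) (h t * cutoff a b n t) = 0) ->
  {ae leb, forall t, D t -> h t = 0}.
Proof.
move=> T0 [g gi hg] h0.
have mD : measurable D by [].
have mg : measurable_fun D g by have /integrableP[/measurable_EFinP] := gi.
have b1 a b n t : `|cutoff a b n t| <= 1.
  by rewrite /cutoff normrM !ger0_norm ?flat1_ge0// mulr_ile1// ?flat1_ge0 ?flat1_le1.
(* Extension by zero gives a function integrable on the whole line, which has a primitive starting
   at minus infinity. *)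
pose G := g \_ D.
have Gi : leb.-integrable setT (EFin \o G).
  by have [/(_ gi)] := @integrable_mkcond _ _ R leb D (EFin \o g) mD; rewrite restrict_EFin.
have G0 a b : 0 < a -> a <= b -> b < T -> \int[leb]_(t in `]a, b]) G t = 0.
  move=> a0 ab bT.
  have lim : \int[leb]_(t in D) (g t * cutoff a b n t) @[n --> \oo] -->
      \int[leb]_(t in D) (g t * ((if 0 < t - a then 1 else 0) * (if 0 < b - t then 1 else 0))).
    apply: (@Rintegral_cvg _ _ R leb D mD (fun n t => g t * cutoff a b n t) _ (fun t => `|g t|)).
    - move=> n; apply: measurable_funM => //; apply: measurable_funTS.
      apply: continuous_measurable_fun; exact: continuous_cutoff.
    - by move=> t Dt; apply: cvgMr; apply: cvgM; exact: flat1_cvg.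
    - exact: (integrable_abse gi).
    - by move=> n t _; rewrite normrM ler_piMr.
  have E n : \int[leb]_(t in D) (g t * cutoff a b n t) = 0.
    rewrite -[RHS](h0 a b n)//; apply: eq_Rintegral_ae.
    by apply: filterS hg => t ht Dt; rewrite ht.
  have {lim} lim0 : \int[leb]_(t in D) (g t * ((if 0 < t - a then 1 else 0) * (if 0 < b - t then 1 else 0))) = 0.
    rewrite -(cvg_lim (@Rhausdorff R) lim) (_ : (fun n => _) = cst 0); first by rewrite lim_cst.
    by apply/funext => n; rewrite E.
  rewrite -[RHS]lim0 Rintegral_mkcond [RHS]Rintegral_mkcond.
  apply: eq_Rintegral_ae.
  (* The cutoffs converge to the indicator of ]a, b[, whereas increments of the primitive are
     integrals over ]a, b]; the endpoint is negligible. *)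
  have : {ae leb, forall t, t != b}.
    exists [set b]; split; [exact: measurable_set1|exact: lebesgue_measure_set1|].
    by move=> t /= /negP; rewrite negbK => /eqP.
  apply: filterS => t tb _; rewrite /G !patchE !mem_setE !in_itv/= !subr_gt0.
  rewrite (le_eqVlt t b) (negbTE tb)/=.
  case: (ltP a t) => ta; case: (ltP t b) => tb' /=; rewrite ?mulr1 ?mulr0 ?mul0r ?if_same//.
have locG : locally_integrable setT G by apply: open_integrable_locally => //; exact: openT.
have iS b : leb.-integrable [set` Interval -oo%O (BRight b)] (EFin \o G).
  by apply: integrableS Gi.
pose F b := \int[leb]_(x in [set` Interval -oo%O (BRight b)]) G x.
have := FTC1Ny iS locG.
apply: filterS2 hg => t ht [_ dF] Dt; rewrite ht//.
have := Dt; rewrite /= in_itv/= => /andP[t0 tT].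
have -> : g t = G t by rewrite /G patchE mem_set.
rewrite -dF -/F.
rewrite derive1E.
have FE b : 0 < b -> b < T -> F b = F t.
  move=> b0 bT; apply/eqP; rewrite -subr_eq0; apply/eqP.
  have [tb|/ltW bt] := leP t b.
    by rewrite /F Rintegral_itvB ?G0//.
  by apply/eqP; rewrite -oppr_eq0 opprB /F Rintegral_itvB ?G0//.
rewrite (@near_eq_derive _ _ _ F (cst (F t)) t 1) ?derive_cst//.
near=> b; apply: FE; near: b; [exact: lt_nbhsr|exact: lt_nbhsl].
Unshelve. all: by end_near. Qed.

End test_functions.

(** * Distributional identities *)

Section multiplier_pairings.
Context (R : realType) (d : nat) (L : 'rV[R]_d).
Hypothesis L0 : forall i, 0 < L 0 i.
Implicit Types (f g v w : 'rV[R]_d -> 'rV[R]_d) (phi : 'rV[R]_d -> R).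

Lemma netcvgZ c (a : 'rV[int]_d -> R) l : netcvg a l -> netcvg (fun k => c * a k) (c * l).
Proof.
move=> al e e0; have c0 : 0 < `|c| + 1 by rewrite ltr_wpDl.
have [s0 H] := al _ (divr_gt0 e0 c0).
exists s0 => s us ss; rewrite -mulr_sumr -mulrBr normrM.
apply: (@le_trans _ _ ((`|c| + 1) * (e / (`|c| + 1)))).
  by apply: ler_pM => //; [rewrite lerDl|exact: H].
by rewrite mulrC divfK// gt_eqF.
Qed.

(** The exchange of k and - k occurs twice and cancels, so the Laplacian is diagonal, with symbol
    minus the sum of the squared wavenumbers. Thus [g] is, weakly, - c times the Laplacian of
    [f]. *)
Lemma ip_laplacian f g (c : R) phi i : L2per L f ->
  multiplier L (fun k => c * \sum_j wavenumber L k j ^+ 2) id f g ->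
  smooth phi -> Defs.periodic L phi ->
  ip L (component g i) phi = - c * \sum_j ip L (component f i)
    ('D_(delta_mx 0 j) ('D_(delta_mx 0 j) phi)).
Proof.
move=> hf [hg gE] sp pp.
have H1 := netcvg_ip L0 (L2per_coord L0 i hg) (square_integrable_smooth L0 sp pp).
have H2 j := ip_field_derive L0 i j hf (smooth_derive (delta_mx 0 j) sp)
  (periodic_derive (delta_mx 0 j) pp).
have H3 := netcvgZ (- c) (netcvg_sum (index_enum 'I_d) H2).
apply: (netcvg_unique H1); congr (netcvg _ _) : H3; apply/funext => k.
under eq_bigr do rewrite (hcoef_smooth_derive L0)// opprK wavenumberN.
rewrite [hcoef L k (component g i)](gE k i : hcoef L k (component g i) = _); move: (coefs L f k i) (hcoef L k phi) => A B.
by rewrite !mulr_sumr !mulr_suml; apply: eq_bigr => j _; ring.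
Qed.

(** Weakly, (F.grad) g = f. Reindexing by - k aligns the two expansions; at k = 0, where the symbol
    cannot be inverted, both terms vanish because [f] has mean zero. *)
Lemma ip_transport (F : 'rV[R]_d) f g phi i :
  L2per L f -> (forall i, coefs L f 0 i = 0) ->
  (forall k, k != 0 -> \sum_j F 0 j * wavenumber L k j != 0) ->
  multiplier L (fun k => (\sum_j F 0 j * wavenumber L k j)^-1) -%R f g ->
  smooth phi -> Defs.periodic L phi ->
  ip L (component f i) phi =
  - \sum_j F 0 j * ip L (component g i) ('D_(delta_mx 0 j) phi).
Proof.
move=> hf f0 F0 [hg gE] sp pp.
have H1 := netcvg_reindex (@opprK _)
  (netcvg_ip L0 (L2per_coord L0 i hf) (square_integrable_smooth L0 sp pp)).
have H2 j := netcvgZ (- F 0 j) (ip_field_derive L0 i j hg sp pp).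
have H3 := netcvg_sum (index_enum 'I_d) H2.
rewrite -sumrN; under eq_bigr do rewrite -mulNr.
apply: (netcvg_unique H1); congr (netcvg _ _) : H3; apply/funext => k.
transitivity ((\sum_j F 0 j * wavenumber L k j) * (coefs L g k i * hcoef L (- k) phi)).
  by rewrite mulr_suml; apply: eq_bigr => j _; ring.
rewrite gE; have [->|k0] := eqVneq k 0.
  by rewrite oppr0 f0 mulr0 mul0r mulr0 -/(coefs L f 0 i) f0 mul0r.
by rewrite !mulrA divff ?F0// mul1r.
Qed.

End multiplier_pairings.

(** * The curl of a cross product with a constant vector *)

Section curl_cross_formula.
Context (R : realType) (A : Type).

Let sum2 (a : 'I_2 -> R) : \sum_j a j = a 0 + a 1.
Proof.
rewrite !big_ord_recl big_ord0 addr0.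
by congr (a _ + a _); exact: val_inj.
Qed.

Let sum3 (a : 'I_3 -> R) : \sum_j a j = a 0 + a 1 + a 2.
Proof.
rewrite !big_ord_recl big_ord0 addr0 addrA.
by congr (a _ + a _ + a _); exact: val_inj.
Qed.

(** The vector identity reduced to algebra: [V i (P j)] stands for the value of the i-th
    distribution on the j-th derivative of the test function. No linearity of distributions is
    involved, as both sides combine such values. *)
Lemma cross2E (V : 'I_2 -> A -> R) (f : 'I_2 -> R) (P : 'I_2 -> A) (i : 'I_2) :
  (if i == 0 then - (f 1 * V 0 (P 1) - f 0 * V 1 (P 1))
   else - - (f 1 * V 0 (P 0) - f 0 * V 1 (P 0))) =
  - \sum_j f j * V i (P j) + f i * \sum_j V j (P j).
Proof.
rewrite !sum2; have [->|->] : i = 0 \/ i = 1.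
- by case: i => -[|[|//]] ?; [left|right]; exact: val_inj.
- by rewrite eqxx; ring.
- by rewrite /=; ring.
Qed.

Lemma cross3E (V : 'I_3 -> A -> R) (f : 'I_3 -> R) (P : 'I_3 -> A) (i : 'I_3) :
  - (f (i + 2 + 2) * V (i + 2 + 1) (P (i + 1)) -
      f (i + 2 + 1) * V (i + 2 + 2) (P (i + 1))) -
    - (f (i + 1 + 2) * V (i + 1 + 1) (P (i + 2)) -
      f (i + 1 + 1) * V (i + 1 + 2) (P (i + 2))) =
  - \sum_j f j * V i (P j) + f i * \sum_j V j (P j).
Proof.
have [a01 a02 a11] : [/\ 0 + 1 = 1 :> 'I_3, 0 + 2 = 2 :> 'I_3 & 1 + 1 = 2 :> 'I_3].
  by split; exact: val_inj.
have [a12 a21 a22] : [/\ 1 + 2 = 0 :> 'I_3, 2 + 1 = 0 :> 'I_3 & 2 + 2 = 1 :> 'I_3].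
  by split; exact: val_inj.
rewrite !sum3.
have [->|->|->] : [\/ i = 0, i = 1 | i = 2].
  by case: i => -[|[|[|//]]] ?; [apply: Or31|apply: Or32|apply: Or33]; exact: val_inj.
all: rewrite ?(a01, a02, a11, a12, a21, a22).
all: move: (f 0) (f 1) (f 2) => x y z.
all: move: (V 0 (P 0)) (V 1 (P 1)) (V 2 (P 2)) => a b c.
- by move: (V 0 (P 1)) (V 0 (P 2)) => p q; ring.
- by move: (V 1 (P 0)) (V 1 (P 2)) => p q; ring.
- by move: (V 2 (P 0)) (V 2 (P 1)) => p q; ring.
Qed.

End curl_cross_formula.

Lemma curl_crossE (R : realType) d (V : 'I_d -> distrib R d) (F : 'rV[R]_d) i phi :
  d = 2%N \/ d = 3%N ->
  curl_cross V F i phi =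
  - \sum_j F 0 j * V i ('D_(0 : R, delta_mx 0 j : 'rV[R]_d) phi) +
  F 0 i * \sum_j V j ('D_(0 : R, delta_mx 0 j : 'rV[R]_d) phi).
Proof.
case=> dE; subst d.
- rewrite -(cross2E V (F 0) (fun j => 'D_(0 : R, delta_mx 0 j : 'rV[R]_2) phi)).
  by rewrite /curl_cross /curl2; case: ifP.
- exact: (cross3E V (F 0) (fun j => 'D_(0 : R, delta_mx 0 j : 'rV[R]_3) phi)).
Qed.

Section distribution_pairings.
Context (R : realType) (d : nat) (L : 'rV[R]_d) (T : R).
Hypotheses (L0 : forall i, 0 < L 0 i) (T0 : 0 < T).
Local Notation field := ('rV[R]_d -> 'rV[R]_d).
Local Notation leb := (@lebesgue_measure R).
Local Notation D := (`]0%R, T[%classic : set R).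
Local Notation pair u i phi t := (ip L (component (u t) i) (fun x => phi (t, x))).
Implicit Types (u v w : R -> field) (phi : R * 'rV[R]_d -> R).

Let mD : measurable (D : set (measurableTypeR R)). Proof. by []. Qed.

(** Identities involving only space derivatives hold at each time, hence without a support condition
    in time. *)
Definition smooth_periodic phi :=
  smooth phi /\ forall t, Defs.periodic L (fun x => phi (t, x)).

Lemma smooth_periodic_test phi : test_function L T phi -> smooth_periodic phi.
Proof. by case. Qed.

Lemma smooth_periodic_derive phi (z : R * 'rV[R]_d) :
  smooth_periodic phi -> smooth_periodic ('D_z phi).
Proof.
move=> [sp pp]; split; first exact: smooth_derive.
by move=> t; exact: periodic_slice_derive.
Qed.

Lemma smooth_slices phi t : smooth_periodic phi ->
  smooth (fun x => phi (t, x)) /\ Defs.periodic L (fun x => phi (t, x)).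
Proof. by move=> [sp pp]; split=> //; exact: smooth_slice. Qed.

Lemma slice_derive phi j t :
  (fun x => 'D_(0 : R, delta_mx 0 j : 'rV[R]_d) phi (t, x)) =
  'D_(delta_mx 0 j) (fun x => phi (t, x)).
Proof. by apply/funext => x; exact: derive_slice. Qed.

Lemma slice_derive2 phi j t :
  (fun x => 'D_(0 : R, delta_mx 0 j : 'rV[R]_d)
    ('D_(0 : R, delta_mx 0 j : 'rV[R]_d) phi) (t, x)) =
  'D_(delta_mx 0 j) ('D_(delta_mx 0 j) (fun x => phi (t, x))).
Proof.
have := congr1 (fun g : 'rV[R]_d -> R => 'D_(delta_mx 0 j) g) (slice_derive phi j t).
have := slice_derive ('D_(0 : R, delta_mx 0 j : 'rV[R]_d) phi) j t => E E2.
transitivity ('D_(delta_mx 0 j) (fun x => 'D_(0 : R, delta_mx 0 j : 'rV[R]_d) phi (t, x))).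
  exact: E.
exact: E2.
Qed.

Lemma ae_integrable_pair u i phi : L2_L2 L T u -> smooth_periodic phi ->
  ae_integrable leb D (fun t => pair u i phi t).
Proof.
move=> hu [sp pp]; apply: ae_integrable_pairing => //.
by have [] := sp [::].
Qed.

Lemma dist_ofE u i phi : L2_L2 L T u -> smooth_periodic phi ->
  dist_of L T u i phi = volume L * \int[leb]_(t in D) pair u i phi t.
Proof.
move=> hu sp; rewrite -(ae_RintegralZ mD _ (ae_integrable_pair i hu sp)).
apply: eq_Rintegral => t _; rewrite /ip mulrA divff ?mul1r//.
by rewrite gt_eqF// volume_gt0.
Qed.

Lemma dist_of_div_free v phi : L2_L2 L T v ->
  {ae leb, forall t, D t -> div_free L (v t)} -> smooth_periodic phi ->
  \sum_j dist_of L T v j ('D_(0 : R, delta_mx 0 j : 'rV[R]_d) phi) = 0.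
Proof.
move=> hv dv sp; have [Xv _ _] := hv.
have sD j := smooth_periodic_derive (0, delta_mx 0 j) sp.
under eq_bigr do rewrite dist_ofE//.
rewrite -mulr_sumr -(ae_Rintegral_sum mD); last by move=> j; exact: (ae_integrable_pair j hv (sD j)).
rewrite [X in _ * X](_ : _ = 0) ?mulr0// -[RHS](_ : \int[leb]_(t in D) 0 = 0); last first.
  by rewrite /Rintegral integral0.
apply: eq_Rintegral_ae; apply: filterS2 dv Xv => t dv Xv Dt.
have [ss ps] := smooth_slices t sp.
have /eqP := dv Dt _ ss ps; rewrite (div_freeE L0 (Xv Dt))// mulf_eq0.
rewrite gt_eqF ?volume_gt0//= => /eqP E; rewrite -[RHS]E; apply: eq_bigr => j _.
by rewrite slice_derive.
Qed.

Lemma laplacianE (S : distrib R d) phi : laplacian S phi =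
  \sum_j S ('D_(0 : R, delta_mx 0 j : 'rV[R]_d) ('D_(0 : R, delta_mx 0 j : 'rV[R]_d) phi)).
Proof. by rewrite /laplacian fct_sumE; apply: eq_bigr => j _; rewrite /dx opprK. Qed.

Lemma dist_of_laplacian u w c i phi : L2_L2 L T u -> L2_L2 L T w ->
  {ae leb, forall t, D t ->
    multiplier L (fun k => c * \sum_j wavenumber L k j ^+ 2) id (u t) (w t)} ->
  smooth_periodic phi ->
  dist_of L T w i phi = - c * laplacian (dist_of L T u i) phi.
Proof.
move=> hu hw uw sp; have [Xu _ _] := hu; have [Xw _ _] := hw.
have sD j := smooth_periodic_derive (0, delta_mx 0 j)
  (smooth_periodic_derive (0, delta_mx 0 j) sp).
rewrite laplacianE dist_ofE//; under eq_bigr do rewrite dist_ofE//.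
rewrite -mulr_sumr mulrCA; congr (_ * _).
have iD j := ae_integrable_pair i hu (sD j).
rewrite -(ae_Rintegral_sum mD)// -(ae_RintegralZ mD); last exact: ae_integrable_sum.
apply: eq_Rintegral_ae; apply: filterS2 Xu uw => t Xu uw Dt.
have [ss ps] := smooth_slices t sp.
apply: etrans (ip_laplacian L0 i (Xu Dt) (uw Dt) ss ps) _.
apply: (congr1 (fun z => - c * z)); apply: eq_bigr => j _.
by apply: (congr1 (ip L _)); exact/esym/slice_derive2.
Qed.

Lemma dist_ofD u v i phi : L2_L2 L T u -> L2_L2 L T v ->
  L2_L2 L T (fun t => u t + v t) -> smooth_periodic phi ->
  dist_of L T (fun t => u t + v t) i phi = dist_of L T u i phi + dist_of L T v i phi.
Proof.
move=> hu hv huv sp; have [Xu _ _] := hu; have [Xv _ _] := hv.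
rewrite !dist_ofE// -mulrDr; congr (_ * _).
rewrite -(ae_RintegralD mD); [|exact: ae_integrable_pair..].
apply: eq_Rintegral_ae; apply: filterS2 Xu Xv => t Xu Xv Dt.
have [ss ps] := smooth_slices t sp.
rewrite -ipDl//; [|exact: (L2per_coord L0 _ (Xu Dt))|exact: (L2per_coord L0 _ (Xv Dt))|exact: square_integrable_smooth].
by congr ip; apply/funext => x; rewrite /component fctE mxE.
Qed.

Lemma dist_of_transport (F : 'rV[R]_d) u w i phi : L2_L2 L T u -> L2_L2 L T w ->
  {ae leb, forall t, D t -> forall i, coefs L (u t) 0 i = 0} ->
  (forall k, k != 0 -> \sum_j F 0 j * wavenumber L k j != 0) ->
  {ae leb, forall t, D t -> multiplier L
    (fun k => (\sum_j F 0 j * wavenumber L k j)^-1) -%R (u t) (w t)} ->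
  smooth_periodic phi ->
  dist_of L T u i phi =
  - \sum_j F 0 j * dist_of L T w i ('D_(0 : R, delta_mx 0 j : 'rV[R]_d) phi).
Proof.
move=> hu hw u0 F0 uw sp; have [Xu _ _] := hu.
have sD j := smooth_periodic_derive (0, delta_mx 0 j) sp.
rewrite dist_ofE//; under eq_bigr do rewrite dist_ofE// mulrCA.
rewrite -mulr_sumr -mulrN; congr (_ * _).
have iD j := ae_integrable_pair i hw (sD j).
under eq_bigr do rewrite -(ae_RintegralZ mD)//.
rewrite -(ae_Rintegral_sum mD); last by move=> j; exact: ae_integrableZ.
rewrite -mulN1r -(ae_RintegralZ mD); last first.
  by apply: ae_integrable_sum => // j; exact: ae_integrableZ.
apply: eq_Rintegral_ae; apply: filterS3 Xu u0 uw => t Xu u0 uw Dt.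
have [ss ps] := smooth_slices t sp.
rewrite mulN1r; apply: etrans (ip_transport L0 i (Xu Dt) (u0 Dt) F0 (uw Dt) ss ps) _.
apply: (congr1 -%R); apply: eq_bigr => j _; apply: (congr1 (fun z => F 0 j * z)).
by apply: (congr1 (ip L _)); exact/esym/slice_derive.
Qed.

Lemma pair_cylinder u i a b n k : L2_L2 L T u ->
  {ae leb, forall t, D t ->
    pair u i (cylinder L a b n k) t = coefs L (u t) k i * cutoff a b n t}.
Proof.
move=> [Xu _ _]; apply: filterS Xu => t Xu Dt.
rewrite ipC (_ : (fun x => cylinder L a b n k (t, x)) = fun x => cutoff a b n t * cas L k x)//.
rewrite ipZl//; [|exact: square_integrable_cas|exact: (L2per_coord L0 _ (Xu Dt))].
by rewrite ipC mulrC.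
Qed.

Lemma ae_integrable_coefs_cutoff u i a b n k : L2_L2 L T u -> 0 < a -> b < T ->
  ae_integrable leb D (fun t => coefs L (u t) k i * cutoff a b n t).
Proof.
move=> hu a0 bT; have sp := smooth_periodic_test (test_function_cylinder L0 n k a0 bT).
apply: ae_integrable_eq (ae_integrable_pair i hu sp).
by apply: filterS (pair_cylinder i a b n k hu) => t E Dt; rewrite E.
Qed.

Lemma dist_of_cylinder u i a b n k : L2_L2 L T u -> 0 < a -> b < T ->
  dist_of L T u i (cylinder L a b n k) =
  volume L * \int[leb]_(t in D) (coefs L (u t) k i * cutoff a b n t).
Proof.
move=> hu a0 bT; have sp := smooth_periodic_test (test_function_cylinder L0 n k a0 bT).
by rewrite dist_ofE//; congr (_ * _); apply: eq_Rintegral_ae; exact: pair_cylinder.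
Qed.

Lemma dist_of_cylinder_space u i j a b n k : L2_L2 L T u -> 0 < a -> b < T ->
  dist_of L T u i ('D_(0 : R, delta_mx 0 j : 'rV[R]_d) (cylinder L a b n (- k))) =
  - wavenumber L k j * dist_of L T u i (cylinder L a b n k).
Proof.
move=> hu a0 bT.
have sp l := smooth_periodic_test (test_function_cylinder L0 n l a0 bT).
rewrite !dist_ofE//; last exact: smooth_periodic_derive.
rewrite mulrCA; congr (_ * _); rewrite -(ae_RintegralZ mD); last exact: (ae_integrable_pair i hu (sp k)).
apply: eq_Rintegral_ae; have [Xu _ _] := hu; apply: filterS Xu => t Xu Dt.
rewrite ipC [X in _ * X]ipC.
rewrite (_ : (fun x => 'D_ _ _ _) = fun x => - wavenumber L k j * cylinder L a b n k (t, x)).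
  rewrite ipZl//; last exact: (L2per_coord L0 _ (Xu Dt)).
  by have [ss ps] := smooth_slices t (sp k); exact: square_integrable_smooth.
apply/funext => x; rewrite cylinder_derive_space opprK wavenumberN /cylinder /=; ring.
Qed.

(** Differentiating a cylinder in time changes only its time factor, so the same combination of
    coefficients at k appears and vanishes. The constants [c] cover both constraints, zero mean and
    zero divergence. *)
Lemma dist_of_cylinder_time u (c : 'I_d -> R) a b n k : L2_L2 L T u -> 0 < a -> b < T ->
  {ae leb, forall t, D t -> \sum_i c i * coefs L (u t) k i = 0} ->
  \sum_i c i * dist_of L T u i ('D_(1 : R, 0 : 'rV[R]_d) (cylinder L a b n k)) = 0.
Proof.
move=> hu a0 bT u0; have [Xu _ _] := hu.
have sp := smooth_periodic_derive (1, 0) (smooth_periodic_test (test_function_cylinder L0 n k a0 bT)).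
have ip_ i := ae_integrable_pair i hu sp.
under eq_bigr do rewrite dist_ofE// mulrCA -(ae_RintegralZ mD)//.
rewrite -mulr_sumr -(ae_Rintegral_sum mD); last by move=> i; exact: ae_integrableZ.
rewrite [X in _ * X](_ : _ = 0) ?mulr0// -[RHS](_ : \int[leb]_(t in D) 0 = 0); last first.
  by rewrite /Rintegral integral0.
apply: eq_Rintegral_ae; apply: filterS2 Xu u0 => t Xu u0 Dt.
transitivity ('D_1 (cutoff a b n) t * \sum_i c i * coefs L (u t) k i); last first.
  by rewrite (u0 Dt) mulr0.
rewrite mulr_sumr; apply: eq_bigr => i _.
rewrite [RHS]mulrCA; apply: (congr1 (fun z => c i * z)); rewrite ipC.
rewrite (_ : (fun x => 'D_ _ _ _) = fun x => 'D_1 (cutoff a b n) t * cas L k x); last first.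
  by apply/funext => x; exact: cylinder_derive_time.
rewrite ipZl//; [|exact: square_integrable_cas|exact: (L2per_coord L0 _ (Xu Dt))].
by rewrite ipC.
Qed.

Lemma ae_integrable_coefs u k i : L2_L2 L T u ->
  ae_integrable leb D (fun t => coefs L (u t) k i).
Proof.
move=> hu.
have ck : continuous (fun p : R * 'rV[R]_d => cas L k p.2).
  move=> p; apply: (@continuous_comp _ _ _ snd (cas L k)); first exact: cvg_snd.
  exact: continuous_wave.
have pk : forall t : R, Defs.periodic L (fun x => cas L k (t, x).2).
  by move=> t; exact: periodic_wave.
exact: (ae_integrable_pairing L0 i ck pk hu).
Qed.

Lemma fundamental_coefs u (c : 'I_d -> R) k : L2_L2 L T u ->
  (forall a b n, 0 < a -> b < T ->
     \sum_i c i * dist_of L T u i (cylinder L a b n k) = 0) ->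
  {ae leb, forall t, D t -> \sum_i c i * coefs L (u t) k i = 0}.
Proof.
move=> hu u0; have V0 := volume_gt0 L0.
have ik i := ae_integrable_coefs k i hu.
apply: fundamental_lemma => //.
  by apply: ae_integrable_sum => // i; exact: ae_integrableZ.
move=> a b n a0 bT; have /eqP := u0 a b n a0 bT.
have ib i := ae_integrable_coefs_cutoff i n k hu a0 bT.
under eq_bigr do rewrite dist_of_cylinder// mulrCA -(ae_RintegralZ mD)//.
rewrite -mulr_sumr -(ae_Rintegral_sum mD); last by move=> i; exact: ae_integrableZ.
rewrite mulf_eq0 gt_eqF//= => /eqP E; rewrite -[RHS]E; apply: eq_Rintegral => t _.
by rewrite mulr_suml; apply: eq_bigr => i _; rewrite mulrA.
Qed.

End distribution_pairings.

(** * The velocity field *)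

Section constants.
Context (R : realType) (d : nat) (L : 'rV[R]_d).
Hypotheses (L0 : forall i, 0 < L 0 i).
Implicit Types (k : 'rV[int]_d) (tau C : R).

Lemma sqnormZ_gt0 k : k != 0 -> 0 < sqnormZ R k.
Proof.
move=> k0; have [i ki] : exists i, k 0 i != 0.
  apply/existsP; apply: contraNT k0; rewrite negb_exists => /forallP k0.
  by apply/eqP/rowP => i; rewrite mxE; apply/eqP; rewrite -[_ == _]negbK.
rewrite /sqnormZ (bigD1 i)//= ltr_pwDl//.
  by rewrite exprn_even_gt0//= intr_eq0.
by apply: sumr_ge0 => j _; exact: sqr_ge0.
Qed.

Lemma sum_wavenumber_sq_le : exists2 A : R, 0 < A &
  forall k, \sum_j wavenumber L k j ^+ 2 <= A * sqnormZ R k.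
Proof.
pose a j : R := (2 * pi / L 0 j) ^+ 2.
have a0 j : 0 <= a j by exact: sqr_ge0.
exists (1 + \sum_j a j); first by rewrite ltr_pwDl// sumr_ge0.
move=> k; rewrite /sqnormZ mulr_sumr; apply: ler_sum => j _.
have -> : wavenumber L k j ^+ 2 = a j * (k 0 j)%:~R ^+ 2 by rewrite -exprMn /wavenumber mulrA mulrAC.
apply: ler_wpM2r; first exact: sqr_ge0.
by rewrite (bigD1 j)//= addrCA lerDl addr_ge0// sumr_ge0.
Qed.

(** The symbol is at most |c| A (1 + |k|^2), and the square of 1 + |k|^2 is exactly the ratio of the
    weights of exponents tau + 2 and tau. *)
Lemma laplacian_weight c tau : exists2 K : R, 0 < K &
  forall k, (c * \sum_j wavenumber L k j ^+ 2) ^+ 2 * weight tau k <= K * weight (tau + 2) k.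
Proof.
have [A A0 HA] := sum_wavenumber_sq_le.
(* The [+ 1] makes the constant positive even for [c = 0]. *)
exists ((c * A) ^+ 2 + 1); first by rewrite ltr_wpDl// sqr_ge0.
move=> k; have q0 := @sqnormZ_ge0 R d k.
have p0 : 0 < 1 + sqnormZ R k by rewrite ltr_pwDl.
rewrite /weight powRD; last by apply/implyP => _; rewrite gt_eqF.
rewrite -/(weight tau k) mulrCA [leLHS]mulrC ler_pM2l ?weight_gt0//.
rewrite (powR_mulrn 2 (ltW p0)).
apply: (@le_trans _ _ ((c * A) ^+ 2 * (1 + sqnormZ R k) ^+ 2)); last first.
  by apply: ler_wpM2r; [exact: sqr_ge0|rewrite lerDl].
rewrite [leLHS]exprMn (_ : _ * _ = c ^+ 2 * (A * (1 + sqnormZ R k)) ^+ 2); last first.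
  by ring.
apply: ler_wpM2l; first exact: sqr_ge0.
rewrite lerXn2r ?nnegrE//.
- by apply: sumr_ge0 => j _; exact: sqr_ge0.
- by rewrite mulr_ge0// ltW.
- by rewrite (le_trans (HA k))// ler_pM2l// lerDr.
Qed.

Variables (F : 'rV[R]_d) (tau C : R).
Hypotheses (tau0 : 0 <= tau) (C0 : 0 < C) (hF : diophantine L F tau C).

Let dotE k : \sum_j F 0 j * wavenumber L k j = 2 * pi * dot F (freq L k).
Proof.
rewrite /dot mulr_sumr; apply: eq_bigr => j _; rewrite mxE /wavenumber; ring.
Qed.

Let P k := Num.sqrt (sqnormZ R k) `^ tau.

Let P0 k : k != 0 -> 0 < P k.
Proof. by move=> k0; rewrite powR_gt0// sqrtr_gt0 sqnormZ_gt0. Qed.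

Let P2 k : P k ^+ 2 <= weight tau k.
Proof.
rewrite expr2 /P -powRM ?sqrtr_ge0// -expr2 sqr_sqrtr ?sqnormZ_ge0//.
apply: ge0_ler_powR => //; rewrite ?nnegrE ?sqnormZ_ge0 ?addr_ge0 ?sqnormZ_ge0//.
by rewrite lerDr.
Qed.

Lemma transport_neq0 k : k != 0 -> \sum_j F 0 j * wavenumber L k j != 0.
Proof.
move=> k0; rewrite dotE mulf_neq0//; first by rewrite gt_eqF// mulr_gt0// pi_gt0.
by rewrite -normr_gt0 (lt_le_trans _ (hF k0))// divr_gt0// P0.
Qed.

(** The factor 2 pi comes from the wavenumbers and [C] from the Diophantine bound; |k|^tau squared
    is at most the weight of exponent tau. At k = 0 the left side is 0, by the convention that the
    inverse of 0 is 0. *)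
Lemma transport_weight k : (\sum_j F 0 j * wavenumber L k j)^-1 ^+ 2 * weight 0 k <=
  (2 * pi * C)^-1 ^+ 2 * weight tau k.
Proof.
rewrite {1}/weight powRr0 mulr1.
have [->|k0] := eqVneq k 0.
  rewrite big1 ?invr0 ?expr0n; last by move=> j _; rewrite /wavenumber mxE mul0r mulr0 mulr0.
  by rewrite mulr_ge0 ?sqr_ge0// ltW// weight_gt0.
have tp : 0 < 2 * pi :> R by rewrite mulr_gt0// pi_gt0.
have pC : 0 < 2 * pi * C by rewrite mulr_gt0.
apply: (@le_trans _ _ ((2 * pi * C)^-1 ^+ 2 * P k ^+ 2)); last first.
  by apply: ler_wpM2l; [exact: sqr_ge0|exact: P2].
rewrite -exprMn -real_normK ?num_real// lerXn2r ?nnegrE//.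
  by rewrite mulr_ge0 ?invr_ge0 ?(ltW pC)// ltW// P0.
rewrite normfV -[leRHS]invrK lef_pV2 ?posrE.
- rewrite [leLHS](_ : _ = 2 * pi * (C / P k)); last by rewrite [LHS]invfM invrK mulrA.
  by rewrite dotE normrM (gtr0_norm tp) ler_pM2l//; exact: hF.
- by rewrite normr_gt0 transport_neq0.
- by rewrite invr_gt0 mulr_gt0 ?invr_gt0// P0.
Qed.

End constants.

Section ae_time.
Context (R : realType) (T : R).
Local Notation leb := (@lebesgue_measure R).

Lemma ae_closed_interval (Q : R -> Prop) :
  {ae leb, forall t, t \in `]0, T[ -> Q t} -> {ae leb, forall t, t \in `[0, T] -> Q t}.
Proof.
have ne c : {ae leb, forall t, t != c}.
  exists [set c]; split; [exact: measurable_set1|exact: lebesgue_measure_set1|].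
  by move=> t /= /negP; rewrite negbK => /eqP.
move=> H; apply: filterS3 H (ne 0) (ne T) => t H t0 tT; rewrite in_itv/= => /andP[t1 t2].
by apply: H; rewrite in_itv/= !lt_neqAle eq_sym t0 t1 tT t2.
Qed.

Lemma ae_open_interval (Q : R -> Prop) :
  {ae leb, forall t, t \in `[0, T] -> Q t} -> {ae leb, forall t, t \in `]0, T[ -> Q t}.
Proof.
apply: filterS => t H; rewrite in_itv/= => /andP[t1 t2].
by apply: H; rewrite in_itv/= !ltW.
Qed.

End ae_time.

Section induction.
Context (R : realType) (d : nat) (L : 'rV[R]_d) (T : R).
Hypotheses (L0 : forall i, 0 < L 0 i) (T0 : 0 < T).
Local Notation field := ('rV[R]_d -> 'rV[R]_d).
Local Notation leb := (@lebesgue_measure R).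
Local Notation D := (`]0%R, T[%classic : set R).
Implicit Types (u v w b : R -> field) (phi : R * 'rV[R]_d -> R).

Lemma fundamental_coefs_eq u u' i k : L2_L2 L T u -> L2_L2 L T u' ->
  (forall x y n, 0 < x -> y < T ->
     dist_of L T u i (cylinder L x y n k) = dist_of L T u' i (cylinder L x y n k)) ->
  {ae leb, forall t, D t -> coefs L (u t) k i = coefs L (u' t) k i}.
Proof.
move=> hu hu' uu'; have V0 := volume_gt0 L0.
have mD : measurable (D : set (measurableTypeR R)) by [].
have iu := ae_integrable_coefs L0 k i hu; have iu' := ae_integrable_coefs L0 k i hu'.
have : {ae leb, forall t, D t -> coefs L (u t) k i + -1 * coefs L (u' t) k i = 0}.
  apply: fundamental_lemma => //; first by apply: ae_integrableD => //; exact: ae_integrableZ.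
  move=> x y n x0 yT.
  have ix := ae_integrable_coefs_cutoff L0 i n k hu x0 yT.
  have ix' := ae_integrable_coefs_cutoff L0 i n k hu' x0 yT.
  transitivity (\int[leb]_(t in D) (coefs L (u t) k i * cutoff x y n t +
      -1 * (coefs L (u' t) k i * cutoff x y n t))).
    apply: eq_Rintegral => t _.
    by move: (coefs L (u t) k i) (coefs L (u' t) k i) (cutoff x y n t) => p q r; ring.
  rewrite (ae_RintegralD mD)//; last exact: ae_integrableZ.
  rewrite (ae_RintegralZ mD)// mulN1r; apply/eqP; rewrite subr_eq0; apply/eqP.
  have := uu' x y n x0 yT.
  rewrite (dist_of_cylinder L0 i n k hu x0 yT) (dist_of_cylinder L0 i n k hu' x0 yT).
  exact: (mulfI (lt0r_neq0 V0)).
by apply: filterS => t H Dt; apply/eqP; rewrite -subr_eq0 -mulN1r; apply/eqP; exact: H.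
Qed.

Lemma time_derivative_coefs u u' (c : 'I_d -> R) k : L2_L2 L T u -> L2_L2 L T u' ->
  (forall i, eq_dist L T (dist_of L T u' i) (dt (dist_of L T u i))) ->
  {ae leb, forall t, D t -> \sum_i c i * coefs L (u t) k i = 0} ->
  {ae leb, forall t, D t -> \sum_i c i * coefs L (u' t) k i = 0}.
Proof.
move=> hu hu' du u0; apply: (fundamental_coefs L0 T0) => // x y n x0 yT.
have := dist_of_cylinder_time L0 n hu x0 yT u0 => E.
apply: oppr_inj; rewrite oppr0 -[RHS]E -sumrN; apply: eq_bigr => i _.
rewrite (du i _ (test_function_cylinder L0 n k x0 yT)) /dt mulrN opprK//.
Qed.

Variables (eta : R) (F : 'rV[R]_d) (tau C : R).
Hypotheses (hd : d = 2%N \/ d = 3%N) (tau0 : 0 <= tau) (C0 : 0 < C)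
  (hF : diophantine L F tau C).

Section construction.
Variables (b db : R -> field).
Hypotheses (hb : L2_Hs L T (tau + 2) b) (hdb : L2_Hs L T tau db)
  (dbE : forall i, eq_dist L T (dist_of L T db i) (dt (dist_of L T b i)))
  (b_div : {ae leb, forall t, D t -> div_free L (b t)})
  (b_mean : {ae leb, forall t, D t -> zero_mean L (b t)}).

Let b2 : L2_L2 L T b. Proof. by apply: L2_Hs_L2 hb => //; rewrite addr_ge0. Qed.
Let db2 : L2_L2 L T db. Proof. exact: L2_Hs_L2 hdb. Qed.

Lemma residual_ex : exists w, [/\ L2_Hs L T tau w,
  (forall i, eq_dist L T (dist_of L T w i)
     (dt (dist_of L T b i) - eta *: laplacian (dist_of L T b i))),
  {ae leb, forall t, D t -> forall i, coefs L (w t) 0 i = 0} &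
  {ae leb, forall t, D t -> forall k, \sum_i wavenumber L k i * coefs L (w t) k i = 0}].
Proof.
have [K K0 HK] := laplacian_weight L eta tau.
(* [M (b t)] represents - eta times the Laplacian of [b t], as a multiplier from exponent tau + 2 to
   exponent tau. *)
have [M [ME MB]] := @bochner_multiplier R d L T L0
  (fun k => eta * \sum_j wavenumber L k j ^+ 2) id (tau + 2) tau K
  (fun k => erefl) (fun k => erefl) K0 tau0 HK (Hsper L tau) (Hs_sqnorm L tau)
  (fun f g _ _ h => h) (fun g _ => erefl) (@Hs_sqnorm_ge0 _ _ L tau).
have [hl _] := MB _ hb.
pose w t := db t + M (b t).
have hw : L2_Hs L T tau w by exact: L2_HsD.
have l2 : L2_L2 L T (fun t => M (b t)) by exact: L2_Hs_L2 hl.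
have w2 : L2_L2 L T w by exact: L2_Hs_L2 hw.
have [Xb _ _] := hb; have [Xdb _ _] := db2; have [Xb2 _ _] := b2.
have bM : {ae leb, forall t, D t ->
    multiplier L (fun k => eta * \sum_j wavenumber L k j ^+ 2) id (b t) (M (b t))}.
  by apply: filterS Xb => t Xb Dt; apply: ME; exact: Xb.
(* A linear constraint on the coefficients at one frequency passes from [b] to its time derivative,
   because [c] is constant in time, and to [M (b t)], because the multiplier is a scalar at each
   frequency. *)
have comb (c : 'I_d -> R) k : {ae leb, forall t, D t -> \sum_i c i * coefs L (b t) k i = 0} ->
    {ae leb, forall t, D t -> \sum_i c i * coefs L (w t) k i = 0}.
  move=> b0; have db0 := time_derivative_coefs b2 db2 dbE b0.
  apply: filterS (filterI (filterI b0 db0) (filterI Xdb bM)) => t [[bt dbt] [Xt Mt]] Dt.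
  have [hM ccM] := Mt Dt.
  under eq_bigr do rewrite (coefsD L0 _ _ (Xt Dt) hM) mulrDr.
  rewrite big_split /= (dbt Dt) add0r; under eq_bigr do rewrite ccM mulrCA.
  by rewrite -mulr_sumr /= (bt Dt) mulr0.
exists w; split=> //.
- move=> i phi test; have sp := smooth_periodic_test test.
  rewrite (dist_ofD L0 i db2 l2 w2 sp) (dbE i test).
  by rewrite (dist_of_laplacian L0 i b2 l2 bM sp) mulNr.
- have H i : {ae leb, forall t, D t -> coefs L (w t) 0 i = 0}.
    have cE (a : 'I_d -> R) : \sum_j (j == i)%:R * a j = a i.
      by rewrite (bigD1 i)//= eqxx mul1r big1 ?addr0// => j /negbTE ->; rewrite mul0r.
    have : {ae leb, forall t, D t -> \sum_j (j == i)%:R * coefs L (b t) 0 j = 0}.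
      by apply: filterS b_mean => t bt Dt; rewrite cE; exact: (zero_meanP L0 _).1 (bt Dt) i.
    by move=> /comb; apply: filterS => t Ht Dt; have := Ht Dt; rewrite cE.
  have /filter_forall := H; apply: filterS => t Ht Dt i; exact: Ht.
- have H k : {ae leb, forall t, D t -> \sum_i wavenumber L k i * coefs L (w t) k i = 0}.
    apply: comb; apply: filterS2 b_div Xb2 => t bt Xt Dt.
    exact: (div_freeP L0 (Xt Dt)).1 (bt Dt) k.
  by apply: filterS (ae_forall_countable H) => t Ht Dt k; exact: Ht.
Qed.

Lemma velocity_ex w : L2_Hs L T tau w ->
  {ae leb, forall t, D t -> forall i, coefs L (w t) 0 i = 0} ->
  {ae leb, forall t, D t -> forall k, \sum_i wavenumber L k i * coefs L (w t) k i = 0} ->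
  exists v, [/\ velocity_space L T v,
    (forall i phi, smooth_periodic L phi -> dist_of L T w i phi =
      - \sum_j F 0 j * dist_of L T v i ('D_(0 : R, delta_mx 0 j : 'rV[R]_d) phi)) &
    (bochner_norm (L2_sqnorm L) T v <=
       (2 * pi * C)^-1%:E * bochner_norm (Hs_sqnorm L tau) T w)%E].
Proof.
move=> hw w0 wdiv; have w2 : L2_L2 L T w by exact: L2_Hs_L2 hw.
have pC : 0 < 2 * pi * C by rewrite !mulr_gt0// pi_gt0.
have K0 : 0 < (2 * pi * C)^-1 ^+ 2 by rewrite exprn_gt0// invr_gt0.
pose m k := (\sum_j F 0 j * wavenumber L k j)^-1.
(* The inverse of 0 being 0, the multiplier itself selects the solution of mean zero. *)
have m0 : m 0 = 0.
  by rewrite /m big1 ?invr0// => j _; rewrite /wavenumber mxE mul0r mulr0 mulr0.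
have Mmean f g : Hsper L tau f -> multiplier L m -%R f g -> Hsper L 0 g -> L2per0 L g.
  move=> _ [hg gE] _; split=> //; apply/(zero_meanP L0) => i.
  by rewrite gE m0 mul0r.
have [M [ME MB]] := @bochner_multiplier R d L T L0 m -%R tau 0 _
  (@opprK _) (@sqnormZN R d) K0 (lexx 0) (transport_weight tau0 C0 hF)
  (L2per0 L) (L2_sqnorm L) Mmean (L2_sqnorm_Hs L0) (L2_sqnorm_ge0 L0).
have [hv vN] := MB _ hw; exists (fun t => M (w t)).
have [Xw _ _] := hw.
have wM : {ae leb, forall t, D t -> multiplier L m -%R (w t) (M (w t))}.
  by apply: filterS Xw => t Xt Dt; apply: ME; exact: Xt.
have v2 := L2per0_L2 L0 hv.
split.
- split=> //; apply: ae_closed_interval; apply: filterS2 wM wdiv => t Mt wt Dt.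
  have [hM cM] := Mt Dt; apply/(div_freeP L0 hM) => k.
  (* Since wavenumbers are odd, the divergence condition for the velocity at k is, up to sign and a
     scalar, the one for [w] at - k. *)
  under eq_bigr do rewrite cM mulrCA.
  rewrite -mulr_sumr [X in _ * X](_ : _ = 0) ?mulr0//; apply: oppr_inj.
  rewrite oppr0 -[RHS](wt Dt (- k)) -sumrN; apply: eq_bigr => i _.
  by rewrite wavenumberN mulNr.
- by move=> i phi sp; apply: (dist_of_transport L0 i w2 v2 w0 (transport_neq0 C0 hF) wM sp).
- rewrite /bochner_norm.
  have I0 : (0 <= \int[leb]_(t in D) Hs_sqnorm L tau (w t))%E.
    by apply: integral_ge0 => t _; exact: Hs_sqnorm_ge0.
  (* The multiplier bound concerns squared norms, so its constant is the square of the one in the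
     estimate. *)
  have -> : (2 * pi * C)^-1%:E = (((2 * pi * C)^-1 ^+ 2)%:E `^ 2^-1)%E.
    rewrite poweR_EFin powR12_sqrt ?sqr_ge0// sqrtr_sqr ger0_norm// invr_ge0 ltW//.
  rewrite -poweRM//; last by rewrite lee_fin sqr_ge0.
  apply: gt0_ler_poweR => //; rewrite in_itv/= leey andbT.
    by apply: integral_ge0 => t _; exact: L2_sqnorm_ge0.
  by rewrite mule_ge0// lee_fin sqr_ge0.
Qed.

End construction.

Lemma curl_cross_div_free v i phi : L2_L2 L T v ->
  {ae leb, forall t, D t -> div_free L (v t)} -> smooth_periodic L phi ->
  curl_cross (dist_of L T v) F i phi =
  - \sum_j F 0 j * dist_of L T v i ('D_(0 : R, delta_mx 0 j : 'rV[R]_d) phi).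
Proof.
by move=> hv dv sp; rewrite curl_crossE// (dist_of_div_free L0)// mulr0 addr0.
Qed.

(** Testing at frequency - k reads off the coefficient at k, multiplied by the symbol 2 pi
    F.g(k). *)
Lemma curl_cross_cylinder v i x y n k : L2_L2 L T v ->
  {ae leb, forall t, D t -> div_free L (v t)} -> 0 < x -> y < T ->
  curl_cross (dist_of L T v) F i (cylinder L x y n (- k)) =
  (\sum_j F 0 j * wavenumber L k j) * dist_of L T v i (cylinder L x y n k).
Proof.
move=> hv dv x0 yT.
have sp := smooth_periodic_test (test_function_cylinder L0 n (- k) x0 yT).
apply: etrans (curl_cross_div_free i hv dv sp) _.
rewrite mulr_suml -sumrN; apply: eq_bigr => j _.
by rewrite (dist_of_cylinder_space L0 i j n k hv x0 yT); ring.
Qed.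

(** For k != 0 the symbol is nonzero and can be cancelled, so the coefficients of the two fields
    agree; at k = 0 both vanish, the fields having mean zero. Countably many null sets are then
    merged. *)
Lemma velocity_unique v v' : velocity_space L T v -> velocity_space L T v' ->
  (forall i, eq_dist L T (curl_cross (dist_of L T v') F i) (curl_cross (dist_of L T v) F i)) ->
  {ae leb, forall t, D t -> ae_eq_field L (v' t) (v t)}.
Proof.
move=> [hv /ae_open_interval dv] [hv' /ae_open_interval dv'] E.
have v2 := L2per0_L2 L0 hv; have v2' := L2per0_L2 L0 hv'.
have [Xv _ _] := hv; have [Xv' _ _] := hv'.
have H k i : {ae leb, forall t, D t -> coefs L (v' t) k i = coefs L (v t) k i}.
  have [->|k0] := eqVneq k 0.
    apply: filterS2 Xv Xv' => t Xt Xt' Dt; have [_ zt] := Xt Dt; have [_ zt'] := Xt' Dt.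
    by rewrite ((zero_meanP L0 _).1 zt) ((zero_meanP L0 _).1 zt').
  apply: (fundamental_coefs_eq v2' v2) => x y n x0 yT.
  have := E i _ (test_function_cylinder L0 n (- k) x0 yT).
  rewrite (curl_cross_cylinder i n k v2' dv' x0 yT) (curl_cross_cylinder i n k v2 dv x0 yT).
  exact: (mulfI (transport_neq0 C0 hF k0)).
have Hi : {ae leb, forall t, forall p : 'rV[int]_d * 'I_d, D t ->
    coefs L (v' t) p.1 p.2 = coefs L (v t) p.1 p.2}.
  by apply: ae_forall_countable => p; exact: H.
apply: filterS3 Hi Xv Xv' => t Ht Xt Xt' Dt.
have [ht _] := Xt Dt; have [ht' _] := Xt' Dt.
by apply: ae_eq_fieldP => // k i; exact: Ht (k, i) Dt.
Qed.

End induction.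

Theorem theorem5 (R : realType) (d : nat) (hd : d = 2%N \/ d = 3%N)
  (L : 'rV[R]_d) (hL : forall i, 0 < L 0 i)
  (eta T : R) (heta : 0 < eta) (hT : 0 < T)
  (F : 'rV[R]_d) (tau C : R) (htau : d%:R - 1 <= tau) (hC : 0 < C)
  (hF : diophantine L F tau C)
  (b : R -> 'rV[R]_d -> 'rV[R]_d)
  (hb_L2 : L2_Hs L T (tau + 2) b)
  (hb_C : continuous_in_time (Hsper L (tau + 1)) (Hs_sqnorm L (tau + 1)) T b)
  (hb_dt : exists2 db, L2_Hs L T tau db &
    forall i, eq_dist L T (dist_of L T db i) (dt (dist_of L T b i)))
  (hb_div : {ae lebesgue_measure, forall t, t \in `[0, T] -> div_free L (b t)})
  (hb_mean : {ae lebesgue_measure, forall t, t \in `[0, T] ->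
    zero_mean L (b t)}) :
  exists v : R -> 'rV[R]_d -> 'rV[R]_d,
    [/\ velocity_space L T v,
        induction_equation L T eta F b v,
        forall v', velocity_space L T v' -> induction_equation L T eta F b v' ->
          {ae lebesgue_measure, forall t, t \in `]0, T[ ->
            ae_eq_field L (v' t) (v t)} &
        exists w, [/\ L2_Hs L T tau w,
          forall i, eq_dist L T (dist_of L T w i)
            (dt (dist_of L T b i) - eta *: laplacian (dist_of L T b i)) &
          (bochner_norm (L2_sqnorm L) T v <=
            (2 * pi * C)^-1%:E * bochner_norm (Hs_sqnorm L tau) T w)%E]].
Proof.
have tau0 : 0 <= tau.
  by apply: le_trans htau; rewrite subr_ge0 ler1n; case: hd => ->.
have b_div := ae_open_interval hb_div; have b_mean := ae_open_interval hb_mean.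
have b2 : L2_L2 L T b by apply: L2_Hs_L2 hb_L2 => //; rewrite addr_ge0.
have [db hdb dbE] := hb_dt.
have [w [hw wE w0 wdiv]] := residual_ex hL hT eta tau0 hb_L2 hdb dbE b_div b_mean.
have [v [hv vE vw]] := velocity_ex hL tau0 hC hF hw w0 wdiv.
have [hv2 /ae_open_interval vdiv] := hv; have v2 := L2per0_L2 hL hv2.
have [eq1 eq2] : induction_equation L T eta F b v.
  split=> [i|] phi test; have sp := smooth_periodic_test test.
    have := wE i phi test; rewrite (vE i phi sp) -(curl_cross_div_free hL F hd i v2 vdiv sp).
    by move=> /eqP; rewrite eq_sym subr_eq addrC => /eqP.
  rewrite /divergence fct_sumE; under eq_bigr do rewrite /dx.
  by rewrite sumrN (dist_of_div_free hL b2 b_div sp) oppr0.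
exists v; split=> //; last by exists w.
(* Both equations have the same time derivative and the same Laplacian term, so the two curl terms
   agree on every test function. *)
move=> v' hv' [eq' _]; apply: (velocity_unique hL hT hd hC hF hv hv') => i phi test.
exact: (@addrI _ (eta * laplacian (dist_of L T b i) phi) _ _
  (etrans (esym (eq' i phi test)) (eq1 i phi test))).
Qed.
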